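(* Let $\alpha\in\mathbb{J}$. Assume $\{S(t)\}_{t\ge0}$ is a semigroup in the scale and $P=\{P_1,\ldots,P_n\}\in\mathscr{P}_{\beta_1,\ldots,\beta_n,R}$. If $\{S(t)\}_{t\ge0}$ is analytic in $X^\alpha$ with sectorial generator, then $\{S_P(t)\}_{t\ge0}$ is analytic in $X^\alpha$ with sectorial generator (denoted $-L_P$).
   Context: Scale of spaces: $\mathbb{J}$ is a set of indices and $\{X^\gamma\}_{\gamma\in\mathbb{J}}$ a family of Banach spaces (norms $\|\cdot\|_\gamma$) that is topologically consistent: if a sequence in $X^\gamma\cap X^{\tilde\gamma}$ converges in both spaces, the limits coincide. A map $\mathtt{r}:\mathbb{J}\to\mathbb{R}$ (regularity index) is given and $d(\tilde\gamma,\gamma):=\mathtt{r}(\tilde\gamma)-\mathtt{r}(\gamma)$. $\{S(t)\}_{t\ge0}$ is a family of linear operators with $S(0)=I$ defined consistently on the spaces of the scale (if $u_0\in X^\gamma\cap X^{\tilde\gamma}$, the values of $S(t)u_0$ in the two spaces coincide). Smoothing: $\gamma\stackrel{S(t)}{\dashrightarrow}\tilde\gamma$ means that $d(\tilde\gamma,\gamma)\ge0$ and for any $T>0$ there is a constant $M=M(\gamma,\tilde\gamma,T)$ (nondecreasing in $T$) with $\|S(t)\|_{\mathcal{L}(X^\gamma,X^{\tilde\gamma})}\le M t^{-d(\tilde\gamma,\gamma)}$ for $0<t\le T$. $\gamma\stackrel{S(t)}{\leadsto}\tilde\gamma$ means that in addition $(0,\infty)\ni t\mapsto S(t)u_0\in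 X^{\tilde\gamma}$ is continuous for each $u_0\in X^\gamma$. $\{S(t)\}$ is a semigroup in the scale if for each $\gamma\in\mathbb{J}$ it is a (not necessarily $C^0$) semigroup in $X^\gamma$ and $\gamma\stackrel{S(t)}{\leadsto}\gamma$. Perturbations: for fixed $\alpha\in\mathbb{J}$, $R>0$ and $\beta\in\mathbb{J}$, $\mathscr{P}_{\beta,R}$ is the set of $P\in\mathcal{L}(X^\alpha,X^\beta)$ with $\|P\|_{\mathcal{L}(X^\alpha,X^\beta)}\le R$, where $\alpha,\beta$ satisfy $0\le d(\alpha,\beta)<1$ and $\beta\stackrel{S(t)}{\leadsto}\alpha$. $P=\{P_1,\ldots,P_n\}\in\mathscr{P}_{\beta_1,\ldots,\beta_n,R}$ means $P_i\in\mathscr{P}_{\beta_i,R}$ for each $i$. Perturbed family: $\mathcal{E}_\alpha:=\{\gamma\in\mathbb{J}:\mathtt{r}(\gamma)\in(\mathtt{r}(\alpha)-1,\mathtt{r}(\alpha)]\text{ and }\gamma\stackrel{S(t)}{\leadsto}\alpha\}$ (so $\alpha\in\mathcal{E}_\alpha$ when $S$ is a semigroup in the scale). $\mathcal{L}^\infty_{\alpha,\varepsilon}$ is the set of strongly measurable $\varphi:(0,\infty)\to X^\alpha$ with $\sup_{t\in(0,T]}t^\varepsilon\|\varphi(t)\|_\alpha<\infty$ for every $T>0$. For $\gamma\in\mathcal{E}_\alpha$ and $u_0\in X^\gamma$ there is a unique $u\in\mathcal{L}^\infty_{\alpha,d(\alpha,\gamma)}$ with $u(t)=S(t)u_0+\sum_{i=1}^n\int_0^tS(t-\tau)P_iu(\tau)\,d\tau$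 for all $t>0$; $S_P(t)u_0:=u(t)$ for $t>0$ and $S_P(0)u_0:=u_0$. Analytic semigroup with sectorial generator in a Banach space $X$: $\{S(t)\}$ is such if there is a linear operator $L$ with domain $D(L)\subset X$ (not necessarily dense) and $a_0\in\mathbb{R}$, $\theta_0\in(0,\pi/2)$ such that $\Sigma:=\mathbb{C}\setminus\overline{\{z\ne a_0:|\mathrm{Arg}(z-a_0)|<\theta_0\}}\subset\rho(L)$, $\sup_{\lambda\in\Sigma}|\lambda-a_0|\,\|(L-\lambda)^{-1}\|_{\mathcal{L}(X)}<\infty$, and $S(t)=\frac1{2\pi i}\int_{a_0+\Gamma_{r,\eta}}e^{-\lambda t}(L-\lambda)^{-1}d\lambda$ for $t>0$, where $\theta_0<\eta<\pi/2$, $r>0$ and $\Gamma_{r,\eta}=\{|\mathrm{Arg}\,\lambda|=\eta,|\lambda|\ge r\}\cup\{|\mathrm{Arg}\,\lambda|\ge\eta,|\lambda|=r\}$ is oriented with the lower ray traversed towards the arc and the upper ray away from it (clockwise around the sector). Then one writes $S(t)=e^{-Lt}$ and $-L$ is called the sectorial generator. *)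

(* Defs.v *)
From HB Require Import structures.
From mathcomp Require Import all_boot all_order all_algebra.
From mathcomp Require Import all_classical all_reals all_analysis.
From mathcomp Require Import complex.

Set Implicit Arguments.
Unset Strict Implicit.
Unset Printing Implicit Defensive.

Import Order.TTheory GRing.Theory Num.Theory.
Import numFieldNormedType.Exports.

Local Open Scope classical_set_scope.
Local Open Scope ring_scope.
Local Open Scope complex_scope.

(* All Banach spaces are over the complex field
   R[i], where R is a realType. *)

Section NormsAndIntegrals.
Variable R : realType.

(* The library norm of a normedModType R[i] takes its values in R[i]; they are
   real and nonnegative, so taking the real part loses nothing. *)
Definition rnorm (X : normedModType R[i]) (x : X) : R := complex.Re `|x|.

(* ||A|| <= c in L(X, Y), for a linear map A. *)
Definition opnorm_le (X Y : normedModType R[i]) (A : X -> Y) (c : R) : Prop :=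
  0 <= c /\ forall x, rnorm (A x) <= c * rnorm x.

Variable X : completeNormedModType R[i].

Definition simple_fun (s : R -> X) : Prop :=
  finite_set (range s) /\
  forall x, measurable (s @^-1` [set x] : set (measurableTypeR R)).

Definition simple_integrable (D : set R) (s : R -> X) : Prop :=
  simple_fun s /\
  forall x, x != 0 -> (lebesgue_measure (D `&` s @^-1` [set x]) < +oo)%E.

Definition simple_integral (D : set R) (s : R -> X) : X :=
  \sum_(x \in range s) (fine (lebesgue_measure (D `&` s @^-1` [set x])))%:C *: x.

(* Strong (Bochner) measurability for the Lebesgue measure. Simple functions are
   built on Borel sets; as convergence is only required almost everywhere, this
   is the same class as with Lebesgue measurable sets. *)
Definition strongly_measurable (D : set R) (f : R -> X) : Prop :=
  exists s : nat -> R -> X,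
    (forall n, simple_fun (s n)) /\
    {ae (@lebesgue_measure R), forall t, D t -> s ^~ t @ \oo --> f t}.

(* f is Bochner integrable on D and its integral over D is v. *)
Definition is_bochner_integral (D : set R) (f : R -> X) (v : X) : Prop :=
  strongly_measurable D f /\
  exists s : nat -> R -> X,
    [/\ forall n, simple_integrable D (s n),
        (fun n => \int[@lebesgue_measure R]_(t in D)
                     (rnorm (f t - s n t))%:E)%E @ \oo --> 0%E
      & (fun n => simple_integral D (s n)) @ \oo --> v].

End NormsAndIntegrals.

Section ComplexPlane.
Variable R : realType.

Definition expi (phi : R) : R[i] := cos phi +i* sin phi.

Definition cexp (z : R[i]) : R[i] :=
  (expR (complex.Re z))%:C * expi (complex.Im z).

(* Principal argument, in ]-pi, pi]. Its value at 0 is irrelevant. *)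
Definition Arg (z : R[i]) : R :=
  xget 0 [set phi : R | - pi < phi <= pi /\ z = `|z| * expi phi].

(* Complement of the closed sector with vertex a0 and half-angle theta0. *)
Definition sector_compl (a0 theta0 : R) : set R[i]^o :=
  ~` closure [set z : R[i]^o | z != a0%:C /\ `|Arg (z - a0%:C)| < theta0].

Variable X : completeNormedModType R[i].

(* v is the integral of f over a0 + Gamma_(r, eta). The lower ray is
   parametrized outwards, hence counted negatively; the arc is
   phi |-> a0 + r e^(-i phi), from angle -eta through -pi to -(2 pi - eta),
   which is eta modulo 2 pi. *)
Definition is_contour_integral (a0 r eta : R) (f : R[i] -> X) (v : X) : Prop :=
  exists lower arc upper : X,
    [/\ is_bochner_integral `]r, +oo[
          (fun s => expi (- eta) *: f (a0%:C + s%:C * expi (- eta))) lower,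
        is_bochner_integral `]eta, 2 * pi - eta[
          (fun phi => (- 'i%C * r%:C * expi (- phi)) *:
                      f (a0%:C + r%:C * expi (- phi))) arc,
        is_bochner_integral `]r, +oo[
          (fun s => expi eta *: f (a0%:C + s%:C * expi eta)) upper
      & v = - lower + arc + upper].

End ComplexPlane.

Section AnalyticSemigroups.
Variables (R : realType) (X : completeNormedModType R[i]).

(* An unbounded linear operator is given by its domain and a function whose
   values outside of the domain are irrelevant. *)
Record unbounded_operator := UnboundedOperator {
  dom : set X;
  opfun : X -> X;
  dom_zero : dom 0;
  dom_linear : forall (c : R[i]) x y, dom x -> dom y -> dom (c *: x + y);
  opfun_linear : forall (c : R[i]) x y, dom x -> dom y ->
    opfun (c *: x + y) = c *: opfun x + opfun y }.

(* (L - lam)^-1, meaningful when lam is in the resolvent set. *)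
Definition resolvent (L : unbounded_operator) (lam : R[i]) (y : X) : X :=
  xget 0 [set x | dom L x /\ opfun L x - lam *: x = y].

Definition resolvent_set (L : unbounded_operator) : set R[i] :=
  [set lam | (forall y, exists! x, dom L x /\ opfun L x - lam *: x = y) /\
             exists c, opnorm_le (resolvent L lam) c].

(* The integral representation is required for all admissible (r, eta); by
   Cauchy's theorem the contour integral does not depend on them. The operator
   integral is taken pointwise. *)
Definition sectorial_generator (T : R -> X -> X) (L : unbounded_operator) :
    Prop :=
  exists a0 theta0 : R,
    [/\ 0 < theta0 < pi / 2,
        sector_compl a0 theta0 `<=` resolvent_set L,
        exists M : R, forall lam : R[i], sector_compl a0 theta0 lam ->
          exists2 c, opnorm_le (resolvent L lam) c &
                     complex.Re `|lam - a0%:C| * c <= M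
      & forall r eta : R, 0 < r -> theta0 < eta < pi / 2 ->
        forall (t : R) (u : X), 0 < t -> exists2 v : X,
          is_contour_integral a0 r eta
            (fun lam => cexp (- lam * t%:C) *: resolvent L lam u) v
          & T t u = ((2 * pi)%:C * 'i%C)^-1 *: v].

(* T(t) = e^(-L t) for some sectorial L. *)
Definition analytic_semigroup (T : R -> X -> X) : Prop :=
  exists L, sectorial_generator T L.

End AnalyticSemigroups.

Section Scale.
Variables (R : realType) (J : Type) (X : J -> completeNormedModType R[i]).
(* The spaces of the scale are identified, through the injective linear maps
   iota, with subspaces of a common vector space V; this is what gives a
   meaning to their intersections. *)
Variables (V : lmodType R[i]) (iota : forall g, {linear X g -> V}).
Variable reg : J -> R.
(* S g t is S(t) acting in X^g. Only times t >= 0 matter. *)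
Variable S : forall g, R -> {linear X g -> X g}.

Definition topologically_consistent : Prop :=
  forall (g g' : J) (u : nat -> X g) (u' : nat -> X g') (a : X g) (a' : X g'),
    (forall n, iota g (u n) = iota g' (u' n)) ->
    u @ \oo --> a -> u' @ \oo --> a' -> iota g a = iota g' a'.

Definition consistent_operators : Prop :=
  forall (g g' : J) (t : R) (u : X g) (u' : X g'), 0 <= t ->
    iota g u = iota g' u' -> iota g (S g t u) = iota g' (S g' t u').

Definition dist (g' g : J) : R := reg g' - reg g.

(* The element of X^g' that coincides with x, if there is one. *)
Definition recast (g g' : J) (x : X g) : X g' :=
  xget 0 [set y | iota g' y = iota g x].

(* S(t) as a map from X^g to X^g'. *)
Definition S_between (g g' : J) (t : R) (u : X g) : X g' :=
  recast g' (S g t u).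

Definition smoothing (g g' : J) : Prop :=
  0 <= dist g' g /\
  exists M : R -> R,
    (forall T T' : R, 0 < T -> T <= T' -> M T <= M T') /\
    forall T t : R, 0 < t <= T ->
      (forall u : X g, exists v : X g', iota g' v = iota g (S g t u)) /\
      opnorm_le (@S_between g g' t) (M T * t `^ (- dist g' g)).

Definition csmoothing (g g' : J) : Prop :=
  smoothing g g' /\
  forall (u : X g) (t : R), 0 < t -> {for t, continuous (fun s : R => @S_between g g' s u)}.

Definition semigroup_in_scale : Prop :=
  forall g : J,
    [/\ forall u, S g 0 u = u,
        forall s t u, 0 <= s -> 0 <= t -> S g (s + t) u = S g s (S g t u)
      & csmoothing g g].

Definition perturbation_class (alpha beta : J) (rho : R)
    (P : X alpha -> X beta) : Prop :=
  [/\ 0 <= dist alpha beta < 1, csmoothing beta alpha & opnorm_le P rho].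

Variable alpha : J.

Definition Linfty (eps : R) (phi : R -> X alpha) : Prop :=
  strongly_measurable `]0, +oo[ phi /\
  forall T : R, 0 < T ->
    exists K : R, forall t, 0 < t <= T -> t `^ eps * rnorm (phi t) <= K.

Variables (n : nat) (beta : 'I_n -> J).
Variable P : forall i, {linear X alpha -> X (beta i)}.

Definition mild_solution (g : J) (u0 : X g) (u : R -> X alpha) : Prop :=
  Linfty (dist alpha g) u /\
  forall t : R, 0 < t -> exists I : 'I_n -> X alpha,
    (forall i, is_bochner_integral `]0, t[
       (fun tau => S_between alpha (t - tau) (P i (u tau))) (I i)) /\
    u t = S_between alpha t u0 + \sum_i I i.

(* The perturbed family in X^alpha; mild_solution determines u on ]0, +oo[. *)
Definition perturbed (t : R) (u0 : X alpha) : X alpha :=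
  if t == 0 then u0 else xget (fun=> 0) [set u | mild_solution u0 u] t.

End Scale.

(* Main.v *)
Require Import Defs.
From HB Require Import structures.
From mathcomp Require Import all_boot all_order all_algebra.
From mathcomp Require Import finmap.
From mathcomp Require Import all_classical all_reals all_analysis.
From mathcomp Require Import measurable_realfun complex.
From mathcomp Require Import ring lra.

(** Write L for the sectorial operator with S(t) = e^(-L t) in X = X^alpha, R(z)
    for (L - z)^-1, and BB(t) for the sum of the operators S(t) P_i from X to X;
    they satisfy S(s) BB(t) = BB(s + t) and, for t in bounded intervals,
    |BB(t)| <= C t^(-d) with d < 1.
    Formally the perturbed generator is -(L - P), with resolvent
    (1 - R(z) P)^-1 R(z), but P takes values in larger spaces and R(z) P has to
    be given a meaning in X. For very negative real z it is the Laplace transform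
    K(z) of BB, the integral of e^(z t) BB(t) over t > 0 (laplace). It satisfies
    K(z) - K(w) = (z - w) R(z) K(w) (laplace_res), and this identity itself
    defines a continuation KK(z) to the whole complement of the sector
    (laplace_ext). Since K(-nu) = O(nu^(-e)) for some e > 0, the same identity
    gives |KK(z)| -> 0 as |z| grows outside of the sector (laplace_ext_small).

    After moving the vertex of the sector to the left, |KK(z)| <= 1/2 outside of
    it, and RP(z) = (1 - KK(z))^-1 R(z) is an injective family that satisfies the
    resolvent identity and the decay estimate of a sectorial operator
    (perturbed_res_sectorial). Such a family is the resolvent of an operator, and
    its Dunford integral q(t) over the contour is an analytic semigroup with
    sectorial generator (sectorial_of_res). It remains to see that q(t) u is the
    mild solution of the perturbed problem with initial value u.

    For this let y = (L_P - m) q for a real number m far to the left, so that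
    q' = - y - m q and q = RP(m) y = R(m) y + KK(m) q. Differentiating
    S(t - s) q(s) with the help of this decomposition, all terms cancel except
    BB(t - s) q(s) (semigroup_contour_deriv). Integrating over 0 < s < t gives the
    mild equation (mild_contour), provided that S(t - s) q(s) tends to S(t) u and
    to q(t) at the two ends. The first limit holds because
    q(t) u - S(t) u is the contour integral of e^(-z t) KK(z) RP(z) u, and placing
    the vertex at distance 1/t makes it o(1) (contour_near); the second because
    S(s) K -> K uniformly as s -> 0. A weakly singular Gronwall argument shows
    that a mild solution is unique (volterra_zero, mild_uniq).

    All integrals are Bochner integrals of X-valued functions. The part of their
    theory that is needed, for integrands that are continuous on an open interval
    and have an integrable norm, is developed first, together with a version of
    the theorem of Cauchy for the contours at hand: holomorphy is replaced by a
    quadratic Taylor estimate (lip_deriv), and independence of the vertex follows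
    because a function with quadratic increments is constant (quad_const). *)

Set Implicit Arguments.
Unset Strict Implicit.
Unset Printing Implicit Defensive.

Import Order.TTheory GRing.Theory Num.Theory.
Import numFieldNormedType.Exports.

Local Open Scope classical_set_scope.
Local Open Scope ring_scope.
Local Open Scope complex_scope.

(** * Real-valued norms *)

Section Norms.
Context {R : realType}.
Notation C := R[i].
Notation cn := Normc.normc.

Lemma cnE (z : C) : `|z| = (cn z)%:C.
Proof. by case: z. Qed.

Lemma cn_ge0 (z : C) : 0 <= cn z.
Proof. by case: z => a b; rewrite sqrtr_ge0. Qed.

Lemma cnM (x y : C) : cn (x * y) = cn x * cn y.
Proof. exact: Normc.normcM. Qed.

Lemma cnD (x y : C) : cn (x + y) <= cn x + cn y.
Proof. by have := ler_normD x y; rewrite !cnE -rmorphD lecR. Qed.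

Lemma cnN (x : C) : cn (- x) = cn x.
Proof. by apply: complexI; rewrite -!cnE normrN. Qed.

Lemma cnBC (x y : C) : cn (x - y) = cn (y - x).
Proof. by rewrite -cnN opprB. Qed.

Lemma cnR (x : R) : cn x%:C = `|x|.
Proof. by rewrite /= expr0n addr0 sqrtr_sqr. Qed.

Lemma cn0 : cn (0 : C) = 0. Proof. exact: Normc.normc0. Qed.

Lemma cn_eq0 (x : C) : (cn x == 0) = (x == 0).
Proof. by apply/eqP/eqP => [/Normc.eq0_normc|->]; rewrite ?cn0. Qed.

Lemma cn_gt0 (x : C) : (0 < cn x) = (x != 0).
Proof. by rewrite lt0r cn_ge0 andbT cn_eq0. Qed.

Lemma cn_sqr (z : C) : cn z ^+ 2 = complex.Re z ^+ 2 + complex.Im z ^+ 2.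
Proof. by case: z => a b; rewrite sqr_sqrtr ?addr_ge0 ?sqr_ge0. Qed.

Lemma Re_le_cn (z : C) : `|complex.Re z| <= cn z.
Proof. by rewrite -lecR -cnE normc_ge_Re. Qed.

Context {X : normedModType C}.
Implicit Types x y : X.

Lemma normrnE x : `|x| = (rnorm x)%:C.
Proof. by rewrite /rnorm; have := normr_ge0 x; case: `|x| => a b; rewrite lecE /= => /andP[/eqP ->]. Qed.

Lemma rn_ge0 x : 0 <= rnorm x.
Proof. by rewrite -lecR -normrnE normr_ge0. Qed.

Lemma rnD x y : rnorm (x + y) <= rnorm x + rnorm y.
Proof. by have := ler_normD x y; rewrite !normrnE -rmorphD lecR. Qed.

Lemma rnN x : rnorm (- x) = rnorm x.
Proof. by rewrite /rnorm normrN. Qed.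

Lemma rnBC x y : rnorm (x - y) = rnorm (y - x).
Proof. by rewrite -rnN opprB. Qed.

Lemma rnB x y : rnorm (x - y) <= rnorm x + rnorm y.
Proof. by rewrite -(rnN y) rnD. Qed.

Lemma rnDB x y : rnorm x <= rnorm (x - y) + rnorm y.
Proof. by rewrite -{1}(subrK y x) rnD. Qed.

Lemma rn_tri z x y : rnorm (x - y) <= rnorm (x - z) + rnorm (z - y).
Proof. by rewrite -{1}(subrK z x) -addrA rnD. Qed.

Lemma rnZ (c : C) x : rnorm (c *: x) = cn c * rnorm x.
Proof. by have := normrZ c x; rewrite !normrnE cnE -rmorphM => /complexI. Qed.

Lemma rnZR (c : R) x : rnorm (c%:C *: x) = `|c| * rnorm x.
Proof. by rewrite rnZ cnR. Qed.

Lemma rn0 : rnorm (0 : X) = 0.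
Proof. by rewrite /rnorm normr0. Qed.

Lemma rn_eq0 x : (rnorm x == 0) = (x == 0).
Proof.
apply/eqP/eqP => [h|->]; last exact: rn0.
by apply/eqP; rewrite -normr_eq0 normrnE h.
Qed.

Lemma rn_le0 x : rnorm x <= 0 -> x = 0.
Proof. by move=> h; apply/eqP; rewrite -rn_eq0 eq_le h rn_ge0. Qed.

Lemma rn_small x y : (forall e : R, 0 < e -> rnorm (x - y) <= e) -> x = y.
Proof.
move=> h; apply/eqP; rewrite -subr_eq0; apply/eqP/rn_le0.
by apply/ler_addgt0Pr => e e0; rewrite add0r h.
Qed.

Lemma rn_sum (I : Type) (s : seq I) (Q : pred I) (F : I -> X) :
  rnorm (\sum_(i <- s | Q i) F i) <= \sum_(i <- s | Q i) rnorm (F i).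
Proof.
elim/big_ind2 : _ => [|x1 x2 y1 y2 h1 h2|//]; first by rewrite rn0.
by rewrite (le_trans (rnD _ _))// lerD.
Qed.

Lemma rn_dist x y : `|rnorm x - rnorm y| <= rnorm (x - y).
Proof.
rewrite ler_norml; apply/andP; split.
  by rewrite lerNl opprB lerBlDr rnBC rnDB.
by rewrite lerBlDr rnDB.
Qed.

End Norms.

Section Limits.
Context {R : realType} {X : normedModType R[i]}.

Lemma cvg_rnormP (T : Type) (F : set_system T) (FF : Filter F) (f : T -> X) (l : X) :
  (f @ F --> l) <-> (forall e : R, 0 < e -> \forall x \near F, rnorm (f x - l) < e).
Proof.
split=> [/cvgrPdist_lt h e e0|h].
  have e0' : 0 < e%:C by rewrite ltcR.
  move: (h _ e0'); apply: filterS => x.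
  by rewrite normrnE ltcR rnBC.
apply/cvgrPdist_lt => e e0.
have eE : e = (complex.Re e)%:C.
  by move: e0; case: e => a b; rewrite ltcE /= => /andP[/eqP -> _].
have e0' : 0 < complex.Re e by move: e0; rewrite eE ltcR.
move: (h _ e0'); apply: filterS => x hx.
by rewrite eE normrnE ltcR rnBC.
Qed.

(** Continuity at a point as an estimate with real radii: the norm of X has
    complex values, and this form spares the casts. *)
Definition cont_at (f : R -> X) (t : R) :=
  forall e : R, 0 < e -> exists2 d : R, 0 < d &
    forall s, `|s - t| < d -> rnorm (f s - f t) < e.

Lemma cont_atP (f : R -> X) t : {for t, continuous f} <-> cont_at f t.
Proof.
split=> [h e e0|h].
  have := (cvg_rnormP (F := nbhs t) _ _ _).1 h e e0.
  move=> [d /= d0 hd]; exists d => // s sd.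
  by apply: hd => /=; rewrite distrC.
apply/(cvg_rnormP (F := nbhs t)) => e e0; have [d d0 hd] := h e e0.
by exists d => //= s sd; apply: hd; rewrite distrC.
Qed.

Lemma cvgnP (u : nat -> X) (l : X) :
  (u @ \oo --> l) <-> (forall e : R, 0 < e -> exists N, forall n, (N <= n)%N -> rnorm (u n - l) < e).
Proof.
split=> [h e e0|h].
  have [N _ hN] := (cvg_rnormP (F := \oo) _ _ _).1 h e e0.
  by exists N.
by apply/(cvg_rnormP (F := \oo)) => e e0; have [N hN] := h e e0; exists N.
Qed.

End Limits.

Lemma cauchy_cvg_rnorm {R : realType} (X : completeNormedModType R[i]) (u : nat -> X) :
  (forall e : R, 0 < e -> exists N, forall n m, (N <= n)%N -> (N <= m)%N -> rnorm (u n - u m) < e) ->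
  exists l : X, u @ \oo --> l.
Proof.
move=> h; suff : cvg (u @ \oo) by move=> ?; exists (lim (u @ \oo)).
apply/cauchy_cvgP/cauchy_exP => e e0.
have eE : e = (complex.Re e)%:C.
  by move: e0; case: e => a b; rewrite ltcE /= => /andP[/eqP -> _].
have e0' : 0 < complex.Re e by move: e0; rewrite eE ltcR.
have [N hN] := h _ e0'; exists (u N), N => // n /= Nn.
by rewrite -ball_normE /ball_ /= eE normrnE ltcR; apply: hN.
Qed.

(** * Identities between linear combinations *)

Section LinearExpressions.
Context {K : comPzRingType} {X : lmodType K}.

Inductive lexp := LVar of nat | LZero | LAdd of lexp & lexp | LOpp of lexp | LScale of K & lexp.

Fixpoint leval (env : seq X) (e : lexp) : X :=
  match e with
  | LVar i => env`_i
  | LZero => 0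
  | LAdd e1 e2 => leval env e1 + leval env e2
  | LOpp e1 => - leval env e1
  | LScale c e1 => c *: leval env e1
  end.

Fixpoint lcoef (e : lexp) (i : nat) : K :=
  match e with
  | LVar j => if eqn j i then 1 else 0
  | LZero => 0
  | LAdd e1 e2 => lcoef e1 i + lcoef e2 i
  | LOpp e1 => - lcoef e1 i
  | LScale c e1 => c * lcoef e1 i
  end.

Lemma levalE env e : leval env e = \sum_(i < size env) lcoef e i *: env`_i.
Proof.
elim: e => [j||e1 h1 e2 h2|e1 h1|c e1 h1] /=.
- have [js|js] := ltnP j (size env).
    rewrite (bigD1 (Ordinal js))//= [eqn j j]eqxx scale1r big1 ?addr0// => i.
    by rewrite eq_sym -val_eqE /= -[eqn j i]/(j == i) => /negbTE ->; rewrite scale0r.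
  rewrite nth_default// big1// => i _.
  by rewrite -[eqn j i]/(j == i) gtn_eqF ?scale0r//; apply: leq_trans js.
- by rewrite big1// => i _; rewrite scale0r.
- by rewrite h1 h2 -big_split; apply: eq_bigr => i _; rewrite scalerDl.
- by rewrite h1 -sumrN; apply: eq_bigr => i _; rewrite scaleNr.
- by rewrite h1 scaler_sumr; apply: eq_bigr => i _; rewrite scalerA.
Qed.

Fixpoint lcoef_eq (n : nat) (e1 e2 : lexp) : Prop :=
  match n with
  | 0%N => True
  | n'.+1 => lcoef e1 n' = lcoef e2 n' /\ lcoef_eq n' e1 e2
  end.

(** Two linear combinations of the same vectors agree as soon as their
    coefficients do; this turns identities between vectors into ring identities
    between scalars. *)
Lemma leval_eq env e1 e2 : lcoef_eq (size env) e1 e2 -> leval env e1 = leval env e2.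
Proof.
move=> h; rewrite !levalE; apply: eq_bigr => i _; congr (_ *: _).
by elim: (size env) h (nat_of_ord i) (ltn_ord i) => // n IH [h1 h2] j;
  rewrite ltnS leq_eqVlt => /orP[/eqP ->|/IH]; last exact.
Qed.

End LinearExpressions.

Ltac vec_atoms t env :=
  lazymatch t with
  | GRing.add ?a ?b => let e := vec_atoms a env in vec_atoms b e
  | GRing.opp ?a => vec_atoms a env
  | GRing.scale _ ?a => vec_atoms a env
  | GRing.zero => env
  | _ => lazymatch env with
         | context [cons t _] => env
         | _ => constr:(cons t env)
         end
  end.
Ltac vec_index t env :=
  lazymatch env with
  | cons t _ => constr:(0%N)
  | cons _ ?r => let i := vec_index t r in constr:(i.+1)
  end.
Ltac vec_reify K t env :=
  lazymatch t with
  | GRing.add ?a ?b =>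
      let x := vec_reify K a env in let y := vec_reify K b env in constr:(LAdd x y)
  | GRing.opp ?a => let x := vec_reify K a env in constr:(LOpp x)
  | GRing.scale ?c ?a => let x := vec_reify K a env in constr:(@LScale K c x)
  | GRing.zero => constr:(@LZero K)
  | _ => let i := vec_index t env in constr:(@LVar K i)
  end.

(** The goals that remain equate the coefficients of each vector on both sides. *)
Ltac vec K X :=
  lazymatch goal with
  | |- ?a = ?b =>
      let e0 := vec_atoms a constr:(@nil X) in
      let env := vec_atoms b e0 in
      let x := vec_reify K a env in
      let y := vec_reify K b env in
      change (@leval K X env x = @leval K X env y);
      apply: leval_eq;
      cbv [lcoef_eq lcoef eqn size];
      do ?[split]; try exact: I
  end.

(** * Simple functions *)

Section Simple.
Context {R : realType}.
Notation mu := (@lebesgue_measure R).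

(** The integral of a nonnegative function is a supremum over the simple functions
    below it, hence monotone without any measurability. This matters because a
    Bochner integrable function is only almost everywhere a limit of Borel simple
    functions, and its norm need not be Borel. *)
Lemma le_integral_lower (D : set R) (f1 f2 : R -> \bar R) :
  (forall x, D x -> (0 <= f1 x)%E) -> (forall x, D x -> (f1 x <= f2 x)%E) ->
  (\int[mu]_(x in D) f1 x <= \int[mu]_(x in D) f2 x)%E.
Proof.
move=> f10 f12.
have f20 x : D x -> (0 <= f2 x)%E by move=> Dx; apply: le_trans (f12 x Dx); apply: f10.
rewrite !ge0_integralE //= ge_ereal_sup// => _ [h/= hf] <-.
apply: ereal_sup_ubound; exists h => //= x.
by apply: le_trans (hf x) _; apply: lee_restrict.
Qed.

Lemma le_integral_lowerS (D E : set R) (f : R -> \bar R) : D `<=` E ->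
  (forall x, E x -> (0 <= f x)%E) ->
  (\int[mu]_(x in D) f x <= \int[mu]_(x in E) f x)%E.
Proof.
move=> DE f0; rewrite integral_mkcond [leRHS]integral_mkcond.
apply: le_integral_lower => x _; first by apply: erestrict_ge0 => y /DE; exact: f0.
rewrite /patch; case: ifPn => [|_]; first by rewrite inE => /DE xE; rewrite mem_set.
by case: ifPn; rewrite ?lexx// inE => /f0.
Qed.

Context {X : completeNormedModType R[i]}.
Implicit Types (D : set R) (s : R -> X).

(** A simple integral may be computed over the fibers of any map with finitely many
    measurable fibers through which the function factors; sums of two functions are
    handled by factoring both through the pair. *)
Lemma simple_integral_index D (mD : measurable (D : set (measurableTypeR R))) (K : choiceType) (k : R -> K) (phi : K -> X) :
  finite_set (range k) ->
  (forall p, measurable (k @^-1` [set p] : set (measurableTypeR R))) ->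
  (forall p, phi p != 0 -> (mu (D `&` k @^-1` [set p]) < +oo)%E) ->
  simple_integral D (phi \o k) =
  \sum_(p \in range k) (fine (mu (D `&` k @^-1` [set p])))%:C *: phi p.
Proof.
move=> fk mk ffin; rewrite /simple_integral.
have -> : range (phi \o k) = phi @` range k by rewrite image_comp.
rewrite !fsbig_finite// ?finite_image//.
rewrite fset_set_image// (@partition_big_imfset _ _ _ _ _ phi)/=.
apply: eq_big_seq => x _.
under [RHS]eq_bigr => p /eqP -> do over.
rewrite -scaler_suml.
have [->|x0] := eqVneq x 0; first by rewrite !scaler0.
congr (_ *: _); rewrite -rmorph_sum/=; congr (_%:C).
pose F p := if phi p == x then D `&` k @^-1` [set p] else set0.
have -> : D `&` (phi \o k) @^-1` [set x] = \big[setU/set0]_(p <- fset_set (range k)) F p.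
  rewrite -bigcup_fset; apply/seteqP; split=> [t /= [Dt kt]|t [p /= _]].
    exists (k t); first by rewrite /= in_fset_set//; apply/mem_set; exists t.
    by rewrite /F kt eqxx.
  by rewrite /F; case: eqP => // <- [Dt ->].
rewrite measure_fbigsetU.
- rewrite -sum_fine; last first.
    move=> p _; rewrite /F; case: eqP => pE; last by rewrite measure0.
    by rewrite ge0_fin_numE//; apply: ffin; rewrite pE.
  by rewrite [RHS]big_mkcond/=; apply: eq_bigr => p _; rewrite /F; case: ifP; rewrite ?measure0.
- by move=> p _; rewrite /F; case: ifP => // _; apply: measurableI.
- move=> p q _ _ [t []]; rewrite /F; case: ifP => // _ [_ <-].
  by case: ifP => // _ [_ <-].
exact: finite_image.
Qed.

(** A finite measurable partition of the line, indexed by K. For K = X this is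
    simple_fun; booleans and pairs serve to restrict and to combine. *)
Definition simple_map (K : Type) (k : R -> K) :=
  finite_set (range k) /\ forall p, measurable (k @^-1` [set p] : set (measurableTypeR R)).

Lemma simple_map_preimage (K : choiceType) (k : R -> K) (Y : set K) :
  simple_map k -> measurable (k @^-1` Y : set (measurableTypeR R)).
Proof.
move=> [fk mk].
have -> : k @^-1` Y = \bigcup_(p in range k `&` Y) k @^-1` [set p].
  apply/seteqP; split=> [t /= Yt|t [p [_ Yp] /= kt]]; last by rewrite /preimage /= kt.
  by exists (k t).
apply: fin_bigcup_measurable => [|p _]; last exact: mk.
by apply: sub_finite_set fk => p [].
Qed.

Lemma simple_map_comp (K K' : choiceType) (k : R -> K) (phi : K -> K') :
  simple_map k -> simple_map (phi \o k).
Proof.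
move=> kf; split=> [|p].
  have [fk _] := kf; rewrite -(image_comp k phi); exact: finite_image.
by rewrite comp_preimage; apply: simple_map_preimage.
Qed.

Lemma simple_map_pair (K K' : choiceType) (k : R -> K) (k' : R -> K') :
  simple_map k -> simple_map k' -> simple_map (fun t => (k t, k' t)).
Proof.
move=> [fk mk] [fk' mk']; split=> [|[p q]].
  apply: sub_finite_set (finite_setX fk fk') => -[p q] [t _ [<- <-]].
  by split => /=; exists t.
rewrite (_ : _ @^-1` _ = k @^-1` [set p] `&` k' @^-1` [set q]).
  exact: measurableI.
by apply/seteqP; split=> t /= [-> ->].
Qed.

Lemma simple_map_measurable (K : choiceType) (k : R -> K) (phi : K -> R) (D : set R) :
  measurable (D : set (measurableTypeR R)) ->
  simple_map k -> measurable_fun (D : set (measurableTypeR R)) (phi \o k).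
Proof.
move=> mD kf _ Y mY; rewrite comp_preimage.
by apply: measurableI => //; exact: simple_map_preimage.
Qed.

Lemma simple_map_indic (D : set R) :
  measurable (D : set (measurableTypeR R)) -> simple_map (fun t => t \in D).
Proof.
move=> mD; split=> [|b]; first exact: finite_finset.
have -> : (fun t => t \in D) @^-1` [set b] = if b then D else ~` D.
  apply/seteqP; case: b; split=> t /=.
  - exact: set_mem.
  - exact: mem_set.
  - by move=> h Dt; rewrite mem_set in h.
  - exact: memNset.
by case: b => //; exact: measurableC.
Qed.

Lemma simple_integral_norm D s : measurable (D : set (measurableTypeR R)) -> simple_integrable D s ->
  ((rnorm (simple_integral D s))%:E <= \int[mu]_(t in D) (rnorm (s t))%:E)%E.
Proof.
move=> mD [[fs ms] fin].
have -> : (\int[mu]_(t in D) (rnorm (s t))%:E)%E =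
   (\int[mu]_(t in D) \sum_(x \in range s) (rnorm x * \1_(s @^-1` [set x]) t)%:E)%E.
  apply: eq_integral => t _; rewrite fsumEFin//; congr (_%:E).
  rewrite (fsbigD1 (s t))//=; last by exists t.
    rewrite indicE mem_set// mulr1 fsbig1 ?addr0// => x [_ /= xs].
    by rewrite indicE memNset ?mulr0// => /= h; apply: xs.
rewrite ge0_integral_fsum//; first last.
- by move=> x t _; rewrite lee_fin mulr_ge0// rn_ge0.
- move=> x; apply/measurable_EFinP; apply: measurable_funM => //.
under eq_fsbigr => x xs.
  under eq_integral do rewrite EFinM.
  rewrite ge0_integralZl_EFin//; first last.
  - exact: rn_ge0.
  - by apply/measurable_EFinP; exact: measurable_indic.
  rewrite integral_indic// setIC.
  over.
rewrite /= /simple_integral !fsbig_finite//.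
apply: (@le_trans _ _ (\sum_(x <- fset_set (range s)) (rnorm ((fine (mu (D `&` s @^-1` [set x])))%:C *: x))%:E)%E).
  by rewrite sumEFin lee_fin; apply: rn_sum.
apply: lee_sum => x _; rewrite rnZR ger0_norm; last exact: fine_ge0.
have [->|x0] := eqVneq x 0; first by rewrite rn0 mulr0 mul0e.
by rewrite mulrC EFinM fineK// ge0_fin_numE//; exact: fin.
Qed.

Lemma simple_integral_lin D (c : R[i]) s1 s2 : measurable (D : set (measurableTypeR R)) ->
  simple_integrable D s1 -> simple_integrable D s2 ->
  simple_integrable D (fun t => c *: s1 t + s2 t) /\
  simple_integral D (fun t => c *: s1 t + s2 t) =
  c *: simple_integral D s1 + simple_integral D s2.
Proof.
move=> mD [sf1 fin1] [sf2 fin2].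
have kf := simple_map_pair sf1 sf2.
have finp (p : X * X) : p <> (0, 0) ->
    (mu (D `&` (fun t => (s1 t, s2 t)) @^-1` [set p]) < +oo)%E.
  case: p => x y xy.
  have mp : measurable (D `&` (fun t => (s1 t, s2 t)) @^-1` [set (x, y)] : set (measurableTypeR R)).
    by apply: measurableI => //; case: kf.
  have [x0|x0] := eqVneq x 0.
    have y0 : y != 0 by apply/eqP => y0; apply: xy; rewrite x0 y0.
    apply: le_lt_trans (fin2 y y0); apply: le_measure; rewrite ?inE//.
      by apply: measurableI => //; case: sf2.
    by move=> t /= [Dt [_ ->]].
  apply: le_lt_trans (fin1 x x0); apply: le_measure; rewrite ?inE//.
    by apply: measurableI => //; case: sf1.
  by move=> t /= [Dt [-> _]].
have key (phi : X * X -> X) : phi (0, 0) = 0 ->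
    simple_integral D (fun t => phi (s1 t, s2 t)) =
    \sum_(p \in range (fun t => (s1 t, s2 t)))
      (fine (mu (D `&` (fun t => (s1 t, s2 t)) @^-1` [set p])))%:C *: phi p.
  move=> phi0; case: (kf) => fr mr; apply: (@simple_integral_index D mD _ (fun t => (s1 t, s2 t)) phi) => //.
  by move=> p /eqP phip; apply: finp => p0; apply: phip; rewrite p0.
split.
  split; first exact: (simple_map_comp (fun p : X * X => c *: p.1 + p.2) kf).
  move=> x x0.
  rewrite -ge0_fin_numE//.
  have -> : D `&` (fun t => c *: s1 t + s2 t) @^-1` [set x] =
    \bigcup_(p in range (fun t => (s1 t, s2 t)) `&` [set p | c *: p.1 + p.2 = x])
      (D `&` (fun t => (s1 t, s2 t)) @^-1` [set p]).
    apply/seteqP; split=> [t /= [Dt tx]|t [p [_ /= <-]] /= [Dt <-]//].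
    by exists (s1 t, s2 t) => //; split => //; exists t.
  rewrite measure_fin_bigcup//=.
  - rewrite fsbig_finite//=; last by apply: sub_finite_set kf.1 => ? [].
    apply/sum_fin_numP => p; rewrite in_fset_set; last by apply: sub_finite_set kf.1 => ? [].
    rewrite inE => -[_ /= px] _; rewrite ge0_fin_numE//; apply: finp => p0.
    by move: px; rewrite p0 /= scaler0 addr0 => px; rewrite -px eqxx in x0.
  - by apply: sub_finite_set kf.1 => ? [].
  - by move=> p q _ _ [t [[_ /= <-] [_ /= <-]]].
  - by move=> p _; apply: measurableI => //; case: kf.
rewrite (key (fun p => c *: p.1 + p.2)); last by rewrite /= scaler0 addr0.
have := key fst erefl; have := key snd erefl => /= -> ->.
case: kf => fr _.
rewrite !fsbig_finite// scaler_sumr -big_split/=; apply: eq_bigr => p _.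
by rewrite scalerDr !scalerA mulrC.
Qed.

End Simple.

(** * The Bochner integral *)

Import HBNNSimple.

Section Bochner.
Context {R : realType}.
Notation mu := (@lebesgue_measure R).
Notation cn := Normc.normc.
Notation mble D := (measurable (D : set (measurableTypeR R))).
Notation mfun D f := (measurable_fun (D : set (measurableTypeR R)) f).

(** Subadditivity needs only one measurable summand: a simple function below the
    sum, minus the measurable part, lies below the other summand. *)
Lemma lower_add (D : set R) (F p : R -> \bar R) (q : R -> R) : mble D ->
  (forall t, D t -> 0 <= F t)%E -> (forall t, D t -> 0 <= p t)%E ->
  (forall t, D t -> 0 <= q t) -> mfun D q ->
  (forall t, D t -> F t <= (q t)%:E + p t)%E ->
  (\int[mu]_(t in D) F t <= \int[mu]_(t in D) (q t)%:E + \int[mu]_(t in D) p t)%E.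
Proof.
move=> mD F0 p0 q0 mq Fqp.
rewrite ge0_integralE//; apply: ge_ereal_sup => _ [h /= hF <-].
have hD t : ~ D t -> h t = 0.
  move=> nDt; apply/eqP; rewrite eq_le; apply/andP; split; last by apply: fun_ge0.
  by have := hF t; rewrite patchE memNset.
have mh : mfun D h by apply: measurable_funTS.
have -> : sintegral mu h = (\int[mu]_(t in D) (h t)%:E)%E.
  rewrite -integralT_nnsfun [RHS]integral_mkcond; apply: eq_integral => t _.
  by rewrite patchE; case: ifPn => //; rewrite notin_setE => /hD ->.
pose w t := Num.max (h t - q t) 0.
have mw : mfun D w by apply: measurable_maxr => //; apply: measurable_funB.
have w0 t : 0 <= w t by rewrite le_max lexx orbT.
apply: (@le_trans _ _ (\int[mu]_(t in D) ((q t)%:E + (w t)%:E))%E).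
  apply: le_integral_lower => t Dt; first by rewrite lee_fin; apply: fun_ge0.
  by rewrite -EFinD lee_fin -lerBlDl le_max lexx.
rewrite ge0_integralD//; first last.
- exact/measurable_EFinP.
- by move=> t _; rewrite lee_fin.
- exact/measurable_EFinP.
apply: leeD => //; apply: le_integral_lower => t Dt; first by rewrite lee_fin.
have := hF t; rewrite patchE mem_set// => hFt.
rewrite /w; have [|_] := lerP (h t - q t) 0; first by move=> _; apply: p0.
have := le_trans hFt (Fqp t Dt); case: (p t) (p0 t Dt) => [x||]//; rewrite ?leey// -EFinD !lee_fin => _.
by rewrite lerBlDl.
Qed.

Context {X : completeNormedModType R[i]}.
Implicit Types (D : set R) (f s : R -> X).

(** Limits everywhere, and not only almost everywhere, of simple functions: the
    norms of such functions are Borel, so that dominated convergence applies. *)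
Definition simple_limit D f := exists s : nat -> R -> X,
  (forall n, simple_fun (s n)) /\ forall t, D t -> s ^~ t @ \oo --> f t.

Lemma simple_limit_measurable D f s : mble D -> simple_limit D f -> simple_fun s ->
  mfun D (fun t => rnorm (f t - s t)).
Proof.
move=> mD [u [us uf]] ss.
apply: (@measurable_fun_cvg _ _ _ _ (fun n t => rnorm (u n t - s t))).
  move=> n; apply: (simple_map_measurable (fun p : X * X => rnorm (p.1 - p.2)) mD (simple_map_pair (us n) ss)).
move=> t Dt; apply/cvgrPdist_lt => e e0.
have [N hN] := (cvgnP _ _).1 (uf t Dt) e e0; exists N => // n /= Nn.
apply: le_lt_trans (hN n Nn); rewrite distrC; apply: le_trans (rn_dist _ _) _.
by rewrite opprB addrA subrK.
Qed.

Lemma simple_fun0 : simple_fun (fun _ => 0 : X).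
Proof.
have := simple_map_comp (fun _ => 0 : X) (simple_map_indic (@measurableT _ (measurableTypeR R))).
by [].
Qed.

Lemma simple_limit_norm_measurable D f : mble D -> simple_limit D f -> mfun D (fun t => rnorm (f t)).
Proof.
move=> mD nf; have := simple_limit_measurable mD nf simple_fun0.
by under eq_fun do rewrite subr0.
Qed.

(** The integrand is dominated but not assumed to have a measurable norm; an
    arbitrary mild solution can be estimated only in this way. *)
Lemma is_bochner_norm_le D f v (g : R -> R) : mble D -> is_bochner_integral D f v ->
  mfun D g -> (forall t, D t -> rnorm (f t) <= g t) ->
  ((rnorm v)%:E <= \int[mu]_(t in D) (g t)%:E)%E.
Proof.
move=> mD [_ [s [si sf sv]]] mg fg.
have g0 t : D t -> 0 <= g t by move=> Dt; apply: le_trans (fg t Dt); apply: rn_ge0.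
have [oo|fin] := eqVneq (\int[mu]_(t in D) (g t)%:E)%E +oo%E; first by rewrite oo leey.
apply/lee_addgt0Pr => e e0.
have e20 : 0 < e / 2 by rewrite divr_gt0.
have [N hN] := (cvgnP _ _).1 sv _ e20.
have /fine_cvgP [[N1 _ hN1] /cvgrPdist_lt /(_ _ e20) [N2 _ hN2]] := sf.
pose n := maxn N (maxn N1 N2).
have n1 : (N1 <= n)%N by rewrite /n !leq_max leqnn ?orbT.
have n2 : (N2 <= n)%N by rewrite /n !leq_max leqnn ?orbT.
have n0 : (N <= n)%N by rewrite /n !leq_max leqnn ?orbT.
have h1 : rnorm v <= rnorm (simple_integral D (s n)) + e / 2.
  have := rnDB v (simple_integral D (s n)); rewrite rnBC => /le_trans; apply.
  by rewrite addrC lerD2l; apply/ltW/hN.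
have h2 := simple_integral_norm mD (si n).
have h3 : (\int[mu]_(t in D) (rnorm (s n t))%:E <= \int[mu]_(t in D) (g t)%:E +
    \int[mu]_(t in D) (rnorm (f t - s n t))%:E)%E.
  apply: lower_add => //; [by move=> t _; rewrite lee_fin rn_ge0..|move=> t Dt].
  by rewrite -EFinD lee_fin addrC rnBC (le_trans (rnDB _ (f t)))// rnBC lerD2l fg.
have h4 : (\int[mu]_(t in D) (rnorm (f t - s n t))%:E <= (e / 2)%:E)%E.
  have := hN2 n n2; have := hN1 n n1 => /= fn; rewrite sub0r normrN => h.
  by rewrite -[leLHS]fineK// lee_fin; apply: le_trans (ler_norm _) (ltW h).
apply: (@le_trans _ _ ((rnorm (simple_integral D (s n)) + e / 2)%:E)); first by rewrite lee_fin.
rewrite EFinD (splitr e) EFinD addeA; apply: leeD => //.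
apply: le_trans h2 _; apply: le_trans h3 _; exact: leeD.
by rewrite -splitr.
Qed.

(** One function is required to be a limit everywhere, so that its distance to
    simple functions is measurable and the distances can be added. *)
Lemma is_bochner_lin D f1 f2 v1 v2 (c : R[i]) : mble D ->
  is_bochner_integral D f1 v1 -> is_bochner_integral D f2 v2 -> simple_limit D f2 ->
  is_bochner_integral D (fun t => c *: f2 t + f1 t) (c *: v2 + v1).
Proof.
move=> mD [m1 [s1 [si1 sf1 sv1]]] [m2 [s2 [si2 sf2 sv2]]] nf2.
have lim_lin (x y : nat -> X) a b : x @ \oo --> a -> y @ \oo --> b ->
    (fun n => c *: x n + y n) @ \oo --> c *: a + b.
  move=> xa yb; apply/cvgnP => e e0.
  pose k := cn c + 1.
  have k0 : 0 < k by rewrite ltr_wpDl// cn_ge0.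
  have [N hN] := (cvgnP _ _).1 xa (e / 2 / k) (divr_gt0 (divr_gt0 e0 (ltr0Sn _ _)) k0).
  have [M hM] := (cvgnP _ _).1 yb (e / 2) (divr_gt0 e0 (ltr0Sn _ _)).
  exists (maxn N M) => n; rewrite geq_max => /andP[/hN h1 /hM h2].
  rewrite opprD addrACA -scalerBr (splitr e); apply: le_lt_trans (rnD _ _) _.
  apply: ler_ltD h2; rewrite rnZ.
  apply: (@le_trans _ _ (k * (e / 2 / k))); last by rewrite mulrCA divff ?mulr1// gt_eqF.
  by apply: ler_pM; rewrite ?cn_ge0 ?rn_ge0// ?(ltW h1)// lerDl.
split.
  case: m1 => u1 [us1 uf1]; case: m2 => u2 [us2 uf2].
  exists (fun n t => c *: u2 n t + u1 n t); split.
    move=> n; exact: (simple_map_comp (fun p : X * X => c *: p.1 + p.2) (simple_map_pair (us2 n) (us1 n))).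
  have FF : Filter (nbhs (almost_everywhere mu)) by exact: (ae_filter_ringOfSetsType (mu : {measure set (measurableTypeR R) -> \bar R})).
  by apply: filterS2 uf1 uf2 => t h1 h2 Dt; apply: lim_lin; [exact: h2|exact: h1].
exists (fun n t => c *: s2 n t + s1 n t); split.
- by move=> n; case: (simple_integral_lin c mD (si2 n) (si1 n)).
- apply: (@squeeze_cvge _ _ _ _ (cst 0%E) _ (fun n =>
   (cn c)%:E * \int[mu]_(t in D) (rnorm (f2 t - s2 n t))%:E + \int[mu]_(t in D) (rnorm (f1 t - s1 n t))%:E)%E).
  + apply: nearW => n; apply/andP; split.
      by apply: integral_ge0 => t _; rewrite lee_fin rn_ge0.
    have mf : mfun D (fun t => rnorm (f2 t - s2 n t)) by apply: simple_limit_measurable => //; case: (si2 n).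
    rewrite -ge0_integralZl_EFin//; last 3 first.
    * by move=> t _; rewrite lee_fin rn_ge0.
    * exact/measurable_EFinP.
    * exact: cn_ge0.
    under [X in (_ <= X + _)%E]eq_integral do rewrite -EFinM.
    apply: lower_add => //.
    * by move=> t _; rewrite lee_fin rn_ge0.
    * by move=> t _; rewrite lee_fin rn_ge0.
    * by move=> t _; rewrite mulr_ge0 ?cn_ge0 ?rn_ge0.
    * exact: measurable_funM.
    * move=> t _; rewrite -EFinD lee_fin opprD addrACA -scalerBr -rnZ; exact: rnD.
  + exact: cvg_cst.
  + have h2 : ((cn c)%:E * \int[mu]_(t in D) (rnorm (f2 t - s2 n t))%:E)%E @[n --> \oo] --> ((cn c)%:E * 0)%E.
      exact: cvgeZl.
    have := cvgeD _ h2 sf1; rewrite mule0 adde0; exact.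
- have := lim_lin _ _ _ _ sv2 sv1; apply: cvg_trans; apply: near_eq_cvg.
  by apply: nearW => n; case: (simple_integral_lin c mD (si2 n) (si1 n)) => _ ->.
Qed.

Lemma is_bochner_unique D f v1 v2 : mble D -> simple_limit D f ->
  is_bochner_integral D f v1 -> is_bochner_integral D f v2 -> v1 = v2.
Proof.
move=> mD nf b1 b2; have b := is_bochner_lin (-1) mD b2 b1 nf.
have := @is_bochner_norm_le _ _ _ (cst 0) mD b.
rewrite integral0_eq// lee_fin => /(_ (measurable_cst _)) h.
apply/eqP; rewrite -subr_eq0; apply/eqP/rn_le0.
rewrite rnBC -scaleN1r addrC; apply: h => t Dt.
by rewrite scaleN1r addNr rn0.
Qed.

End Bochner.

Section Existence.
Context {R : realType}.
Notation mu := (@lebesgue_measure R).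
Notation cn := Normc.normc.
Notation mble D := (measurable (D : set (measurableTypeR R))).
Notation mfun D f := (measurable_fun (D : set (measurableTypeR R)) f).

Lemma cvge0P (u : nat -> \bar R) : (forall n, (0 <= u n)%E) ->
  (u @ \oo --> 0%E) <-> (forall e : R, 0 < e -> exists N, forall n, (N <= n)%N -> (u n <= e%:E)%E).
Proof.
move=> u0; split=> [h e e0|h].
  have /fine_cvgP [[N1 _ hN1] /cvgrPdist_lt /(_ _ e0) [N2 _ hN2]] := h.
  exists (maxn N1 N2) => n; rewrite geq_max => /andP[n1 n2].
  have := hN2 n n2; have := hN1 n n1 => /= fn; rewrite sub0r normrN => hh.
  by rewrite -[leLHS]fineK// lee_fin; apply: le_trans (ler_norm _) (ltW hh).
apply/fine_cvgP; split.
  have [N hN] := h 1 ltr01; exists N => // n /= /hN un.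
  by rewrite ge0_fin_numE//; apply: le_lt_trans un _; rewrite ltry.
apply/cvgrPdist_le => e e0; have [N hN] := h e e0; exists N => // n /= /hN un.
rewrite sub0r normrN ger0_norm ?fine_ge0//.
by rewrite -lee_fin fineK// ge0_fin_numE//; apply: le_lt_trans un _; rewrite ltry.
Qed.

Context {X : completeNormedModType R[i]}.
Implicit Types (D : set R) (f s : R -> X).

Lemma simple_integral_cauchy D f (s : nat -> R -> X) : mble D -> simple_limit D f ->
  (forall n, simple_integrable D (s n)) ->
  (\int[mu]_(t in D) (rnorm (f t - s n t))%:E)%E @[n --> \oo] --> 0%E ->
  exists v : X, simple_integral D (s n) @[n --> \oo] --> v.
Proof.
move=> mD nf si sf; apply: cauchy_cvg_rnorm => e e0.
have e30 : 0 < e / 3 by rewrite divr_gt0.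
have [|N hN] := (cvge0P _).1 sf (e / 3) e30.
  by move=> n; apply: integral_ge0 => t _; rewrite lee_fin rn_ge0.
exists N => n m /hN hn /hN hm.
have [i1 i2] := simple_integral_lin (-1) mD (si m) (si n).
have := simple_integral_norm mD i1; rewrite i2 scaleN1r addrC => h.
rewrite -lte_fin; apply: le_lt_trans h _.
apply: (@le_lt_trans _ _ ((e / 3)%:E + (e / 3)%:E)%E); last first.
  by rewrite -EFinD lte_fin; lra.
apply: le_trans (leeD hm hn).
apply: lower_add => //.
- by move=> t _; rewrite lee_fin rn_ge0.
- by move=> t _; rewrite lee_fin rn_ge0.
- by move=> t _; rewrite rn_ge0.
- by apply: simple_limit_measurable => //; case: (si m).
- move=> t _; rewrite -EFinD lee_fin scaleN1r [- _ + _]addrC.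
  by apply: le_trans (rn_tri (f t) _ _) _; rewrite (rnBC (s n t)) addrC.
Qed.

(** Dominated convergence, for simple functions truncated to the sets where they
    are at most twice as large as f and where the variable is bounded; the truncation
    keeps the pointwise limit. *)
Lemma is_bochner_exists D f : mble D -> simple_limit D f ->
  (\int[mu]_(t in D) (rnorm (f t))%:E < +oo)%E -> exists v, is_bochner_integral D f v.
Proof.
move=> mD nf fin; have [s [ss sf]] := nf.
have mnf := simple_limit_norm_measurable mD nf.
(* where the approximation is at most twice as large as f, in a bounded set *)
pose E n := (D `&` (fun t => 2 * rnorm (f t) - rnorm (s n t)) @^-1` `[0, +oo[) `&` `[- n%:R, n%:R].
have mE n : mble (E n).
  apply: measurableI => //.
  have mg : mfun D (fun t => 2 * rnorm (f t) - rnorm (s n t)).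
    apply: measurable_funB; first exact: measurable_funM.
    exact: (simple_map_measurable (@rnorm R X) mD (ss n)).
  by apply: mg => //; exact: measurable_itv.
have inE n t : E n t <-> [/\ D t, rnorm (s n t) <= 2 * rnorm (f t) & `|t| <= n%:R].
  rewrite /E /= !in_itv /= andbT subr_ge0 -ler_norml.
  by split=> [[[? ?] ?]|[? ? ?]].
pose w n t := if t \in E n then s n t else 0.
have sw n : simple_integrable D (w n).
  have mw : simple_fun (w n).
    exact: (simple_map_comp (fun p : bool * X => if p.1 then p.2 else 0) (simple_map_pair (simple_map_indic (mE n)) (ss n))).
  split=> // x x0.
  apply: (@le_lt_trans _ _ (mu `[- n%:R, n%:R])).
    apply: le_measure; rewrite ?mem_set//; first by apply: measurableI => //; case: mw.
    move=> t /= [Dt wx]; move: x0; rewrite -wx /w; case: ifPn => [|_]; last by rewrite eqxx.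
    by move=> /set_mem /inE [_ _]; rewrite ler_norml in_itv.
  by rewrite lebesgue_measure_itv; case: ifP => _; rewrite ?ltry// -EFinB ltry.
have w2 n t : D t -> rnorm (w n t) <= 2 * rnorm (f t).
  move=> Dt; rewrite /w; case: ifPn => [/set_mem /inE []//|_].
  by rewrite rn0 mulr_ge0// rn_ge0.
have wf t : D t -> w ^~ t @ \oo --> f t.
  move=> Dt; apply/cvgnP => e e0.
  have [M hM] : exists M : nat, forall n, (M <= n)%N -> `|t| <= n%:R.
    exists (Num.trunc `|t|).+1 => n Mn; apply: (@le_trans _ _ (Num.trunc `|t|).+1%:R).
      by apply/ltW/truncnS_gt.
    by rewrite ler_nat.
  have [f0|f0] := eqVneq (rnorm (f t)) 0.
    exists 0%N => n _; have := w2 n t Dt; rewrite f0 mulr0 => /rn_le0 ->.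
    by rewrite sub0r rnN f0.
  have fp : 0 < rnorm (f t) by rewrite lt0r f0 rn_ge0.
  have [N1 hN1] := (cvgnP _ _).1 (sf t Dt) e e0.
  have [N2 hN2] := (cvgnP _ _).1 (sf t Dt) _ fp.
  exists (maxn M (maxn N1 N2)) => n; rewrite !geq_max => /andP[/hM h1 /andP[/hN1 h2 /hN2 h3]].
  suff -> : w n t = s n t by [].
  rewrite /w mem_set//; apply/inE; split => //.
  apply: le_trans (rnDB _ (f t)) _; apply: le_trans (lerD (ltW h3) (lexx _)) _; lra.
have sw0 : (\int[mu]_(t in D) (rnorm (f t - w n t))%:E)%E @[n --> \oo] --> 0%E.
  have mfw n : mfun D (fun t => rnorm (f t - w n t)).
    by apply: simple_limit_measurable => //; case: (sw n).
  have := @dominated_convergence _ _ _ mu D mD (fun n t => (rnorm (f t - w n t))%:E) (cst 0%E)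
     (fun t => (3 * rnorm (f t))%:E).
  case.
  - by move=> n; apply/measurable_EFinP.
  - exact: measurable_cst.
  - apply: aeW => t Dt; apply/cvge0P; first by move=> n; rewrite lee_fin rn_ge0.
    move=> e e0; have [N hN] := (cvgnP _ _).1 (wf t Dt) e e0.
    by exists N => n /hN h; rewrite lee_fin rnBC ltW.
  - apply/integrableP; split; first by apply/measurable_EFinP; apply: measurable_funM.
    under eq_integral => t _ do rewrite gee0_abs ?lee_fin ?mulr_ge0 ?rn_ge0// EFinM.
    rewrite ge0_integralZl_EFin//.
    + by rewrite lte_mul_pinfty// ?lee_fin.
    + by move=> t _; rewrite lee_fin rn_ge0.
    + exact/measurable_EFinP.
  - apply: aeW => t n Dt; rewrite gee0_abs ?lee_fin ?rn_ge0//.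
    apply: le_trans (rnB _ _) _; have := w2 n t Dt; lra.
  - by move=> _ _; rewrite integral_cst// mul0e.
have [v hv] := simple_integral_cauchy mD nf sw sw0.
exists v; split; last by exists w.
by exists s; split => //; apply: aeW.
Qed.

(** One sequence of simple functions computes all three integrals. *)
Lemma is_bochner_split D D1 D2 f v : mble D -> mble D1 -> mble D2 ->
  D1 `<=` D -> D2 `<=` D ->
  (forall E, mble E -> mu (D `&` E) = (mu (D1 `&` E) + mu (D2 `&` E))%E) ->
  simple_limit D f -> is_bochner_integral D f v ->
  exists v1 v2, [/\ is_bochner_integral D1 f v1, is_bochner_integral D2 f v2 & v = v1 + v2].
Proof.
move=> mD m1 m2 D1D D2D mD12 nf [[u [us uf]] [s [si sf sv]]].
have sub D' : mble D' -> D' `<=` D -> exists2 v',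
    is_bochner_integral D' f v' & simple_integral D' (s n) @[n --> \oo] --> v'.
  move=> mD' D'D.
  have nf' : simple_limit D' f by case: nf => w [? h]; exists w; split=> // t /D'D; apply: h.
  have si' n : simple_integrable D' (s n).
    have [ssn fin] := si n; split=> // x x0; apply: le_lt_trans (fin x x0).
    have ms : mble (s n @^-1` [set x]) by case: ssn.
    by apply: le_measure; rewrite ?mem_set//; [exact: measurableI|exact: measurableI|apply: setSI].
  have sf' : (\int[mu]_(t in D') (rnorm (f t - s n t))%:E)%E @[n --> \oo] --> 0%E.
    apply: (@squeeze_cvge _ _ _ _ (cst 0%E) _ (fun n => (\int[mu]_(t in D) (rnorm (f t - s n t))%:E)%E)) => //.
      apply: nearW => n; apply/andP; split.
        by apply: integral_ge0 => t _; rewrite lee_fin rn_ge0.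
      by apply: le_integral_lowerS => // t _; rewrite lee_fin rn_ge0.
    exact: cvg_cst.
  have [v' hv'] := simple_integral_cauchy mD' nf' si' sf'.
  exists v' => //; split; last by exists s.
  exists u; split=> //.
  have FF : Filter (nbhs (almost_everywhere mu)) by exact: (ae_filter_ringOfSetsType (mu : {measure set (measurableTypeR R) -> \bar R})).
  by apply: filterS uf => t h /D'D; apply: h.
have [v1 b1 h1] := sub D1 m1 D1D; have [v2 b2 h2] := sub D2 m2 D2D.
exists v1, v2; split => //.
have h12 : simple_integral D (s n) @[n --> \oo] --> v1 + v2.
  have -> : (fun n => simple_integral D (s n)) = (fun n => simple_integral D1 (s n) + simple_integral D2 (s n)).
    apply/funext => n; have [[fs ms] fin] := si n.
    rewrite /simple_integral !fsbig_finite// -big_split/=; apply: eq_bigr => x _.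
    have [->|x0] := eqVneq x 0; first by rewrite !scaler0 addr0.
    rewrite -scalerDl -rmorphD; congr (_%:C *: _).
    have := fin x x0; rewrite mD12// => fx.
    rewrite fineD// ge0_fin_numE//; apply: le_lt_trans fx.
      exact: leeDl.
    exact: leeDr.
  exact: cvgD.
exact: (cvg_unique _ sv h12).
Qed.

(** Sampling at the points of a fine grid approximates any function that is
    continuous on a set by simple functions. *)
Lemma cont_simple_limit D f :
  (forall t, D t -> cont_at f t) -> simple_limit D f.
Proof.
move=> cf.
pose k (n : nat) (t : R) : int := if t \in `[(- n%:R : R), n%:R]%classic then Num.floor (t * n.+1%:R) else 0.
have mk n : simple_map (k n).
  have mfl (p : int) : mble [set t : R | Num.floor (t * n.+1%:R) = p].
    rewrite (_ : [set _ | _] = `[p%:~R / n.+1%:R, (p + 1)%:~R / n.+1%:R[%classic).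
      exact: measurable_itv.
    apply/seteqP; split=> t /=; rewrite in_itv/= ler_pdivrMr ?ltr_pdivlMr ?ltr0Sn//.
      by move=> <-; rewrite floor_le floorD1_gt.
    by move=> h; apply/eqP; rewrite floor_eq.
  split.
    pose M : nat := (n * n.+1).+1.
    apply: (@sub_finite_set _ _ ((fun i : nat => i%:Z - M%:Z) @` `I_(M + M).+1)); last first.
      by apply: finite_image; exact: finite_II.
    move=> _ [t _ <-]; rewrite /k; case: ifPn => [/set_mem|_]; last first.
      by exists M => //=; [rewrite ltnS leq_addr|rewrite subrr].
    rewrite /= in_itv /= => /andP[t1 t2].
    set p := Num.floor _.
    have ME : (M%:Z)%:~R = n%:R * n.+1%:R + 1 :> R by rewrite -pmulrn /M -[in LHS](@natr1 _ (n * n.+1)%N) natrM.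
    have p1 : (- M%:Z <= p)%R.
      rewrite floor_ge_int rmorphN/= lerNl ME.
      have : - t * n.+1%:R <= n%:R * n.+1%:R by rewrite ler_wpM2r// lerNl.
      by rewrite mulNr => h; apply: le_trans h _; rewrite lerDl.
    have p2 : (p <= M%:Z)%R.
      rewrite -(ler_int R); apply: le_trans (floor_le _) _.
      rewrite ME; apply: (@le_trans _ _ (n%:R * n.+1%:R)); first by rewrite ler_wpM2r.
      by rewrite lerDl.
    exists (absz (p + M%:Z)) => /=.
      rewrite ltnS -lez_nat gez0_abs; last by rewrite -lerBlDr sub0r.
      by rewrite PoszD lerD2r.
    by rewrite gez0_abs ?addrK// -lerBlDr sub0r.
  move=> p.
  have -> : k n @^-1` [set p] = (`[(- n%:R : R), n%:R]%classic `&` [set t : R | Num.floor (t * n.+1%:R) = p])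
     `|` (~` `[(- n%:R : R), n%:R]%classic `&` (if p == 0 then setT else set0)).
    apply/seteqP; split=> t /=; rewrite /k.
      case: ifPn => [/set_mem ? ?|/negP nt <-]; first by left.
      right; split; last by rewrite eqxx.
      by move=> h; apply: nt; rewrite mem_set.
    case=> [[h1 <-]|[h1]]; first by rewrite mem_set.
    by rewrite memNset//; case: eqP.
  apply: measurableU; apply: measurableI => //.
    by apply: measurableC; exact: measurable_itv.
  by case: ifP.
pose q n t : R := (k n t)%:~R / n.+1%:R.
exists (fun n t => f (q n t)); split.
  move=> n; exact: (simple_map_comp (fun p : int => f (p%:~R / n.+1%:R)) (mk n)).
move=> t Dt; apply/cvgnP => e e0.
have [d d0 hd] := cf t Dt e e0.
pose M := maxn (Num.trunc `|t|).+1 (Num.trunc d^-1).+1.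
exists M => n; rewrite geq_max => /andP[n1 n2]; apply: hd.
have tn : `|t| <= n%:R.
  by apply: le_trans (ltW (truncnS_gt _)) _; rewrite ler_nat.
rewrite /q /k mem_set; last by rewrite /= in_itv/= -ler_norml.
have n0 : (0 : R) < n.+1%:R by [].
have -> : (Num.floor (t * n.+1%:R))%:~R / n.+1%:R - t = ((Num.floor (t * n.+1%:R))%:~R - t * n.+1%:R) / n.+1%:R.
  by rewrite mulrBl mulfK// gt_eqF.
rewrite normrM normfV [X in _ / X]ger0_norm// ltr_pdivrMr//.
apply: (@le_lt_trans _ _ 1).
  have := floor_le (t * n.+1%:R); have := floorD1_gt (t * n.+1%:R).
  rewrite intrD => h1 h2; rewrite ler_norml; lra.
rewrite mulrC -ltr_pdivrMr// div1r; apply: lt_trans (truncnS_gt _) _.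
by rewrite ltr_nat ltnS.
Qed.

End Existence.

(** * Integrals of continuous functions *)

Section Ccont.
Context {R : realType}.
Notation cn := Normc.normc.
Context {X : normedModType R[i]}.
Implicit Types (f g : R -> X).

Lemma cont_at_lin (c : R[i]) f g t : cont_at f t -> cont_at g t -> cont_at (fun s => c *: f s + g s) t.
Proof.
move=> /cont_atP cf /cont_atP cg; apply/cont_atP.
by apply: cvgD => //; apply: cvgZl_tmp.
Qed.

Lemma cont_atD f g t : cont_at f t -> cont_at g t -> cont_at (fun s => f s + g s) t.
Proof. by move=> /cont_atP cf /cont_atP cg; apply/cont_atP; apply: cvgD. Qed.

Lemma cont_atZl (c : R[i]) f t : cont_at f t -> cont_at (fun s => c *: f s) t.
Proof. by move=> /cont_atP cf; apply/cont_atP; apply: cvgZl_tmp. Qed.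

Lemma cont_at_cst (x : X) t : cont_at (fun _ => x) t.
Proof. by move=> e e0; exists 1 => // s _; rewrite subrr rn0. Qed.

Lemma cont_atZ (p : R -> R[i]) f t :
  (forall e : R, 0 < e -> exists2 d : R, 0 < d & forall s, `|s - t| < d -> cn (p s - p t) < e) ->
  cont_at f t -> cont_at (fun s => p s *: f s) t.
Proof.
move=> cp /cont_atP cf; apply/cont_atP; apply: cvgZ => //.
apply/(@cvg_rnormP R R[i]^o) => e e0; have [d d0 hd] := cp e e0.
have rnE (z : R[i]) : rnorm (z : R[i]^o) = cn z by case: z.
by exists d => //= s; rewrite /= distrC rnE; exact: hd.
Qed.

Lemma cont_at_lip f t (c : R) (A : X -> X) :
  (forall x y, rnorm (A x - A y) <= c * rnorm (x - y)) -> cont_at f t -> cont_at (fun s => A (f s)) t.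
Proof.
move=> hA cf e e0.
pose k := `|c| + 1; have k0 : 0 < k by rewrite ltr_wpDl.
have [d d0 hd] := cf (e / k) (divr_gt0 e0 k0); exists d => // s /hd h.
apply: le_lt_trans (hA _ _) _.
apply: (@le_lt_trans _ _ (k * rnorm (f s - f t))).
  by rewrite ler_wpM2r ?rn_ge0// (le_trans (ler_norm c))// lerDl.
by rewrite mulrC -ltr_pdivlMr.
Qed.

End Ccont.

Section IntOp.
Context {R : realType}.
Notation mu := (@lebesgue_measure R).
Notation cn := Normc.normc.
Notation mble D := (measurable (D : set (measurableTypeR R))).
Notation mfun D f := (measurable_fun (D : set (measurableTypeR R)) f).
Context {X : completeNormedModType R[i]}.
Implicit Types (D : set R) (f s : R -> X).

(** A total operator, meaningful on the class of integrands that follows. *)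
Definition bochner D f : X := xget 0 [set v | is_bochner_integral D f v].

(** Membership in this class suffices for the existence and the uniqueness of the
    integral, and it is stable under all constructions below. *)
Definition cont_integrable D f := (forall t, D t -> cont_at f t) /\
  (\int[mu]_(t in D) (rnorm (f t))%:E < +oo)%E.

Lemma cont_integrable_simple_limit D f : cont_integrable D f -> simple_limit D f.
Proof. by move=> [cf _]; apply: cont_simple_limit. Qed.

Lemma bochnerP D f : mble D -> cont_integrable D f -> is_bochner_integral D f (bochner D f).
Proof.
move=> mD cf; have [v hv] := is_bochner_exists mD (cont_integrable_simple_limit cf) cf.2.
exact: (xgetPex 0 (ex_intro _ v hv)).
Qed.

Lemma bochner_eq D f v : mble D -> cont_integrable D f -> is_bochner_integral D f v -> bochner D f = v.
Proof. by move=> mD cf hv; apply: (is_bochner_unique mD (cont_integrable_simple_limit cf) (bochnerP mD cf) hv). Qed.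

Lemma cont_integrable_dom D f (g : R -> R) : mble D -> (forall t, D t -> cont_at f t) ->
  (forall t, D t -> rnorm (f t) <= g t) ->
  (\int[mu]_(t in D) (g t)%:E < +oo)%E -> cont_integrable D f.
Proof.
move=> mD cf fg gi; split => //; apply: le_lt_trans gi; apply: le_integral_lower => t Dt.
  by rewrite lee_fin rn_ge0.
by rewrite lee_fin fg.
Qed.

Lemma cont_integrable_lin D (c : R[i]) f1 f2 : mble D -> cont_integrable D f1 -> cont_integrable D f2 ->
  cont_integrable D (fun t => c *: f2 t + f1 t).
Proof.
move=> mD c1 c2; split; first by move=> t Dt; apply: cont_at_lin; [apply: c2.1|apply: c1.1].
have m1 := simple_limit_norm_measurable mD (cont_integrable_simple_limit c1).
have m2 := simple_limit_norm_measurable mD (cont_integrable_simple_limit c2).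
apply: (@le_lt_trans _ _ (\int[mu]_(t in D) ((cn c * rnorm (f2 t))%:E + (rnorm (f1 t))%:E))%E).
  apply: le_integral_lower => t Dt; first by rewrite lee_fin rn_ge0.
  by rewrite -EFinD lee_fin -rnZ rnD.
rewrite ge0_integralD//.
- under eq_integral do rewrite EFinM.
  rewrite ge0_integralZl_EFin ?cn_ge0//; last 2 first.
  + by move=> t _; rewrite lee_fin rn_ge0.
  + exact/measurable_EFinP.
  apply: lte_add_pinfty; last exact: c1.2.
  by apply: lte_mul_pinfty; rewrite ?lee_fin ?cn_ge0//; exact: c2.2.
- by move=> t _; rewrite lee_fin mulr_ge0 ?cn_ge0 ?rn_ge0.
- by apply/measurable_EFinP; apply: measurable_funM.
- by move=> t _; rewrite lee_fin rn_ge0.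
- exact/measurable_EFinP.
Qed.

Lemma bochner_lin D (c : R[i]) f1 f2 : mble D -> cont_integrable D f1 -> cont_integrable D f2 ->
  bochner D (fun t => c *: f2 t + f1 t) = c *: bochner D f2 + bochner D f1.
Proof.
move=> mD c1 c2; apply: bochner_eq => //; first exact: cont_integrable_lin.
by apply: is_bochner_lin => //; [apply: bochnerP|apply: bochnerP|apply: cont_integrable_simple_limit].
Qed.

Lemma is_bochner0 D : mble D -> is_bochner_integral D (fun _ => 0 : X) 0.
Proof.
move=> mD; have si : simple_integrable D (fun _ => 0 : X).
  split; first exact: simple_fun0.
  move=> x x0; rewrite (_ : D `&` _ = set0) ?measure0//.
  by apply/seteqP; split => t //= [_ h]; rewrite -h eqxx in x0.
split; first by exists (fun _ _ => 0); split => [_|]; [exact: simple_fun0|apply: aeW => t _; exact: cvg_cst].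
exists (fun _ _ => 0); split => //.
  rewrite (_ : (fun n : nat => _) = cst 0%E); first exact: cvg_cst.
  by apply/funext => n; rewrite integral0_eq// => t _; rewrite subrr rn0.
rewrite (_ : (fun n : nat => _) = cst 0); first exact: cvg_cst.
apply/funext => n; rewrite /simple_integral fsbig1// => x [t _ <-].
by rewrite scaler0.
Qed.

Lemma cont_integrable0 D : mble D -> cont_integrable D (fun _ => 0).
Proof.
move=> mD; split; first by move=> t _; apply: cont_at_cst.
by rewrite integral0_eq// => t _; rewrite rn0.
Qed.

Lemma bochner0 D : mble D -> bochner D (fun _ => 0) = 0.
Proof. by move=> mD; apply: bochner_eq => //; [apply: cont_integrable0|apply: is_bochner0]. Qed.

Lemma cont_integrableZ D (c : R[i]) f : mble D -> cont_integrable D f -> cont_integrable D (fun t => c *: f t).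
Proof.
move=> mD cf; have := cont_integrable_lin c mD (cont_integrable0 mD) cf.
by under eq_fun do rewrite addr0.
Qed.

Lemma bochnerZ D (c : R[i]) f : mble D -> cont_integrable D f -> bochner D (fun t => c *: f t) = c *: bochner D f.
Proof.
move=> mD cf; have := bochner_lin c mD (cont_integrable0 mD) cf; rewrite bochner0// addr0 => <-.
by congr bochner; apply/funext => t; rewrite addr0.
Qed.

Lemma cont_integrableD D f1 f2 : mble D -> cont_integrable D f1 -> cont_integrable D f2 -> cont_integrable D (fun t => f1 t + f2 t).
Proof.
move=> mD c1 c2; have := cont_integrable_lin 1 mD c2 c1.
by under eq_fun do rewrite scale1r.
Qed.

Lemma bochnerD D f1 f2 : mble D -> cont_integrable D f1 -> cont_integrable D f2 ->
  bochner D (fun t => f1 t + f2 t) = bochner D f1 + bochner D f2.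
Proof.
move=> mD c1 c2; have := bochner_lin 1 mD c2 c1; rewrite scale1r => <-.
by congr bochner; apply/funext => t; rewrite scale1r.
Qed.

Lemma cont_integrable_sum D (I : Type) (r : seq I) (F : I -> R -> X) : mble D ->
  (forall i, cont_integrable D (F i)) -> cont_integrable D (fun t => \sum_(i <- r) F i t) /\
  bochner D (fun t => \sum_(i <- r) F i t) = \sum_(i <- r) bochner D (F i).
Proof.
move=> mD cF; elim: r => [|i r [IH1 IH2]].
  by under eq_fun do rewrite big_nil; rewrite big_nil; split; [apply: cont_integrable0|apply: bochner0].
under eq_fun do rewrite big_cons; rewrite big_cons; split; first exact: cont_integrableD.
by rewrite bochnerD// IH2.
Qed.

Lemma bochner_norm D f (g : R -> R) (c : R) : mble D -> cont_integrable D f -> mfun D g ->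
  (forall t, D t -> rnorm (f t) <= g t) ->
  (\int[mu]_(t in D) (g t)%:E <= c%:E)%E -> rnorm (bochner D f) <= c.
Proof.
move=> mD cf mg fg gc; rewrite -lee_fin; apply: le_trans gc.
exact: (is_bochner_norm_le mD (bochnerP mD cf)).
Qed.

Definition bounded_lin (A : X -> X) (c : R) :=
  (forall a x y, A (a *: x + y) = a *: A x + A y) /\
  (forall x, rnorm (A x) <= c * rnorm x).

Section Blin.
Context (A : X -> X) (c : R).
Hypothesis bA : bounded_lin A c.

Lemma bounded_lin0 : A 0 = 0.
Proof. by have := bA.1 (-1) 0 0; rewrite scaler0 add0r scaleN1r addNr. Qed.

Lemma bounded_linD x y : A (x + y) = A x + A y.
Proof. by have := bA.1 1 x y; rewrite !scale1r. Qed.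

Lemma bounded_linZ a x : A (a *: x) = a *: A x.
Proof. by have := bA.1 a x 0; rewrite !addr0 bounded_lin0 addr0. Qed.

Lemma bounded_linN x : A (- x) = - A x.
Proof. by rewrite -scaleN1r bounded_linZ scaleN1r. Qed.

Lemma bounded_linB x y : A (x - y) = A x - A y.
Proof. by rewrite bounded_linD bounded_linN. Qed.

Lemma bounded_lin_sum (I : Type) (r : seq I) (F : I -> X) : A (\sum_(i <- r) F i) = \sum_(i <- r) A (F i).
Proof. by elim: r => [|i r IH]; rewrite ?big_nil ?big_cons ?bounded_lin0// bounded_linD IH. Qed.

Lemma bounded_lin_lip x y : rnorm (A x - A y) <= c * rnorm (x - y).
Proof. by rewrite -bounded_linB; exact: bA.2. Qed.

Lemma bounded_lin_cont_at f t : cont_at f t -> cont_at (fun x => A (f x)) t.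
Proof. exact: cont_at_lip bounded_lin_lip. Qed.

Lemma bounded_lin_cvg (u : nat -> X) l : u @ \oo --> l -> (fun n => A (u n)) @ \oo --> A l.
Proof.
move=> /cvgnP ul; apply/cvgnP => e e0.
pose k := `|c| + 1; have k0 : 0 < k by rewrite ltr_wpDl.
have [N hN] := ul (e / k) (divr_gt0 e0 k0); exists N => n /hN h.
apply: le_lt_trans (bounded_lin_lip _ _) _.
apply: (@le_lt_trans _ _ (k * rnorm (u n - l))).
  by rewrite ler_wpM2r ?rn_ge0// (le_trans (ler_norm c))// lerDl.
by rewrite mulrC -ltr_pdivlMr.
Qed.

Lemma cont_integrable_bounded_lin D f : mble D -> cont_integrable D f -> cont_integrable D (fun t => A (f t)).
Proof.
move=> mD cf; have mf := simple_limit_norm_measurable mD (cont_integrable_simple_limit cf).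
apply: (@cont_integrable_dom _ _ (fun t => `|c| * rnorm (f t))) => //.
- by move=> t Dt; apply: bounded_lin_cont_at; apply: cf.1.
- by move=> t Dt; apply: le_trans (bA.2 _) _; rewrite ler_wpM2r ?rn_ge0// ler_norm.
- under eq_integral do rewrite EFinM.
  rewrite ge0_integralZl_EFin//.
  + by apply: lte_mul_pinfty; rewrite ?lee_fin//; exact: cf.2.
  + by move=> t _; rewrite lee_fin rn_ge0.
  + exact/measurable_EFinP.
Qed.

Lemma bochner_bounded_lin D f : mble D -> cont_integrable D f -> bochner D (fun t => A (f t)) = A (bochner D f).
Proof.
move=> mD cf; apply: bochner_eq => //; first exact: cont_integrable_bounded_lin.
have nf := cont_integrable_simple_limit cf; have [[u [us uf]] [s [si sf sv]]] := bochnerP mD cf.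
split.
  exists (fun n t => A (u n t)); split; first by move=> n; exact: (simple_map_comp A (us n)).
  have FF : Filter (nbhs (almost_everywhere mu)) by exact: (ae_filter_ringOfSetsType (mu : {measure set (measurableTypeR R) -> \bar R})).
  by apply: filterS uf => t h /h; apply: bounded_lin_cvg.
have fr n : [/\ simple_integrable D (fun t => A (s n t)) &
    simple_integral D (fun t => A (s n t)) = A (simple_integral D (s n))].
  have [[fs ms] fin] := si n.
  have e : simple_integral D (fun t => A (s n t)) =
      \sum_(p \in range (s n)) (fine (mu (D `&` s n @^-1` [set p])))%:C *: A p.
    apply: (@simple_integral_index _ _ D mD _ (s n) A) => //.
    by move=> p Ap; apply: fin; apply: contraNneq Ap => ->; rewrite bounded_lin0.
  split; last first.
    rewrite e /simple_integral !fsbig_finite// bounded_lin_sum.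
    by apply: eq_bigr => p _; rewrite bounded_linZ.
  split; first exact: (simple_map_comp A (si n).1).
  move=> x x0; rewrite -ge0_fin_numE//.
  have -> : D `&` (fun t => A (s n t)) @^-1` [set x] =
    \bigcup_(p in range (s n) `&` [set p | A p = x]) (D `&` s n @^-1` [set p]).
    apply/seteqP; split=> [t /= [Dt tx]|t [p [_ /= <-]] /= [Dt <-]//].
    by exists (s n t) => //; split => //; exists t.
  have ff : finite_set (range (s n) `&` [set p | A p = x]) by apply: sub_finite_set fs => ? [].
  rewrite measure_fin_bigcup//=.
  - rewrite fsbig_finite//=; apply/sum_fin_numP => p; rewrite in_fset_set// => /set_mem [_ /= px] _.
    by rewrite ge0_fin_numE//; apply: fin; apply: contraNneq x0 => p0; rewrite -px p0 bounded_lin0.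
  - by move=> p q _ _ [t [[_ /= <-] [_ /= <-]]].
  - by move=> p _; apply: measurableI.
exists (fun n t => A (s n t)); split.
- by move=> n; case: (fr n).
- have mf n : mfun D (fun t => rnorm (f t - s n t)) by apply: simple_limit_measurable => //; case: (si n).
  have h : (`|c|%:E * \int[mu]_(t in D) (rnorm (f t - s n t))%:E)%E @[n --> \oo] --> 0%E.
    by have := cvgeZl (isT : `|c|%:E \is a fin_num) sf; rewrite mule0.
  apply: squeeze_cvge h; last exact: cvg_cst.
  apply: nearW => n; apply/andP; split.
    by apply: integral_ge0 => t _; rewrite lee_fin rn_ge0.
  rewrite -ge0_integralZl_EFin//.
  + apply: le_integral_lower => t _; first by rewrite lee_fin rn_ge0.
    rewrite -EFinM lee_fin; apply: le_trans (bounded_lin_lip _ _) _.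
    by rewrite ler_wpM2r ?rn_ge0// ler_norm.
  + by move=> t _; rewrite lee_fin rn_ge0.
  + exact/measurable_EFinP.
- have -> : (fun n => simple_integral D (fun t => A (s n t))) = (fun n => A (simple_integral D (s n))).
    by apply/funext => n; case: (fr n).
  exact: bounded_lin_cvg.
Qed.

End Blin.

Lemma is_bochner_ext D f1 f2 v : (forall t, D t -> f1 t = f2 t) ->
  is_bochner_integral D f1 v -> is_bochner_integral D f2 v.
Proof.
move=> h [[u [us uf]] [s [si sf sv]]]; split.
  exists u; split=> //.
  have FF : Filter (nbhs (almost_everywhere mu)) by exact: (ae_filter_ringOfSetsType (mu : {measure set (measurableTypeR R) -> \bar R})).
  by apply: filterS uf => t ht Dt; rewrite -h//; apply: ht.
exists s; split => //.
rewrite (_ : (fun n => _) = (fun n => \int[mu]_(t in D) (rnorm (f1 t - s n t))%:E)%E)//.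
by apply/funext => n; apply: eq_integral => t /set_mem Dt; rewrite h.
Qed.

Lemma bochner_ext D f1 f2 : (forall t, D t -> f1 t = f2 t) -> bochner D f1 = bochner D f2.
Proof.
move=> h; rewrite /bochner; congr xget; apply/seteqP; split=> v; apply: is_bochner_ext => // t Dt.
by rewrite h.
Qed.

End IntOp.

(** * Calculus on open intervals *)

Section Intervals.
Context {R : realType}.
Notation mu := (@lebesgue_measure R).
Notation cn := Normc.normc.
Notation mble D := (measurable (D : set (measurableTypeR R))).
Notation mfun D f := (measurable_fun (D : set (measurableTypeR R)) f).

(** None stands for an upper end at infinity: the rays and the arc of the contour
    are treated alike. *)
Definition oitv (a : R) (b : option R) : set R :=
  [set` Interval (BRight a) (if b is Some c then BLeft c else +oo%O)].

Definition below (x : R) (b : option R) : bool := if b is Some c then x < c else true.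

Lemma oitvP a b x : oitv a b x <-> (a < x /\ below x b).
Proof.
rewrite /oitv /=; case: b => [c|]; rewrite in_itv /= ?andbT; first by split=> [/andP[]|[-> ->]].
by split=> [|[]].
Qed.

Lemma measurable_oitv a b : mble (oitv a b). Proof. exact: measurable_itv. Qed.

Lemma below_trans x y b : x <= y -> below y b -> below x b.
Proof. by case: b => //= c; apply: le_lt_trans. Qed.

(** The fundamental theorem is available on segments, from which one passes to
    open intervals, bounded or not. *)
Lemma oitv_exhaust a b m : oitv a b m -> exists x y : nat -> R,
  [/\ forall n, [/\ oitv a b (x n), oitv a b (y n) & x n < y n],
      forall n p, (n <= p)%N -> x p <= x n /\ y n <= y p &
      forall t, oitv a b t -> exists N, forall n, (N <= n)%N -> x n <= t <= y n].
Proof.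
move=> /oitvP [am mb].
pose x n := a + (m - a) / n.+2%:R.
have ma0 : 0 < m - a by rewrite subr_gt0.
have xa n : a < x n by rewrite /x ltrDl divr_gt0.
have inv (n p : nat) : (n <= p)%N -> p.+2%:R^-1 <= n.+2%:R^-1 :> R.
  by move=> np; rewrite lef_pV2 ?posrE// ler_nat !ltnS.
have xm n : x n < m.
  rewrite /x -ltrBrDl gtr_pMr// invf_lt1// ltr1n//.
have small (e t : R) : 0 < t -> 0 < e -> exists N, forall n, (N <= n)%N -> e / n.+2%:R <= t.
  move=> t0 e0; exists (Num.trunc (e / t)) => n Nn.
  rewrite ler_pdivrMr// mulrC -ler_pdivrMr//; apply: le_trans (ltW (truncnS_gt _)) _.
  by rewrite ler_nat; apply: leq_trans (_ : n.+1 <= _)%N.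
have xt t : a < t -> exists N, forall n, (N <= n)%N -> x n <= t.
  move=> at0; have [|N hN] := small (m - a) (t - a) _ ma0; first by rewrite subr_gt0.
  by exists N => n /hN; rewrite /x -lerBrDl.
have xx n p : (n <= p)%N -> x p <= x n.
  by move=> np; rewrite /x lerD2l; apply: ler_wpM2l; [exact: ltW|exact: inv].
have [y [y1 y2 y3]] : exists y : nat -> R, [/\ forall n, m < y n /\ below (y n) b,
    forall n p, (n <= p)%N -> y n <= y p &
    forall t, below t b -> exists N, forall n, (N <= n)%N -> t <= y n].
  case: b mb => [c|] /= mb.
    have cm0 : 0 < c - m by rewrite subr_gt0.
    exists (fun n => c - (c - m) / n.+2%:R); split.
    - move=> n; split; last by rewrite ltrBlDr ltrDl divr_gt0.
      by rewrite ltrBrDr -ltrBrDl gtr_pMr// invf_lt1// ltr1n.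
    - by move=> n p np; rewrite lerD2l lerN2; apply: ler_wpM2l; [exact: ltW|exact: inv].
    - move=> t tc; have [|N hN] := small (c - m) (c - t) _ cm0; first by rewrite subr_gt0.
      by exists N => n /hN; rewrite lerBrDr -lerBrDl.
  exists (fun n => m + n.+1%:R); split.
  - by move=> n; split => //; rewrite ltrDl.
  - by move=> n p np; rewrite lerD2l ler_nat ltnS.
  - move=> t _; exists (Num.trunc `|t - m|) => n Nn; rewrite -lerBlDl.
    apply: le_trans (ler_norm _) _; apply: le_trans (ltW (truncnS_gt _)) _.
    by rewrite ler_nat ltnS.
exists x, y; split.
- move=> n; have [ym yb] := y1 n; split; last exact: lt_trans (xm n) ym.
    by apply/oitvP; split => //; apply: below_trans mb; apply: ltW.
  by apply/oitvP; split => //; apply: lt_trans ym.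
- by move=> n p np; split; [exact: xx|exact: y2].
- move=> t /oitvP [at0 tb]; have [N1 h1] := xt t at0; have [N2 h2] := y3 t tb.
  by exists (maxn N1 N2) => n; rewrite geq_max => /andP[/h1 -> /h2 ->].
Qed.

(** A nonnegative function with a bounded antiderivative is integrable, even if
    it blows up at an end of the interval or if the interval is unbounded. *)
Lemma antider_bound a b (f F : R -> R) (lo hi : R) :
  (forall x, oitv a b x -> 0 <= f x) ->
  (forall x, oitv a b x -> {for x, continuous f}) ->
  (forall x, oitv a b x -> is_derive x 1 F (f x)) ->
  (forall x, oitv a b x -> lo <= F x <= hi) -> lo <= hi ->
  (\int[mu]_(t in oitv a b) (f t)%:E <= (hi - lo)%:E)%E.
Proof.
move=> f0 cf dF Fb lohi.
have [[m hm]|no] := pselect (exists m, oitv a b m); last first.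
  rewrite (_ : oitv a b = set0) ?integral_set0 ?lee_fin ?subr_ge0//.
  by apply/seteqP; split => t // ht; exfalso; apply: no; exists t.
have [x [y [hxy mono ex]]] := oitv_exhaust hm.
pose E n : set R := [set` `[x n, y n]].
have sub n t : E n t -> oitv a b t.
  rewrite /E /= in_itv /= => /andP[xt ty].
  have [/oitvP [ax _] /oitvP [_ yb] _] := hxy n.
  by apply/oitvP; split; [apply: lt_le_trans xt|apply: below_trans yb].
have UE : oitv a b = \bigcup_n E n.
  apply/seteqP; split => [t ht|t [n _ /sub]//].
  have [N hN] := ex t ht; exists N => //; rewrite /E /= in_itv /=; exact: hN.
have cE n : {within [set` `[x n, y n]], continuous f}.
  apply: continuous_in_subspaceT => t /set_mem Et; apply: cf; exact: sub Et.
have mE n : measurable_fun (E n : set (measurableTypeR R)) (EFin \o f).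
  by apply/measurable_EFinP; apply: subspace_continuous_measurable_fun; [exact: measurable_itv|exact: cE].
have cv : (\int[mu]_(t in E n) (f t)%:E)%E @[n --> \oo] --> (\int[mu]_(t in oitv a b) (f t)%:E)%E.
  rewrite UE; apply: ge0_nondecreasing_set_cvg_integral => //.
  - move=> n p np; apply/subsetPset => t; have [h1 h2] := mono _ _ np.
    by rewrite /E /= !in_itv /= => /andP[/(le_trans h1) -> /le_trans ->].
  - by move=> n; exact: measurable_itv.
  - by move=> n t /sub ht; rewrite lee_fin f0.
have bd n : (\int[mu]_(t in E n) (f t)%:E <= (hi - lo)%:E)%E.
  have [h1 h2 h3] := hxy n.
  have dE t : E n t -> is_derive t 1 F (f t) by move=> /sub; apply: dF.
  have cF t : E n t -> {for t, continuous F}.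
    move=> /dE h; apply: differentiable_continuous; apply/derivable1_diffP; exact: ex_derive.
  rewrite (@continuous_FTC2 R f F) //.
  - rewrite -EFinB lee_fin; have /andP[_ hy] := Fb _ h2; have /andP[hx _] := Fb _ h1.
    by apply: lerB.
  - have xE : E n (x n) by rewrite /E /= in_itv /= lexx ltW.
    have yE : E n (y n) by rewrite /E /= in_itv /= lexx ltW.
    split.
    + move=> t; rewrite in_itv /= => /andP[xt ty].
      by apply: ex_derive; apply: dE; rewrite /E /= in_itv /= !ltW.
    + by apply: cvg_at_right_filter; apply: cF.
    + by apply: cvg_at_left_filter; apply: cF.
  - move=> t; rewrite in_itv /= => /andP[xt ty]; rewrite derive1E.
    by apply: derive_val; apply: dE; rewrite /E /= in_itv /= !ltW.
have := cv; move=> /cvg_lim <-//; apply: lime_le; first by apply/cvg_ex; eexists; exact: cv.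
exact: nearW.
Qed.

End Intervals.

Section Ftc.
Context {R : realType}.
Notation mu := (@lebesgue_measure R).
Notation cn := Normc.normc.
Notation mble D := (measurable (D : set (measurableTypeR R))).
Notation mfun D f := (measurable_fun (D : set (measurableTypeR R)) f).
Context {X : completeNormedModType R[i]}.
Implicit Types (f F : R -> X).

Lemma cont_integrableS (D D' : set R) f : D' `<=` D -> cont_integrable D f -> cont_integrable D' f.
Proof.
move=> D'D [cf fi]; split; first by move=> t /D'D; apply: cf.
by apply: le_lt_trans fi; apply: le_integral_lowerS => // t _; rewrite lee_fin rn_ge0.
Qed.

Lemma bochner_split a b c f : oitv a b c -> cont_integrable (oitv a b) f ->
  [/\ cont_integrable (oitv a (Some c)) f, cont_integrable (oitv c b) f &
      bochner (oitv a b) f = bochner (oitv a (Some c)) f + bochner (oitv c b) f].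
Proof.
move=> /oitvP [ac cb] cf.
have s1 : oitv a (Some c) `<=` oitv a b.
  by move=> t /oitvP [at0 /= tc]; apply/oitvP; split => //; apply: below_trans cb; apply: ltW.
have s2 : oitv c b `<=` oitv a b.
  by move=> t /oitvP [ct tb]; apply/oitvP; split => //; apply: lt_trans ct.
have c1 := cont_integrableS s1 cf; have c2 := cont_integrableS s2 cf; split => //.
have := @is_bochner_split R X (oitv a b) (oitv a (Some c)) (oitv c b) f _ (measurable_oitv _ _) (measurable_oitv _ _) (measurable_oitv _ _) s1 s2 _ (cont_integrable_simple_limit cf) (bochnerP (measurable_oitv _ _) cf).
case.
  move=> E mE.
  have -> : oitv a b `&` E = (oitv a (Some c) `&` E `|` oitv c b `&` E) `|` ([set c] `&` E).
    apply/seteqP; split=> [t [/oitvP [at0 tb] Et]|t [[[/s1 ? ?]|[/s2 ? ?]]|[-> ?]]]; try by split.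
      have [tc|tc|tc] := ltgtP t c; last by right; split.
        by left; left; split => //; apply/oitvP.
      by left; right; split => //; apply/oitvP.
    by split => //; apply/oitvP.
  have m1 : mble (oitv a (Some c) `&` E) by apply: measurableI => //; exact: measurable_oitv.
  have m2 : mble (oitv c b `&` E) by apply: measurableI => //; exact: measurable_oitv.
  have m3 : mble ([set c] `&` E) by apply: measurableI => //; exact: measurable_set1.
  rewrite measureU0//; last 2 first.
  - exact: measurableU.
  - apply/eqP; rewrite eq_le measure_ge0 andbT -(lebesgue_measure_set1 c).
    by apply: le_measure; rewrite ?mem_set//; exact: measurable_set1.
  rewrite measureU//; apply/seteqP; split => // t [[/oitvP [_ /= tc] _] [/oitvP [ct _] _]].
  by have := lt_trans tc ct; rewrite ltxx.
move=> v1 [v2 [b1 b2 ->]].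
by rewrite (bochner_eq (measurable_oitv _ _) c1 b1) (bochner_eq (measurable_oitv _ _) c2 b2).
Qed.

Lemma measure_oitv (x y : R) : x <= y -> mu (oitv x (Some y)) = (y - x)%:E.
Proof.
move=> xy; rewrite /oitv lebesgue_measure_itv /= lte_fin; case: ltP => // yx.
have -> : y = x by apply/eqP; rewrite eq_le xy yx.
by rewrite subrr.
Qed.

Lemma is_bochner_const (x y : R) (v : X) : x <= y ->
  cont_integrable (oitv x (Some y)) (fun _ => v) /\ bochner (oitv x (Some y)) (fun _ => v) = (y - x)%:C *: v.
Proof.
move=> xy.
have mo := measure_oitv xy.
have ci : cont_integrable (oitv x (Some y)) (fun _ => v).
  split; first by move=> t _; apply: cont_at_cst.
  by rewrite (integral_cst _ (measurable_oitv x (Some y)))/= [X in (_ * X)%E]mo -EFinM ltry.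
split => //; apply: bochner_eq => //; first exact: measurable_oitv.
have sv : simple_integrable (oitv x (Some y)) (fun _ => v).
  split.
    have := simple_map_comp (fun _ => v) (simple_map_indic (@measurableT _ (measurableTypeR R))).
    by [].
  move=> w _; apply: (@le_lt_trans _ _ (mu (oitv x (Some y)))); last by rewrite mo ltry.
  apply: le_measure; rewrite ?mem_set//; try exact: measurable_oitv.
  apply: measurableI; first exact: measurable_oitv.
  have [_ h] := simple_map_comp (fun _ => v) (simple_map_indic (@measurableT _ (measurableTypeR R))).
  exact: h.
split; first by exists (fun _ _ => v); split=> [_|]; [case: sv|apply: aeW => t _; exact: cvg_cst].
exists (fun _ _ => v); split => //.
  rewrite (_ : (fun n : nat => _) = cst 0%E); first exact: cvg_cst.
  by apply/funext => n; rewrite integral0_eq// => t _; rewrite subrr rn0.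
rewrite (_ : (fun n : nat => _) = cst ((y - x)%:C *: v)); first exact: cvg_cst.
apply/funext => n; rewrite /simple_integral.
have -> : range (fun _ : R => v) = [set v].
  by apply/seteqP; split => w /=; [move=> [t _ <-]|move=> ->; exists 0].
rewrite fsbig_set1; congr ((_)%:C *: _).
rewrite (_ : _ `&` _ = oitv x (Some y)) ?mo//.
by apply/seteqP; split => t // [].
Qed.

Lemma bochner_le_const (x y c : R) f : x <= y -> cont_integrable (oitv x (Some y)) f ->
  (forall t, oitv x (Some y) t -> rnorm (f t) <= c) -> rnorm (bochner (oitv x (Some y)) f) <= c * (y - x).
Proof.
move=> xy cf fc; apply: (@bochner_norm _ _ _ _ (fun _ => c)) => //; try exact: measurable_oitv.
rewrite (integral_cst _ (measurable_oitv x (Some y)))/= [X in (_ * X)%E](measure_oitv xy).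
by rewrite -EFinM.
Qed.

Definition deriv_at F (x : R) (l : X) :=
  forall e : R, 0 < e -> exists2 d : R, 0 < d &
    forall h : R, `|h| < d -> rnorm (F (x + h) - F x - h%:C *: l) <= e * `|h|.

Lemma deriv_at_cont_at F x l : deriv_at F x l -> cont_at F x.
Proof.
move=> dF e e0; have [d d0 hd] := dF 1 ltr01.
pose k := rnorm l + 1; have k0 : 0 < k by rewrite ltr_wpDl// rn_ge0.
exists (Num.min d (e / k)); first by rewrite lt_min d0 divr_gt0.
move=> s; rewrite lt_min => /andP[sd se].
have := hd (s - x) sd; rewrite [x + _]addrC subrK mul1r => h.
have := rnDB (F s - F x) ((s - x)%:C *: l) => /le_lt_trans; apply.
apply: (@le_lt_trans _ _ (`|s - x| + `|s - x| * rnorm l)).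
  by apply: lerD => //; rewrite rnZR.
by rewrite -{1}(mulr1 `|s - x|) -mulrDr [1 + _]addrC -ltr_pdivlMr.
Qed.

Lemma deriv_at_lin (c : R[i]) F G x l m : deriv_at F x l -> deriv_at G x m ->
  deriv_at (fun s => c *: F s + G s) x (c *: l + m).
Proof.
move=> dF dG e e0.
pose k := cn c + 1; have k0 : 0 < k by rewrite ltr_wpDl// cn_ge0.
have [d1 d10 h1] := dF (e / 2 / k) (divr_gt0 (divr_gt0 e0 (ltr0Sn _ _)) k0).
have [d2 d20 h2] := dG (e / 2) (divr_gt0 e0 (ltr0Sn _ _)).
exists (Num.min d1 d2); first by rewrite lt_min d10.
move=> h; rewrite lt_min => /andP[/h1 {}h1 /h2 {}h2].
have -> : c *: F (x + h) + G (x + h) - (c *: F x + G x) - h%:C *: (c *: l + m) =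
  c *: (F (x + h) - F x - h%:C *: l) + (G (x + h) - G x - h%:C *: m).
  have sub2 (u v w z : X) : (u + v) - (w + z) = (u - w) + (v - z) by rewrite opprD addrACA.
  by rewrite sub2 !scalerBr scalerDr sub2 !scalerA [c * _]mulrC.
apply: le_trans (rnD _ _) _; rewrite rnZ (splitr e) mulrDl; apply: lerD => //.
apply: (@le_trans _ _ (k * (e / 2 / k * `|h|))).
  by apply: ler_pM; rewrite ?cn_ge0 ?rn_ge0// lerDl.
by rewrite mulrA [k * _]mulrC divfK// gt_eqF.
Qed.

Lemma deriv_at_cst (v : X) x : deriv_at (fun _ => v) x 0.
Proof. by move=> e e0; exists 1 => // h _; rewrite subrr scaler0 subrr rn0; apply: mulr_ge0 => //; apply: ltW. Qed.

(** The distance of F to a fixed value is a real function with zero derivative, to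
    which the mean value theorem applies. *)
Lemma deriv_at0_const a b F : (forall x, oitv a b x -> deriv_at F x 0) ->
  forall x y, oitv a b x -> oitv a b y -> F x = F y.
Proof.
move=> dF; suff key : forall x y, oitv a b x -> oitv a b y -> x < y -> F x = F y.
  move=> x y hx hy; have [xy|yx|->//] := ltgtP x y; first exact: key.
  by apply/esym/key.
move=> x y hx hy xy.
have sub t : t \in `[x, y] -> oitv a b t.
  rewrite in_itv /= => /andP[xt ty]; have [ax _] := (oitvP _ _ _).1 hx.
  have [_ yb] := (oitvP _ _ _).1 hy.
  by apply/oitvP; split; [apply: lt_le_trans xt|apply: below_trans yb].
pose N t := rnorm (F t - F x).
have dN t : t \in `[x, y] -> is_derive t 1 N 0.
  move=> /sub /dF ht.
  have cv : ((fun h => h^-1 *: ((N \o shift t) (h *: 1) - N t)) @ 0^') --> (0 : R).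
    apply/cvgrPdist_le => e e0; have [d d0 hd] := ht e e0.
    exists d => //= h /=; rewrite sub0r normrN => hh h0.
    rewrite sub0r normrN normrM normfV mulrC ler_pdivrMr ?normr_gt0//.
    have := hd h hh; rewrite scaler0 subr0; apply: le_trans.
    rewrite /N /shift /= /GRing.scale /= mulr1 (addrC h).
    apply: le_trans (rn_dist _ _) _.
    by rewrite opprB addrA subrK.
  apply: DeriveDef; first by apply/cvg_ex; exists 0.
  exact: cvg_lim cv.
have h1 t : t \in `]x, y[ -> is_derive t 1 N 0.
  by rewrite in_itv /= => /andP[xt ty]; apply: dN; rewrite in_itv /= !ltW.
have h2 : {within [set` `[x, y]], continuous N}.
  apply: continuous_in_subspaceT => t /set_mem tE; apply: differentiable_continuous.
  by apply/derivable1_diffP; apply: (@ex_derive _ _ _ _ _ _ _ (dN t tE)).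
have [c _] := MVT xy h1 h2.
rewrite mul0r /N subrr rn0 subr0 => h0.
by apply/eqP; rewrite eq_sym -subr_eq0 -rn_eq0 h0.
Qed.

Lemma bochner_deriv_at a b f x : cont_integrable (oitv a b) f -> oitv a b x ->
  deriv_at (fun y => bochner (oitv a (Some y)) f) x (f x).
Proof.
move=> cf hx e e0.
have [d d0 hd] := cf.1 x hx e e0.
have [d1 d10 hd1] : exists2 d : R, 0 < d & forall y, `|y - x| < d -> oitv a b y.
  move: hx => /oitvP [ax xb].
  have [d1 d10 h1] : exists2 d : R, 0 < d & forall y, `|y - x| < d -> below y b.
    case: b xb {cf hd} => [c|] /= xc; last by exists 1.
    exists (c - x); rewrite ?subr_gt0// => y; rewrite ltr_norml => /andP[_]; lra.
  exists (Num.min d1 (x - a)); first by rewrite lt_min d10 subr_gt0.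
  move=> y; rewrite lt_min => /andP[/h1 yb]; rewrite ltr_norml => /andP[ya _].
  by apply/oitvP; split => //; lra.
exists (Num.min d d1); first by rewrite lt_min d0.
(* the increment over [x, y] minus its linear part is the integral of f - f x0 *)
have key y z x0 : y <= z -> cont_integrable (oitv y (Some z)) f ->
    (forall t, oitv y (Some z) t -> rnorm (f t - f x0) <= e) ->
    rnorm (bochner (oitv y (Some z)) f - (z - y)%:C *: f x0) <= e * (z - y).
  move=> yz cyz hyz; have [c1 <-] := is_bochner_const (f x0) yz.
  have -> : bochner (oitv y (Some z)) f - bochner (oitv y (Some z)) (fun=> f x0) = bochner (oitv y (Some z)) (fun t => (-1) *: f x0 + f t).
    by rewrite bochner_lin// ?scaleN1r 1?addrC//; exact: measurable_oitv.
  apply: bochner_le_const => //; first by apply: cont_integrable_lin => //; exact: measurable_oitv.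
  by move=> t ht; rewrite scaleN1r addrC; exact: hyz.
have subS y : oitv a b y -> cont_integrable (oitv a (Some y)) f.
  by move=> hy; case: (bochner_split hy cf).
move=> h; rewrite lt_min => /andP[hdd hdd1].
have hb : oitv a b (x + h) by apply: hd1; rewrite addrC addKr.
have [ax _] := (oitvP _ _ _).1 hx; have [axh _] := (oitvP _ _ _).1 hb.
have [h0|h0|->] := ltgtP h 0; last by rewrite addr0 subrr scale0r subrr rn0 normr0 mulr0.
- have xin : oitv a (Some x) (x + h) by apply/oitvP; split => //=; lra.
  have [_ c2 ->] := bochner_split xin (subS x hx).
  rewrite opprD addNKr -opprD rnN.
  have -> : h%:C *: f x = - ((x - (x + h))%:C *: f x) by rewrite -scaleNr -rmorphN; congr (_%:C *: _); lra.
  have -> : `|h| = x - (x + h) by rewrite ltr0_norm//; lra.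
  apply: key => //; first lra.
  move=> t /oitvP [t1 /= t2]; apply/ltW/hd; rewrite distrC; apply: le_lt_trans hdd.
  by rewrite gtr0_norm ?ltr0_norm//; lra.
- have xin : oitv a (Some (x + h)) x by apply/oitvP; split => //=; lra.
  have [_ c2 ->] := bochner_split xin (subS _ hb).
  rewrite [bochner _ _ + _]addrC addrK.
  have -> : `|h| = x + h - x by rewrite gtr0_norm//; lra.
  have -> : h%:C *: f x = (x + h - x)%:C *: f x by congr (_%:C *: _); lra.
  apply: key => //; first lra.
  move=> t /oitvP [t1 /= t2]; apply/ltW/hd; apply: le_lt_trans hdd.
  by rewrite !gtr0_norm//; lra.
Qed.

End Ftc.

Section Bounds.
Context {R : realType}.
Notation mu := (@lebesgue_measure R).

Lemma is_derive_scale (F : R -> R) (x k l : R) :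
  is_derive x 1 F l -> is_derive x 1 (fun t => k * F t) (k * l).
Proof. by move=> dF; apply: is_deriveZ. Qed.

Lemma is_derive_affine (p q x : R) : is_derive x 1 (fun t => p + q * t) q.
Proof.
have h : is_derive x 1 (cst p + (fun t => q * t)) (0 + q * 1).
  by apply: is_deriveD; apply: is_derive_scale.
by rewrite add0r mulr1 in h.
Qed.

(** Power singularities of exponent below one are integrable; the singularity is at
    the lower end here, and at the upper end in the next lemma, as in a convolution
    with the kernel of the perturbation. *)
Lemma pow_bound (C d s : R) : 0 <= C -> 0 <= d < 1 -> 0 < s ->
  (\int[mu]_(t in oitv 0 (Some s)) (C * t `^ (- d))%:E <= (C / (1 - d) * s `^ (1 - d))%:E)%E.
Proof.
move=> C0 /andP[d0 d1] s0; have d10 : 0 < 1 - d by rewrite subr_gt0.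
have k0 : 0 <= C / (1 - d) by rewrite divr_ge0// ltW.
rewrite -[X in (_ <= X%:E)%E]subr0.
apply: (@antider_bound _ _ _ (fun t => C * t `^ (- d)) (fun t => C / (1 - d) * t `^ (1 - d))).
- by move=> x _; rewrite mulr_ge0// powR_ge0.
- move=> x /oitvP [x0 _]; apply: differentiable_continuous; apply/derivable1_diffP.
  by apply: (@ex_derive _ _ _ _ _ _ _ (@is_derive_scale (fun t => t `^ (- d)) x C _ (is_derive1_powR _ x0))).
- move=> x /oitvP [x0 _].
  have := @is_derive_scale (fun t => t `^ (1 - d)) x (C / (1 - d)) _ (is_derive1_powR (1 - d) x0).
  congr (is_derive _ _ _ _); rewrite mulrA divfK ?gt_eqF//; congr (_ * _ `^ _); ring.
- move=> x /oitvP [x0 /= xs]; rewrite (mulr_ge0 k0 (powR_ge0 _ _))/=.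
  apply: ler_wpM2l => //; apply: ge0_ler_powR; rewrite ?nnegrE; exact: ltW.
- exact: mulr_ge0 k0 (powR_ge0 _ _).
Qed.

Lemma pow_bound_right (C d s t : R) : 0 <= C -> 0 <= d < 1 -> s < t ->
  (\int[mu]_(x in oitv s (Some t)) (C * (t - x) `^ (- d))%:E <= (C / (1 - d) * (t - s) `^ (1 - d))%:E)%E.
Proof.
move=> C0 /andP[d0 d1] st; have d10 : 0 < 1 - d by rewrite subr_gt0.
have k0 : 0 <= C / (1 - d) by rewrite divr_ge0// ltW.
have der (p x : R) : x < t -> is_derive x 1 (fun y => (t - y) `^ p) (- (p * (t - x) `^ (p - 1))).
  move=> xt; have tx : 0 < t + -1 * x by rewrite mulN1r subr_gt0.
  have := is_derive1_comp (f := fun y => y `^ p) (g := fun y => t + -1 * y) (is_derive1_powR p tx) (is_derive_affine t (-1) x).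
  rewrite mulrN1 mulN1r; congr (is_derive _ _ _ _).
  by apply/funext => y /=; rewrite mulN1r.
have -> : (C / (1 - d) * (t - s) `^ (1 - d)) = 0 - (- (C / (1 - d)) * (t - s) `^ (1 - d)) by rewrite sub0r mulNr opprK.
apply: (@antider_bound _ _ _ (fun y => C * (t - y) `^ (- d)) (fun y => - (C / (1 - d)) * (t - y) `^ (1 - d))).
- by move=> x _; rewrite mulr_ge0// powR_ge0.
- move=> x /oitvP [_ /= xt]; apply: differentiable_continuous; apply/derivable1_diffP.
  by apply: (@ex_derive _ _ _ _ _ _ _ (@is_derive_scale (fun y => (t - y) `^ (- d)) x C _ (der _ _ xt))).
- move=> x /oitvP [_ /= xt].
  have := @is_derive_scale (fun y => (t - y) `^ (1 - d)) x (- (C / (1 - d))) _ (der _ _ xt).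
  congr (is_derive _ _ _ _); rewrite mulrNN mulrA divfK ?gt_eqF//; congr (_ * _ `^ _); ring.
- move=> x /oitvP [sx /= xt]; rewrite !mulNr oppr_le0 (mulr_ge0 k0 (powR_ge0 _ _)) andbT.
  by rewrite lerN2; apply: ler_wpM2l => //; apply: ge0_ler_powR; rewrite ?nnegrE; lra.
- by rewrite mulNr oppr_le0; exact: mulr_ge0 k0 (powR_ge0 _ _).
Qed.

Lemma exp_bound (C k r : R) : 0 <= C -> 0 < k -> 0 < r ->
  (\int[mu]_(x in oitv r None) (C * expR (- (k * x)))%:E <= (C / k)%:E)%E.
Proof.
move=> C0 k0 r0.
have der (x : R) : is_derive x 1 (fun y => expR (- (k * y))) (- k * expR (- (k * x))).
  have := is_derive1_comp (f := expR) (g := fun y => 0 + (- k) * y) (is_derive_expR _) (is_derive_affine 0 (- k) x).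
  rewrite add0r mulNr mulrC; congr (is_derive _ _ _ _).
  by apply/funext => y /=; rewrite add0r mulNr.
have -> : C / k = 0 - - (C / k) by rewrite sub0r opprK.
apply: (@antider_bound _ _ _ (fun y => C * expR (- (k * y))) (fun y => - (C / k) * expR (- (k * y)))).
- by move=> x _; rewrite mulr_ge0// expR_ge0.
- move=> x _; apply: differentiable_continuous; apply/derivable1_diffP.
  by apply: (@ex_derive _ _ _ _ _ _ _ (@is_derive_scale _ x C _ (der x))).
- move=> x _; have := @is_derive_scale _ x (- (C / k)) _ (der x).
  by congr (is_derive _ _ _ _); rewrite mulrA mulrNN divfK ?gt_eqF.
- move=> x /oitvP [rx _]; have h0 : 0 <= C / k by rewrite divr_ge0// ltW.
  rewrite !mulNr lerN2 oppr_le0 (mulr_ge0 h0) ?expR_ge0// andbT.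
  rewrite ler_piMr// -expR0 ler_expR oppr_le0; apply: mulr_ge0; first exact: ltW.
  by apply: ltW; apply: lt_trans rx.
- by rewrite oppr_le0 divr_ge0// ltW.
Qed.

End Bounds.

Section Tails.
Context {R : realType}.
Notation mu := (@lebesgue_measure R).
Notation mble D := (measurable (D : set (measurableTypeR R))).
Notation mfun D f := (measurable_fun (D : set (measurableTypeR R)) f).
Context {X : completeNormedModType R[i]}.
Implicit Types (f F : R -> X).

(** Dominated convergence for the restrictions of f to the sets E n. *)
Lemma vanishing_tail (D : set R) (E : nat -> set R) f : mble D -> cont_integrable D f ->
  (forall n, mble (E n)) -> (forall n, E n `<=` D) ->
  (forall t, D t -> exists N, forall n, (N <= n)%N -> ~ E n t) ->
  forall e : R, 0 < e -> exists N, forall n, (N <= n)%N ->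
    (\int[mu]_(t in E n) (rnorm (f t))%:E <= e%:E)%E.
Proof.
move=> mD cf mE ED outside e e0.
have mf := simple_limit_norm_measurable mD (cont_integrable_simple_limit cf).
have := @dominated_convergence _ _ _ mu D mD (fun n t => (rnorm (f t) * \1_(E n) t)%:E) (cst 0%E)
     (fun t => (rnorm (f t))%:E).
case.
- move=> n; apply/measurable_EFinP; apply: measurable_funM => //.
- exact: measurable_cst.
- apply: aeW => t Dt; apply/cvge0P; first by move=> n; rewrite lee_fin mulr_ge0// rn_ge0.
  move=> e1 e10; have [N hN] := outside t Dt; exists N => n /hN h.
  by rewrite indicE memNset// mulr0 lee_fin ltW.
- apply/integrableP; split; first exact/measurable_EFinP.
  by under eq_integral => t _ do rewrite gee0_abs ?lee_fin ?rn_ge0//; exact: cf.2.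
- apply: aeW => t n Dt; rewrite gee0_abs lee_fin ?mulr_ge0 ?rn_ge0//.
  by rewrite ler_piMr ?rn_ge0// indicE; case: (_ \in _).
move=> _ _; rewrite integral_cst// mul0e => cv.
have [|N hN] := (cvge0P _).1 cv e e0.
  by move=> n; apply: integral_ge0 => t _; rewrite lee_fin mulr_ge0// rn_ge0.
exists N => n /hN; apply: le_trans.
rewrite integral_mkcond [leRHS]integral_mkcond; apply: le_integral_lower => t _.
  by apply: erestrict_ge0 => x _; rewrite lee_fin rn_ge0.
rewrite !patchE; case: ifPn => Et.
  by rewrite mem_set ?indicE ?Et ?mulr1//; apply: ED; exact: set_mem Et.
by case: ifPn => // _; rewrite lee_fin mulr_ge0// rn_ge0.
Qed.

Lemma tail_left a b m f : oitv a b m -> cont_integrable (oitv a b) f -> forall e : R, 0 < e ->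
  exists2 x0, oitv a b x0 & forall x, oitv a b x -> x <= x0 -> rnorm (bochner (oitv a (Some x)) f) <= e.
Proof.
move=> hm cf e e0; have [x [y [hxy mono ex]]] := oitv_exhaust hm.
have sub c : oitv a b c -> oitv a (Some c) `<=` oitv a b.
  by move=> /oitvP [_ cb] t /oitvP [at0 /= tc]; apply/oitvP; split => //; apply: below_trans cb; apply: ltW.
have := @vanishing_tail _ (fun n => oitv a (Some (x n))) f (measurable_oitv a b) cf (fun n => measurable_oitv _ _).
case/(_ _ _ e e0).
- by move=> n; have [h _ _] := hxy n; exact: sub.
- move=> t /ex [N hN]; exists N => n /hN /andP[xt _] /oitvP [_ /=].
  by move=> /(le_lt_trans xt); rewrite ltxx.
move=> N hN; have [hx _ _] := hxy N; exists (x N) => // z hz zx.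
apply: (@bochner_norm _ _ _ _ (fun t => rnorm (f t))) => //; first exact: measurable_oitv.
- by apply: cont_integrableS cf; exact: sub.
- apply: simple_limit_norm_measurable; first exact: measurable_oitv.
  by apply: cont_integrable_simple_limit; apply: cont_integrableS cf; exact: sub.
- apply: le_trans (hN N (leqnn N)); apply: le_integral_lowerS => [t /oitvP [? /= tz]|t _].
    by apply/oitvP; split => //=; exact: lt_le_trans tz zx.
  by rewrite lee_fin rn_ge0.
Qed.

Lemma tail_right a b m f : oitv a b m -> cont_integrable (oitv a b) f -> forall e : R, 0 < e ->
  exists2 x0, oitv a b x0 & forall x, oitv a b x -> x0 <= x -> rnorm (bochner (oitv x b) f) <= e.
Proof.
move=> hm cf e e0; have [x [y [hxy mono ex]]] := oitv_exhaust hm.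
have sub c : oitv a b c -> oitv c b `<=` oitv a b.
  by move=> /oitvP [ac _] t /oitvP [ct tb]; apply/oitvP; split => //; apply: lt_trans ct.
have := @vanishing_tail _ (fun n => oitv (y n) b) f (measurable_oitv a b) cf (fun n => measurable_oitv _ _).
case/(_ _ _ e e0).
- by move=> n; have [_ h _] := hxy n; exact: sub.
- move=> t /ex [N hN]; exists N => n /hN /andP[_ ty] /oitvP [/(le_lt_trans ty)].
  by rewrite ltxx.
move=> N hN; have [_ hy _] := hxy N; exists (y N) => // z hz yz.
apply: (@bochner_norm _ _ _ _ (fun t => rnorm (f t))) => //; first exact: measurable_oitv.
- by apply: cont_integrableS cf; exact: sub.
- apply: simple_limit_norm_measurable; first exact: measurable_oitv.
  by apply: cont_integrable_simple_limit; apply: cont_integrableS cf; exact: sub.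
- apply: le_trans (hN N (leqnn N)); apply: le_integral_lowerS => [t /oitvP [zt tb]|t _].
    by apply/oitvP; split => //; exact: le_lt_trans yz zt.
  by rewrite lee_fin rn_ge0.
Qed.

Definition limit_left a b F (A : X) := forall e : R, 0 < e ->
  exists2 x0, oitv a b x0 & forall x, oitv a b x -> x <= x0 -> rnorm (F x - A) <= e.

Definition limit_right a b F (B : X) := forall e : R, 0 < e ->
  exists2 x0, oitv a b x0 & forall x, oitv a b x -> x0 <= x -> rnorm (F x - B) <= e.

(** F is not defined at the ends of the interval. Its limits there replace the
    boundary values, because the integrals over neighbourhoods of the ends vanish. *)
Lemma bochner_ftc a b m f F A B : oitv a b m -> cont_integrable (oitv a b) f ->
  (forall x, oitv a b x -> deriv_at F x (f x)) -> limit_left a b F A -> limit_right a b F B ->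
  bochner (oitv a b) f = B - A.
Proof.
move=> hm cf dF lA lB.
pose G x := (-1) *: bochner (oitv a (Some x)) f + F x.
have dG x : oitv a b x -> deriv_at G x 0.
  move=> hx; have := deriv_at_lin (-1) (bochner_deriv_at cf hx) (dF x hx).
  by rewrite scaleN1r addNr.
have Gc x : oitv a b x -> G x = G m by move=> hx; apply: deriv_at0_const dG _ _ hx hm.
have minab x y : oitv a b x -> oitv a b y -> oitv a b (Num.min x y) by move=> ? ?; rewrite minEle; case: ifP.
have maxab x y : oitv a b x -> oitv a b y -> oitv a b (Num.max x y) by move=> ? ?; rewrite maxEle; case: ifP.
have GA : G m = A.
  apply: rn_small => e e0.
  have e20 : 0 < e / 2 by rewrite divr_gt0.
  have [x1 hx1 h1] := lA _ e20; have [x2 hx2 h2] := tail_left hm cf e20.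
  have hx := minab _ _ hx1 hx2; rewrite -(Gc _ hx) /G -addrA (splitr e).
  apply: le_trans (rnD _ _) _; apply: lerD.
    by rewrite scaleN1r rnN; apply: h2 => //; rewrite ge_min lexx orbT.
  by apply: h1 => //; rewrite ge_min lexx.
have IE x : oitv a b x -> bochner (oitv a b) f = F x - A + bochner (oitv x b) f.
  move=> hx; have [_ _ ->] := bochner_split hx cf; congr (_ + _).
  by rewrite -GA -(Gc x hx) /G scaleN1r opprD opprK addrCA subrr addr0.
apply: rn_small => e e0.
have e20 : 0 < e / 2 by rewrite divr_gt0.
have [x1 hx1 h1] := lB _ e20; have [x2 hx2 h2] := tail_right hm cf e20.
have hx := maxab _ _ hx1 hx2; rewrite (IE _ hx).
set x := Num.max x1 x2.
have -> : F x - A + bochner (oitv x b) f - (B - A) = (F x - B) + bochner (oitv x b) f.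
  by rewrite opprB addrAC addrA subrK.
rewrite (splitr e); apply: le_trans (rnD _ _) _; apply: lerD.
  by apply: h1 => //; rewrite le_max lexx.
by apply: h2 => //; rewrite le_max lexx orbT.
Qed.

Lemma bochner_shift s t f : 0 < t -> cont_integrable (oitv 0 (Some t)) (fun x => f (x + s)) ->
  cont_integrable (oitv s (Some (s + t))) f ->
  bochner (oitv 0 (Some t)) (fun x => f (x + s)) = bochner (oitv s (Some (s + t))) f.
Proof.
move=> t0 c1 c2.
have inE x : oitv 0 (Some t) x -> oitv s (Some (s + t)) (x + s).
  by move=> /oitvP [x0 /= xt]; apply/oitvP; split => /=; lra.
have hm : oitv 0 (Some t) (t / 2) by apply/oitvP; split => /=; lra.
have hm' := inE _ hm.
rewrite -[RHS]subr0.
apply: (@bochner_ftc _ _ (t / 2) _ (fun x => bochner (oitv s (Some (x + s))) f)) => //.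
- move=> x hx e e0; have [d d0 hd] := bochner_deriv_at c2 (inE x hx) e0.
  by exists d => // h /hd; rewrite (addrAC x s h).
- move=> e e0; have [x0 hx0 h0] := tail_left hm' c2 e0.
  exists (x0 - s); first by move: hx0 => /oitvP [? /= ?]; apply/oitvP; split => /=; lra.
  move=> x hx xx0; rewrite subr0; apply: h0; first exact: inE.
  by rewrite -lerBrDr.
- move=> e e0; have [x0 hx0 h0] := tail_right hm' c2 e0.
  exists (x0 - s); first by move: hx0 => /oitvP [? /= ?]; apply/oitvP; split => /=; lra.
  move=> x hx xx0; have hxs := inE _ hx; have [_ _ ->] := bochner_split hxs c2.
  rewrite opprD addNKr rnN.
  by apply: h0 => //; rewrite -lerBlDr.
Qed.

End Tails.

(** * Sectors and the complex exponential *)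

Section Plane.
Context {R : realType}.
Notation C := R[i].
Notation cn := Normc.normc.
Implicit Types (a t th : R) (z w : C).

(** Re (z - a) < |z - a| cos th means that the argument of z - a exceeds th in
    absolute value; in this form sectors are compared by the triangle inequality. *)
Definition outside a th z : Prop := complex.Re z - a < cn (z - a%:C) * cos th.

Lemma ReB z w : complex.Re (z - w) = complex.Re z - complex.Re w.
Proof. by case: z w => [? ?] [? ?]. Qed.

Lemma ReD z w : complex.Re (z + w) = complex.Re z + complex.Re w.
Proof. by case: z w => [? ?] [? ?]. Qed.

Lemma mulRC (k p q : R) : k%:C * (p +i* q) = (k * p) +i* (k * q).
Proof. by rewrite /GRing.mul /= !mul0r subr0 addr0. Qed.

Lemma polar z : z != 0 -> exists2 phi : R, - pi < phi <= pi & z = `|z| * expi phi.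
Proof.
move=> z0; have n0 : 0 < cn z by rewrite cn_gt0.
pose c := complex.Re z / cn z.
have cE : complex.Re z = cn z * c by rewrite /c mulrCA divff ?mulr1// gt_eqF.
have c1 : -1 <= c <= 1.
  rewrite -ler_norml normrM normfV [X in _ / X]gtr0_norm// ler_pdivrMr// mul1r.
  exact: Re_le_cn.
have im2 : complex.Im z ^+ 2 = (cn z) ^+ 2 * (1 - c ^+ 2).
  by rewrite mulrBr mulr1 -exprMn -cE cn_sqr addrAC subrr add0r.
have hz (phi : R) : cos phi = c -> cn z * sin phi = complex.Im z -> z = `|z| * expi phi.
  move=> h1 h2; rewrite cnE /expi h1. rewrite mulRC -cE h2.
  by case: (z).
have sqrtE : cn z * Num.sqrt (1 - c ^+ 2) = `|complex.Im z|.
  by rewrite -sqrtr_sqr im2 sqrtrM ?sqr_ge0// sqrtr_sqr ger0_norm// ltW.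
have cI : c \in `[-1, 1] by rewrite in_itv.
have a0 := acos_ge0 c1; have api := acos_lepi c1.
have [im0|im0] := leP 0 (complex.Im z).
  exists (acos c); first by rewrite api andbT (lt_le_trans _ a0)// oppr_lt0 pi_gt0.
  by apply: hz; rewrite ?acosK// sin_acos// sqrtE ger0_norm.
exists (- acos c); last first.
  by apply: hz; rewrite ?cosN ?acosK// sinN mulrN sin_acos// sqrtE ltr0_norm ?opprK.
apply/andP; split; last by apply: le_trans (pi_ge0 R); rewrite oppr_le0.
rewrite ltrN2 lt_neqAle api andbT.
apply/eqP => apiE; move: im0; suff -> : complex.Im z = 0 by rewrite ltxx.
by apply/eqP; rewrite -normr_eq0 -sqrtE -sin_acos// apiE sinpi mulr0 eqxx.
Qed.

Lemma ArgP z : z != 0 -> - pi < Arg z <= pi /\ z = `|z| * expi (Arg z).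
Proof. by move=> /polar [phi h1 h2]; apply: (xgetPex 0 (P := [set phi : R | - pi < phi <= pi /\ z = `|z| * expi phi])); exists phi. Qed.

Lemma Re_Arg z : z != 0 -> complex.Re z = cn z * cos `|Arg z|.
Proof.
move=> /ArgP [_]; rewrite cos_norm cnE; set p := Arg z => zE.
by rewrite {1}zE /expi mulRC.
Qed.

Lemma cos_le (x y : R) : 0 <= x -> x <= y -> y <= pi -> cos y <= cos x.
Proof.
move=> x0 xy yp; have [->//|ne] := eqVneq x y.
apply: ltW; rewrite ltr_cos ?in_itv/= ?x0 ?yp ?(le_trans x0 xy) ?(le_trans xy yp)//.
by rewrite lt_neqAle ne.
Qed.

Lemma cos_lt (x y : R) : 0 <= x -> x < y -> y <= pi -> cos y < cos x.
Proof.
move=> x0 xy yp; rewrite ltr_cos// in_itv/= ?x0 ?yp ?(le_trans x0 (ltW xy))//.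
by rewrite (le_trans (ltW xy) yp).
Qed.

(** The opposite inequality is closed, hence holds on the closure of the sector.
    Conversely a point that satisfies it lies in the closure, since moving it to the
    right brings it into the open sector. *)
Lemma sector_complE a th z : 0 < th < pi / 2 -> sector_compl a th z <-> outside a th z.
Proof.
move=> /andP[th0 thp].
have thpi : th < pi by have := pi_gt0 R; lra.
have c0 : 0 < cos th by apply: cos_gt0_pihalf; rewrite thp andbT; have := pi_gt0 R; lra.
have c1 : cos th < 1 by rewrite -cos0; apply: cos_lt => //; exact: ltW.
split.
  move=> h; rewrite /outside ltNge; apply/negP => zin; apply: h => B /nbhs_ballP [e /= e0 eB].
  have eE : e = (complex.Re e)%:C.
    by move: e0; case: (e) => p q; rewrite ltcE /= => /andP[/eqP -> _].
  have e0' : 0 < complex.Re e by move: e0; rewrite eE ltcR.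
  pose d := complex.Re e / 2; have d0 : 0 < d by rewrite divr_gt0.
  exists (z + d%:C); split; last first.
    apply: eB; rewrite -ball_normE /ball_ /= opprD addNKr normrN eE cnE ltcR cnR gtr0_norm// /d.
    by rewrite ltr_pdivrMr// ltr_pMr// ltr1n.
  pose v := z + d%:C - a%:C.
  have vE : v = (z - a%:C) + d%:C by rewrite /v addrAC.
  have lt1 : cn v * cos th < complex.Re v.
    rewrite vE ReD ReB /=; apply: (@le_lt_trans _ _ ((cn (z - a%:C) + d) * cos th)).
      rewrite (ler_wpM2r (ltW c0))//; apply: le_trans (cnD _ _) _.
      by rewrite lerD2l cnR gtr0_norm.
    by rewrite mulrDl; apply: ler_ltD => //; rewrite gtr_pMr.
  have v0 : v != 0 by apply: contraTneq lt1 => ->; rewrite cn0 mul0r ltxx.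
  split; first by rewrite -subr_eq0.
  move: lt1; rewrite (Re_Arg v0) ltr_pM2l ?cn_gt0// => lt1.
  rewrite ltNge; apply/negP => thA; move: lt1; rewrite ltNge => /negP; apply.
  have [/andP[A1 A2] _] := ArgP v0.
  by apply: cos_le => //; [exact: ltW|rewrite ler_norml A2 ltW].
rewrite /outside => zout clz.
pose e := (cn (z - a%:C) * cos th - (complex.Re z - a)) / 2.
have e0 : 0 < e by rewrite divr_gt0// subr_gt0.
have [|w [[wa /= wA] wz]] := clz (ball (z : R[i]^o) e%:C).
  by apply/nbhs_ballP; exists e%:C => //=; rewrite ltcR.
have {}wz : cn (z - w) < e by move: wz; rewrite -ball_normE /ball_ /= cnE ltcR.
have wa0 : w - a%:C != 0 by rewrite subr_eq0.
have h1 : cn (w - a%:C) * cos th <= complex.Re w - a.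
  have := Re_Arg wa0; rewrite ReB /= => ->; rewrite ler_pM2l ?cn_gt0//.
  by apply: cos_le => //; rewrite ltW.
have h2 : complex.Re w - complex.Re z <= cn (z - w).
  by rewrite -ReB cnBC; apply: le_trans (ler_norm _) (Re_le_cn _).
have h3 : cn (z - a%:C) <= cn (z - w) + cn (w - a%:C).
  by apply: le_trans (cnD _ _); rewrite addrA subrK.
have h4 : cn (z - a%:C) * cos th <= cn (z - w) * cos th + cn (w - a%:C) * cos th.
  by rewrite -mulrDl ler_wpM2r// ltW.
have h5 : cn (z - w) * cos th <= cn (z - w) by rewrite ler_piMr ?cn_ge0// ltW.
by move: wz; rewrite /e; lra.
Qed.

(** Moving the vertex to the left shrinks the outer region, and keeps it away
    from the original vertex. *)
Lemma outside_dist a b th z : b <= a -> 0 < th < pi / 2 -> outside b th z ->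
  [/\ outside a th z, (1 - cos th) * cn (z - b%:C) <= cn (z - a%:C) &
      (1 - cos th) * (a - b) <= cn (z - a%:C)].
Proof.
move=> ba /andP[th0 thp] zb.
have thpi : th < pi by have := pi_gt0 R; lra.
have c0 : 0 < cos th by apply: cos_gt0_pihalf; rewrite thp andbT; have := pi_gt0 R; lra.
have c1 : cos th < 1 by rewrite -cos0; apply: cos_lt => //; exact: ltW.
set c := cos th in c0 c1 *.
pose d := a - b; have d0 : 0 <= d by rewrite subr_ge0.
pose u := cn (z - b%:C); pose v := cn (z - a%:C).
have u0 : 0 <= u := cn_ge0 _; have v0 : 0 <= v := cn_ge0 _.
have zuv : u <= v + d.
  rewrite /u; have -> : z - b%:C = (z - a%:C) + d%:C by rewrite /d rmorphB /= addrA subrK.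
  by apply: le_trans (cnD _ _) _; rewrite lerD2l cnR ger0_norm.
have key : v ^+ 2 = u ^+ 2 - 2 * d * (complex.Re z - b) + d ^+ 2.
  by rewrite /u /v !cn_sqr /d; case: (z) => p q /=; ring.
have zb' : complex.Re z - b < u * c by [].
have sq : (1 - c) * (u ^+ 2 + d ^+ 2) <= v ^+ 2.
  rewrite key.
  have h1 : d * (complex.Re z - b) <= d * (u * c) by rewrite ler_wpM2l// ltW.
  have h2 : 0 <= c * (u - d) ^+ 2 by rewrite mulr_ge0 ?sqr_ge0// ltW.
  move: h2; rewrite sqrrB -mulr_natl; nra.
have c10 : 0 <= 1 - c by rewrite subr_ge0 ltW.
have bound (x : R) : 0 <= x -> x ^+ 2 <= u ^+ 2 + d ^+ 2 -> (1 - c) * x <= v.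
  move=> x0 hx; rewrite -ler_sqr ?nnegrE ?mulr_ge0//; apply: le_trans sq.
  rewrite exprMn; apply: (@le_trans _ _ ((1 - c) * x ^+ 2)); last by rewrite ler_wpM2l.
  rewrite ler_wpM2r ?sqr_ge0// expr2 ler_piMr// lerBlDr lerDl; exact: ltW.
split.
- rewrite /outside -/c -/v; apply: (@lt_le_trans _ _ (u * c - d)).
    by rewrite /d; move: zb'; lra.
  have : (u - d) * c <= v * c by rewrite ler_wpM2r ?lerBlDr// ltW.
  have : d * c <= d by rewrite ler_piMr// ltW.
  by lra.
- by apply: bound => //; rewrite lerDl sqr_ge0.
- by apply: bound => //; rewrite lerDr sqr_ge0.
Qed.

Lemma outside_neq a th z : outside a th z -> 0 < cn (z - a%:C).
Proof.
rewrite /outside cn_gt0 subr_eq0 => h; apply: contraTneq h => ->.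
by rewrite [a%:C - _]subrr cn0 mul0r /= subrr ltxx.
Qed.

Lemma mvt_bound (g g' : R -> R) (K y : R) : (forall x : R, is_derive x 1 g (g' x)) ->
  (forall x : R, `|x| <= `|y| -> `|g' x| <= K) -> `|g y - g 0| <= K * `|y|.
Proof.
move=> dg bg.
have cg : forall x : R, {for x, continuous g}.
  by move=> x; apply: differentiable_continuous; apply/derivable1_diffP; apply: (@ex_derive _ _ _ _ _ _ _ (dg x)).
have [y0|y0|<-] := ltgtP 0 y; last by rewrite subrr normr0 mulr0.
- have h2 : {within [set` `[0, y]], continuous g} by apply: continuous_in_subspaceT => x _; exact: cg.
  have [c] := MVT y0 (fun x _ => dg x) h2; rewrite in_itv /= => /andP[c0 cy] ->.
  rewrite subr0 normrM ler_wpM2r//; apply: bg; rewrite !gtr0_norm//; exact: ltW.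
- have h2 : {within [set` `[y, 0]], continuous g} by apply: continuous_in_subspaceT => x _; exact: cg.
  have [c] := MVT y0 (fun x _ => dg x) h2; rewrite in_itv /= => /andP[c0 cy].
  rewrite distrC => ->; rewrite sub0r normrM normrN ler_wpM2r//; apply: bg.
  by rewrite !ltr0_norm// lerN2 ltW.
Qed.

(** First and second order estimates at zero of the functions that make up the
    complex exponential; the constants are not optimal. *)
Lemma sin_le (y : R) : `|sin y| <= `|y|.
Proof.
have := @mvt_bound (@sin R) (@cos R) 1 y (fun x => is_derive_sin x).
by rewrite sin0 subr0 mul1r; apply => x _; exact: cos_max.
Qed.

Lemma cosB1_le (y : R) : `|cos y - 1| <= `|y|.
Proof.
have := @mvt_bound (@cos R) (fun x => - sin x) 1 y (fun x => is_derive_cos x).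
by rewrite cos0 mul1r; apply => x _; rewrite normrN; exact: sin_max.
Qed.

Lemma cosB1_le2 (y : R) : `|cos y - 1| <= `|y| ^+ 2.
Proof.
have := @mvt_bound (@cos R) (fun x => - sin x) `|y| y (fun x => is_derive_cos x).
rewrite cos0 -expr2; apply => x xy; rewrite normrN; exact: le_trans (sin_le x) xy.
Qed.

Lemma sinB_le2 (y : R) : `|sin y - y| <= `|y| ^+ 2.
Proof.
have d (x : R) : is_derive x 1 (fun y : R => sin y - y) (cos x - 1).
  by apply: is_deriveB.
have := @mvt_bound _ _ `|y| y d.
rewrite sin0 !subr0 -expr2; apply => x xy; exact: le_trans (cosB1_le x) xy.
Qed.

Lemma cn_le2 (p q k : R) : `|p| <= k -> `|q| <= k -> cn (p +i* q) <= 2 * k.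
Proof.
move=> pk qk; have -> : p +i* q = p%:C + 'i%C * q%:C.
  by rewrite mulrC mulRC mulr0 mulr1; apply/eqP; rewrite eq_complex /= addr0 add0r !eqxx.
apply: le_trans (cnD _ _) _; rewrite cnM !cnR.
have -> : cn 'i%C = 1 :> R by rewrite /= expr0n add0r expr1n sqrtr1.
by rewrite mul1r; lra.
Qed.

Lemma expiD (x y : R) : expi (x + y) = expi x * expi y.
Proof.
rewrite /expi cosD sinD; apply/eqP; rewrite eq_complex /= eqxx /=.
by apply/eqP; rewrite addrC [_ * cos y]mulrC; ring.
Qed.

Lemma cn_expi (x : R) : cn (expi x) = 1.
Proof. by rewrite /= cos2Dsin2 sqrtr1. Qed.

Lemma expiB1 (y : R) : cn (expi y - 1) <= 2 * `|y|.
Proof.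
have -> : expi y - 1 = (cos y - 1) +i* (sin y) by apply/eqP; rewrite eq_complex /= subr0 !eqxx.
by apply: cn_le2; [exact: cosB1_le|exact: sin_le].
Qed.

Lemma expiB1B (y : R) : cn (expi y - 1 - 'i%C * y%:C) <= 2 * `|y| ^+ 2.
Proof.
have -> : expi y - 1 - 'i%C * y%:C = (cos y - 1) +i* (sin y - y).
  by rewrite ['i%C * _]mulrC mulRC mulr0 mulr1; apply/eqP; rewrite eq_complex /= !subr0 !eqxx.
by apply: cn_le2; [exact: cosB1_le2|exact: sinB_le2].
Qed.

Lemma expRB1 (x : R) : `|expR x - 1| <= `|x| * expR `|x|.
Proof.
have [x0|x0] := leP 0 x.
  rewrite !ger0_norm ?subr_ge0 -?expR0 ?ler_expR//; rewrite expR0.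
  have := expR_ge1Dx (- x); rewrite expRN => h.
  have e0 := expR_gt0 x.
  have : (1 - x) * expR x <= 1 by rewrite -ler_pdivlMr// div1r.
  by rewrite mulrBl mul1r; lra.
have e1 : expR x <= 1 by rewrite -expR0 ler_expR ltW.
rewrite ler0_norm ?subr_le0// opprB (ltr0_norm x0).
have := expR_ge1Dx x => h; apply: (@le_trans _ _ (- x)); first lra.
have nx : 0 <= - x by rewrite oppr_ge0 ltW.
by rewrite ler_peMr// -expR0 ler_expR.
Qed.

Lemma expRB1B (x : R) : `|expR x - 1 - x| <= `|x| ^+ 2 * expR `|x|.
Proof.
have dx (y : R) : is_derive y 1 (fun y : R => expR y - 1 - y) (expR y - 0 - 1).
  by apply: is_deriveB; apply: is_deriveB.
have := @mvt_bound _ _ (`|x| * expR `|x|) x dx.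
rewrite expR0 !subr0 !subrr subr0 expr2 mulrAC; apply => y yx.
rewrite subr0; apply: le_trans (expRB1 y) _; apply: ler_pM => //.
by rewrite ler_expR.
Qed.

Lemma cexpD z w : cexp (z + w) = cexp z * cexp w.
Proof.
case: z w => [p q] [p' q']; rewrite /cexp /= expRD expiD rmorphM /=.
by rewrite mulrACA.
Qed.

Lemma cn_cexp z : cn (cexp z) = expR (complex.Re z).
Proof. by rewrite /cexp cnM cn_expi mulr1 cnR ger0_norm// expR_ge0. Qed.

Lemma Im_le_cn z : `|complex.Im z| <= cn z.
Proof.
rewrite -ler_sqr ?nnegrE ?cn_ge0// real_normK ?num_real// cn_sqr.
by rewrite lerDr sqr_ge0.
Qed.

Lemma cexpB1 z : cn (cexp z - 1) <= 3 * cn z * expR (cn z).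
Proof.
set x := complex.Re z; set y := complex.Im z.
have hx := Re_le_cn z; have hy := Im_le_cn z; have n0 := cn_ge0 z.
have -> : cexp z - 1 = (expR x)%:C * (expi y - 1) + ((expR x) - 1)%:C.
  by rewrite /cexp -/x -/y mulrBr mulr1 rmorphB /= addrA subrK.
apply: le_trans (cnD _ _) _; rewrite cnM !cnR ger0_norm ?expR_ge0//.
have ex : expR x <= expR (cn z) by rewrite ler_expR (le_trans (ler_norm _)).
have -> : 3 * cn z * expR (cn z) = expR (cn z) * (2 * cn z) + cn z * expR (cn z) by ring.
apply: lerD.
  apply: ler_pM; rewrite ?expR_ge0 ?cn_ge0//; apply: le_trans (expiB1 _) _.
  by rewrite ler_pM2l.
apply: le_trans (expRB1 x) _; apply: ler_pM; rewrite ?expR_ge0//.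
by rewrite ler_expR.
Qed.

Lemma cexpB1B z : cn (cexp z - 1 - z) <= 4 * cn z ^+ 2 * expR (cn z).
Proof.
set x := complex.Re z; set y := complex.Im z.
have hx := Re_le_cn z; have hy := Im_le_cn z; have n0 := cn_ge0 z.
have e1 : 1 <= expR (cn z) by rewrite -expR0 ler_expR.
have -> : cexp z - 1 - z = (expR x)%:C * (expi y - 1 - 'i%C * y%:C) +
    (expR x - 1)%:C * ('i%C * y%:C) + (expR x - 1 - x)%:C.
  have zE : z = x%:C + 'i%C * y%:C := complexE z.
  have cE : cexp z = (expR x)%:C * expi y by [].
  rewrite cE [X in _ - X = _]zE !rmorphB rmorph1; ring.
have -> : 4 * cn z ^+ 2 * expR (cn z) = expR (cn z) * (2 * cn z ^+ 2) + (cn z * expR (cn z)) * cn z + cn z ^+ 2 * expR (cn z) by ring.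
have ex : expR x <= expR (cn z) by rewrite ler_expR (le_trans (ler_norm _)).
have ex' : expR `|x| <= expR (cn z) by rewrite ler_expR.
have sq (p : R) : `|p| <= cn z -> `|p| ^+ 2 <= cn z ^+ 2 by move=> ?; rewrite ler_sqr ?nnegrE.
apply: le_trans (cnD _ _) _; apply: lerD; first apply: le_trans (cnD _ _) _; first apply: lerD.
- rewrite cnM cnR ger0_norm ?expR_ge0//; apply: ler_pM; rewrite ?expR_ge0 ?cn_ge0//.
  by apply: le_trans (expiB1B _) _; rewrite ler_pM2l// sq.
- rewrite !cnM !cnR.
  have -> : cn 'i%C = 1 :> R by rewrite /= expr0n add0r expr1n sqrtr1.
  rewrite mul1r; apply: ler_pM => //; apply: le_trans (expRB1 x) _.
  by apply: ler_pM; rewrite ?expR_ge0.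
- rewrite cnR; apply: le_trans (expRB1B x) _.
  by apply: ler_pM; rewrite ?expR_ge0 ?sqr_ge0// sq.
Qed.

End Plane.

(** * Contour integrals *)

Section Contour.
Context {R : realType}.
Notation C := R[i].
Notation cn := Normc.normc.

Definition on_contour (a r eta : R) (z : C) : Prop :=
  (exists2 s : R, r <= s & z = a%:C + s%:C * expi (- eta) \/ z = a%:C + s%:C * expi eta) \/
  (exists2 phi : R, eta <= phi <= 2 * pi - eta & z = a%:C + r%:C * expi (- phi)).

Lemma on_contour_shift a r eta h z : on_contour a r eta z -> on_contour (a + h) r eta (z + h%:C).
Proof.
have e (w : C) : a%:C + w + h%:C = (a + h)%:C + w by rewrite rmorphD addrAC.
case=> [[s rs [->|->]]|[phi hphi ->]]; rewrite e.
- by left; exists s => //; left.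
- by left; exists s => //; right.
- by right; exists phi.
Qed.

Lemma cn_ray (a s phi : R) : 0 <= s -> cn (a%:C + s%:C * expi phi - a%:C) = s.
Proof. by move=> s0; rewrite addrC addKr cnM cn_expi cnR ger0_norm ?mulr1. Qed.

Lemma Re_ray (a s phi : R) : complex.Re (a%:C + s%:C * expi phi) = a + s * cos phi.
Proof. by rewrite ReD /expi mulRC. Qed.

(** The last inequality is an equality without 2 r on the rays; on the arc,
    where |z - a| = r, it follows from cos eta - 2 <= -1. *)
Lemma on_contour_geom a r eta z : 0 < r -> 0 < eta < pi / 2 -> on_contour a r eta z ->
  [/\ r <= cn (z - a%:C), complex.Re z - a <= cn (z - a%:C) * cos eta &
      cn (z - a%:C) * cos eta - 2 * r <= complex.Re z - a].
Proof.
move=> r0 /andP[e0 ep].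
have pi0 := pi_gt0 R.
case=> [[s rs [->|->]]|[phi /andP[p1 p2] ->]].
- have s0 : 0 <= s by apply: le_trans rs; exact: ltW.
  by rewrite cn_ray// Re_ray cosN; split => //; lra.
- have s0 : 0 <= s by apply: le_trans rs; exact: ltW.
  by rewrite cn_ray// Re_ray; split => //; lra.
- rewrite (cn_ray _ _ (ltW r0)) Re_ray cosN addrAC subrr add0r.
  have cphi : cos phi <= cos eta.
    have [pp|pp] := leP phi pi; first by apply: cos_le => //; exact: ltW.
    have -> : cos phi = cos (2 * pi - phi).
      by rewrite -(cosN (2 * pi - phi)) opprB mulr_natl -(cosD2pi (phi - pi *+ 2)) subrK.
    by apply: cos_le; lra.
  have := cos_geN1 phi; have := cos_le1 eta.
  split => //; first by rewrite ler_pM2l.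
  nra.
Qed.

Context {X : completeNormedModType R[i]}.
Implicit Types (f g : C -> X).

(** The contour integral as a total operator. *)
Definition contour_int (a r eta : R) f : X :=
  - bochner (oitv r None) (fun s => expi (- eta) *: f (a%:C + s%:C * expi (- eta)))
  + bochner (oitv eta (Some (2 * pi - eta)))
      (fun phi => (- 'i%C * r%:C * expi (- phi)) *: f (a%:C + r%:C * expi (- phi)))
  + bochner (oitv r None) (fun s => expi eta *: f (a%:C + s%:C * expi eta)).

Definition contour_cont a r eta f := forall z, on_contour a r eta z -> forall e : R, 0 < e ->
  exists2 d : R, 0 < d & forall w, on_contour a r eta w -> cn (w - z) < d -> rnorm (f w - f z) < e.

Definition contour_exp a r eta f (K k : R) := 
  forall z, on_contour a r eta z -> rnorm (f z) <= K * expR (- (k * cn (z - a%:C))).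

Definition contour_adm a r eta f := contour_cont a r eta f /\ exists K k : R, [/\ 0 <= K, 0 < k & contour_exp a r eta f K k].

Section Fixed.
Context (a r eta : R).
Hypotheses (r0 : 0 < r) (eta0 : 0 < eta < pi / 2).

Let arc_lt : eta < 2 * pi - eta.
Proof. by move: eta0 => /andP[_ ?]; have := pi_gt0 R; lra. Qed.

Lemma ray_cont_integrable (w : C) f K k : cn w = 1 -> (forall s, r <= s -> on_contour a r eta (a%:C + s%:C * w)) ->
  (forall s, 0 <= s -> cn (a%:C + s%:C * w - a%:C) = s) ->
  contour_cont a r eta f -> 0 <= K -> 0 < k -> contour_exp a r eta f K k ->
  cont_integrable (oitv r None) (fun s => w *: f (a%:C + s%:C * w)) /\
  rnorm (bochner (oitv r None) (fun s => w *: f (a%:C + s%:C * w))) <= K / k.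
Proof.
move=> w1 wG ws cf K0 k0 bf.
have cc : forall s, oitv r None s -> cont_at (fun s => w *: f (a%:C + s%:C * w)) s.
  move=> s /oitvP [rs _]; apply: cont_atZl => e e0.
  have [d d0 hd] := cf _ (wG s (ltW rs)) e e0.
  exists (Num.min d (s - r)); first by rewrite lt_min d0 subr_gt0.
  move=> s'; rewrite lt_min => /andP[s1]; rewrite ltr_norml => /andP[s2 _].
  apply: hd; first by apply: wG; lra.
  by rewrite opprD addrACA subrr add0r -mulrBl cnM w1 mulr1 -rmorphB cnR.
have bd : forall s, oitv r None s -> rnorm (w *: f (a%:C + s%:C * w)) <= K * expR (- (k * s)).
  move=> s /oitvP [rs _]; rewrite rnZ w1 mul1r; apply: le_trans (bf _ (wG s (ltW rs))) _.
  by rewrite ws// ltW// (lt_trans r0).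
have ib := exp_bound K0 k0 r0.
have ci : cont_integrable (oitv r None) (fun s => w *: f (a%:C + s%:C * w)).
  apply: (cont_integrable_dom (g := fun s => K * expR (- (k * s)))) => //; first exact: measurable_oitv.
  exact: le_lt_trans ib (ltry _).
split => //; apply: (bochner_norm _ ci _ bd ib); first exact: measurable_oitv.
apply: measurable_funM => //; apply: measurableT_comp => //; apply: measurable_funN => //.
Qed.

Lemma arc_cont_integrable f K k : contour_cont a r eta f -> 0 <= K -> 0 < k -> contour_exp a r eta f K k ->
  let h := fun phi => (- 'i%C * r%:C * expi (- phi)) *: f (a%:C + r%:C * expi (- phi)) in
  cont_integrable (oitv eta (Some (2 * pi - eta))) h /\
  rnorm (bochner (oitv eta (Some (2 * pi - eta))) h) <= 2 * pi * r * K.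
Proof.
move=> cf K0 k0 bf h.
have inG phi : eta <= phi <= 2 * pi - eta -> on_contour a r eta (a%:C + r%:C * expi (- phi)).
  by move=> ?; right; exists phi.
have expic (p q : R) : cn (expi (- p) - expi (- q)) <= 2 * `|p - q|.
  have -> : expi (- p) = expi (- q) * expi (q - p) by rewrite -expiD addKr.
  rewrite -{2}(mulr1 (expi (- q))) -mulrBr cnM cn_expi mul1r (distrC p).
  exact: expiB1.
have cci : cn (- 'i%C * r%:C : C) = r.
  rewrite cnM cnN cnR gtr0_norm//.
  by have -> : cn 'i%C = 1 :> R; rewrite ?mul1r// /= expr0n add0r expr1n sqrtr1.
have bd phi : oitv eta (Some (2 * pi - eta)) phi -> rnorm (h phi) <= r * K.
  move=> /oitvP [p1 /= p2]; rewrite /h rnZ cnM cn_expi mulr1 cci ler_pM2l//.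
  apply: le_trans (bf _ (inG phi _)) _; first by rewrite !ltW.
  rewrite ler_piMr// -expR0 ler_expR oppr_le0; apply: mulr_ge0; first exact: ltW.
  exact: cn_ge0.
have rK : 0 <= r * K by rewrite mulr_ge0// ltW.
have cc : forall phi, oitv eta (Some (2 * pi - eta)) phi -> cont_at h phi.
  move=> phi /oitvP [p1 /= p2]; apply: cont_atZ.
    move=> e e0; exists (e / (2 * r)); first by rewrite divr_gt0// mulr_gt0.
    move=> s; rewrite ltr_pdivlMr ?mulr_gt0// => hs.
    rewrite -mulrBr cnM cci; apply: le_lt_trans hs.
    rewrite [_ * (2 * r)]mulrC [2 * r]mulrC -mulrA ler_pM2l//; exact: expic.
  move=> e e0; have hp : eta <= phi <= 2 * pi - eta by rewrite !ltW.
  have [d d0 hd] := cf _ (inG phi hp) e e0.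
  exists (Num.min (d / (2 * r)) (Num.min (phi - eta) (2 * pi - eta - phi))).
    by rewrite !lt_min divr_gt0 ?mulr_gt0// !subr_gt0 p1.
  move=> s; rewrite !lt_min => /and3P[s1 s2 s3].
  move: s2 s3; rewrite !ltr_norml => /andP[s2 _] /andP[_ s3].
  apply: hd; first by apply: inG; apply/andP; split; lra.
  rewrite opprD addrACA subrr add0r -mulrBr cnM cnR gtr0_norm//.
  move: s1; rewrite ltr_pdivlMr ?mulr_gt0//; apply: le_lt_trans.
  by rewrite [_ * (2 * r)]mulrC [2 * r]mulrC -mulrA ler_pM2l//; exact: expic.
have muG := measure_oitv (ltW arc_lt).
have ci : cont_integrable (oitv eta (Some (2 * pi - eta))) h.
  apply: (cont_integrable_dom (g := fun _ => r * K)) => //; first exact: measurable_oitv.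
  by rewrite (integral_cst _ (measurable_oitv _ _))/= [X in (_ * X)%E]muG -EFinM ltry.
split => //; apply: le_trans (bochner_le_const (ltW arc_lt) ci bd) _.
have -> : 2 * pi * r * K = r * K * (2 * pi) by ring.
by rewrite ler_wpM2l//; move: eta0 => /andP[? _]; lra.
Qed.

Lemma low_ray f K k : contour_cont a r eta f -> 0 <= K -> 0 < k -> contour_exp a r eta f K k ->
  let h := fun s : R => expi (- eta) *: f (a%:C + s%:C * expi (- eta)) in
  cont_integrable (oitv r None) h /\ rnorm (bochner (oitv r None) h) <= K / k.
Proof.
move=> cf K0 k0 bf; apply: ray_cont_integrable => //; first exact: cn_expi.
  by move=> s rs; left; exists s => //; left.
by move=> s; apply: cn_ray.
Qed.

Lemma up_ray f K k : contour_cont a r eta f -> 0 <= K -> 0 < k -> contour_exp a r eta f K k ->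
  let h := fun s : R => expi eta *: f (a%:C + s%:C * expi eta) in
  cont_integrable (oitv r None) h /\ rnorm (bochner (oitv r None) h) <= K / k.
Proof.
move=> cf K0 k0 bf; apply: ray_cont_integrable => //; first exact: cn_expi.
  by move=> s rs; left; exists s => //; right.
by move=> s; apply: cn_ray.
Qed.

Lemma contour_int_norm f K k : contour_cont a r eta f -> 0 <= K -> 0 < k -> contour_exp a r eta f K k ->
  rnorm (contour_int a r eta f) <= K * (2 / k + 2 * pi * r).
Proof.
move=> cf K0 k0 bf.
have [_ h1] := low_ray cf K0 k0 bf; have [_ h2] := arc_cont_integrable cf K0 k0 bf.
have [_ h3] := up_ray cf K0 k0 bf.
rewrite /contour_int; apply: le_trans (rnD _ _) _; apply: le_trans (lerD (rnD _ _) (lexx _)) _.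
rewrite rnN; apply: le_trans (lerD (lerD h1 h2) h3) _.
have -> : K * (2 / k + 2 * pi * r) = K / k + 2 * pi * r * K + K / k by ring.
exact: lexx.
Qed.

Lemma contour_adm_pieces f : contour_adm a r eta f ->
  [/\ cont_integrable (oitv r None) (fun s : R => expi (- eta) *: f (a%:C + s%:C * expi (- eta))),
      cont_integrable (oitv eta (Some (2 * pi - eta)))
       (fun phi => (- 'i%C * r%:C * expi (- phi)) *: f (a%:C + r%:C * expi (- phi))) &
      cont_integrable (oitv r None) (fun s : R => expi eta *: f (a%:C + s%:C * expi eta))].
Proof.
move=> [cf [K [k [K0 k0 bf]]]]; split.
- by case: (low_ray cf K0 k0 bf).
- by case: (arc_cont_integrable cf K0 k0 bf).
- by case: (up_ray cf K0 k0 bf).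
Qed.

Lemma contour_int_is_contour f : contour_adm a r eta f -> is_contour_integral a r eta f (contour_int a r eta f).
Proof.
move=> /contour_adm_pieces [h1 h2 h3]; do 3!eexists; split; last by reflexivity.
- by apply: bochnerP h1; exact: measurable_oitv.
- by apply: bochnerP h2; exact: measurable_oitv.
- by apply: bochnerP h3; exact: measurable_oitv.
Qed.

Lemma contour_int_uniq f v : contour_adm a r eta f -> is_contour_integral a r eta f v -> v = contour_int a r eta f.
Proof.
move=> /contour_adm_pieces [h1 h2 h3] [l [m [u [b1 b2 b3 ->]]]]; rewrite /contour_int.
rewrite (bochner_eq _ h1 b1) ?(bochner_eq _ h2 b2) ?(bochner_eq _ h3 b3)//; exact: measurable_oitv.
Qed.

Lemma contour_adm_lin (c : C) f g : contour_adm a r eta f -> contour_adm a r eta g ->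
  contour_adm a r eta (fun z => c *: f z + g z).
Proof.
move=> [cf [K [k [K0 k0 bf]]]] [cg [L [l [L0 l0 bg]]]]; split.
  move=> z hz e e0.
  pose m := cn c + 1; have m0 : 0 < m by rewrite ltr_wpDl// cn_ge0.
  have [d1 d10 h1] := cf z hz (e / 2 / m) (divr_gt0 (divr_gt0 e0 (ltr0Sn _ _)) m0).
  have [d2 d20 h2] := cg z hz (e / 2) (divr_gt0 e0 (ltr0Sn _ _)).
  exists (Num.min d1 d2); first by rewrite lt_min d10.
  move=> w hw; rewrite lt_min => /andP[/(h1 w hw) {}h1 /(h2 w hw) {}h2].
  rewrite opprD addrACA -scalerBr (splitr e); apply: le_lt_trans (rnD _ _) _.
  apply: ler_ltD h2; rewrite rnZ.
  apply: (@le_trans _ _ (m * (e / 2 / m))); last by rewrite mulrCA divff ?mulr1// gt_eqF.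
  by apply: ler_pM; rewrite ?cn_ge0 ?rn_ge0// ?(ltW h1)// lerDl.
exists (cn c * K + L), (Num.min k l); split.
- by rewrite addr_ge0// mulr_ge0// cn_ge0.
- by rewrite lt_min k0.
- move=> z hz; apply: le_trans (rnD _ _) _; rewrite rnZ mulrDl -mulrA.
  have n0 := cn_ge0 (z - a%:C).
  apply: lerD.
    apply: ler_wpM2l; first exact: cn_ge0.
    apply: le_trans (bf z hz) _; apply: ler_wpM2l => //.
    by rewrite ler_expR lerN2 ler_wpM2r// ge_min lexx.
  apply: le_trans (bg z hz) _; apply: ler_wpM2l => //.
  by rewrite ler_expR lerN2 ler_wpM2r// ge_min lexx orbT.
Qed.

Lemma contour_int_lin (c : C) f g : contour_adm a r eta f -> contour_adm a r eta g ->
  contour_int a r eta (fun z => c *: f z + g z) = c *: contour_int a r eta f + contour_int a r eta g.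
Proof.
move=> /contour_adm_pieces [f1 f2 f3] /contour_adm_pieces [g1 g2 g3]; rewrite /contour_int.
have E b e (p : R -> C) (q : R -> C) : cont_integrable (oitv b e) (fun s => p s *: f (q s)) -> cont_integrable (oitv b e) (fun s => p s *: g (q s)) ->
   bochner (oitv b e) (fun s => p s *: (c *: f (q s) + g (q s))) =
   c *: bochner (oitv b e) (fun s => p s *: f (q s)) + bochner (oitv b e) (fun s => p s *: g (q s)).
  move=> h1 h2; rewrite -(bochner_lin c (measurable_oitv b e) h2 h1); congr bochner; apply/funext => s.
  by rewrite scalerDr !scalerA mulrC.
rewrite (E _ _ (fun _ => expi (- eta)) (fun s => a%:C + s%:C * expi (- eta)) f1 g1).
rewrite (E _ _ (fun _ => expi eta) (fun s => a%:C + s%:C * expi eta) f3 g3).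
rewrite (E _ _ (fun phi => - 'i%C * r%:C * expi (- phi)) (fun s => a%:C + r%:C * expi (- s)) f2 g2).
have zmod (x y z x' y' z' : X) : - (x + x') + (y + y') + (z + z') = (- x + y + z) + (- x' + y' + z').
  by rewrite opprD (addrACA (- x)) (addrACA (- x + y)).
by rewrite zmod !scalerDr scalerN.
Qed.

Lemma contour_adm_bounded_lin (A : X -> X) (c : R) f : bounded_lin A c -> contour_adm a r eta f -> contour_adm a r eta (fun z => A (f z)).
Proof.
move=> bA [cf [K [k [K0 k0 bf]]]]; split.
  move=> z hz e e0.
  pose m := `|c| + 1; have m0 : 0 < m by rewrite ltr_wpDl.
  have [d d0 hd] := cf z hz (e / m) (divr_gt0 e0 m0); exists d => // w hw /(hd w hw) h.
  apply: le_lt_trans (bounded_lin_lip bA _ _) _.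
  apply: (@le_lt_trans _ _ (m * rnorm (f w - f z))).
    by rewrite ler_wpM2r ?rn_ge0// (le_trans (ler_norm c))// lerDl.
  by rewrite mulrC -ltr_pdivlMr.
exists (`|c| * K), k; split => //; first exact: mulr_ge0.
move=> z hz; apply: le_trans (bA.2 _) _.
apply: (@le_trans _ _ (`|c| * rnorm (f z))); first by rewrite ler_wpM2r ?rn_ge0// ler_norm.
by rewrite -mulrA ler_wpM2l//; exact: bf.
Qed.

Lemma contour_int_bounded_lin (A : X -> X) (c : R) f : bounded_lin A c -> contour_adm a r eta f ->
  contour_int a r eta (fun z => A (f z)) = A (contour_int a r eta f).
Proof.
move=> bA /contour_adm_pieces [f1 f2 f3]; rewrite /contour_int !(bounded_linD bA) (bounded_linN bA).
have E b e (p : R -> C) (q : R -> C) : cont_integrable (oitv b e) (fun s => p s *: f (q s)) ->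
   bochner (oitv b e) (fun s => p s *: A (f (q s))) = A (bochner (oitv b e) (fun s => p s *: f (q s))).
  move=> h1; rewrite -(bochner_bounded_lin bA (measurable_oitv b e) h1); congr bochner; apply/funext => s.
  by rewrite (bounded_linZ bA).
rewrite (E _ _ (fun _ => expi (- eta)) (fun s => a%:C + s%:C * expi (- eta)) f1).
rewrite (E _ _ (fun _ => expi eta) (fun s => a%:C + s%:C * expi eta) f3).
by rewrite (E _ _ (fun phi => - 'i%C * r%:C * expi (- phi)) (fun s => a%:C + r%:C * expi (- s)) f2).
Qed.

Lemma contour_int_ext f g : (forall z, on_contour a r eta z -> f z = g z) -> contour_int a r eta f = contour_int a r eta g.
Proof.
move=> fg; rewrite /contour_int; congr (- _ + _ + _).
- by apply: bochner_ext => s /oitvP [s1 _]; rewrite fg//; left; exists s; [exact: ltW|left].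
- by apply: bochner_ext => s /oitvP [s1 s2]; rewrite fg//; right; exists s => //; rewrite !ltW.
- by apply: bochner_ext => s /oitvP [s1 _]; rewrite fg//; left; exists s; [exact: ltW|right].
Qed.

End Fixed.
End Contour.

(** * Cauchy theorem for the contour *)

Section Cauchy.
Context {R : realType}.
Notation C := R[i].
Notation cn := Normc.normc.
Context {X : completeNormedModType R[i]}.
Implicit Types (f p : C -> X).

Lemma near_limit_left a b m (F : R -> X) A : oitv a b m ->
  (forall e : R, 0 < e -> exists2 d : R, 0 < d &
     forall s, oitv a b s -> `|s - a| <= d -> rnorm (F s - A) <= e) -> limit_left a b F A.
Proof.
move=> hm hF e e0; have [d d0 hd] := hF e e0; have [am mb] := (oitvP _ _ _).1 hm.
exists (Num.min m (a + d)).
  apply/oitvP; split; first by rewrite lt_min am ltrDl.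
  by apply: below_trans mb; rewrite ge_min lexx.
move=> s hs; rewrite le_min => /andP[_ sd]; apply: hd => //.
have [as0 _] := (oitvP _ _ _).1 hs; rewrite gtr0_norm ?subr_gt0//; lra.
Qed.

Lemma near_limit_right a c m (F : R -> X) B : oitv a (Some c) m ->
  (forall e : R, 0 < e -> exists2 d : R, 0 < d &
     forall s, oitv a (Some c) s -> `|s - c| <= d -> rnorm (F s - B) <= e) -> limit_right a (Some c) F B.
Proof.
move=> hm hF e e0; have [d d0 hd] := hF e e0; have [am /= mb] := (oitvP _ _ _).1 hm.
exists (Num.max m (c - d)).
  apply/oitvP; split; first by rewrite lt_max am.
  by rewrite /= gt_max mb /= ltrBlDr ltrDl.
move=> s hs; rewrite ge_max => /andP[_ sd]; apply: hd => //.
have [_ /= sc] := (oitvP _ _ _).1 hs; rewrite ltr0_norm ?subr_lt0//; lra.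
Qed.

(** A function whose increments are quadratic in those of the variable is
    constant: sum the increments over n equal steps. *)
Lemma quad_const (F : R -> X) (b a K : R) : b <= a ->
  (forall x y, b <= x <= y -> y <= a -> y - x <= 1 -> rnorm (F y - F x) <= K * (y - x) ^+ 2) ->
  F b = F a.
Proof.
move=> ba HF.
have [K0|K0] := ltP K 0.
  have [->//|ne] := eqVneq b a.
  have ba' : b < a by rewrite lt_neqAle ne.
  pose y := b + Num.min 1 (a - b).
  have m0 : 0 < Num.min 1 (a - b) by rewrite lt_min ltr01 subr_gt0.
  have h : rnorm (F y - F b) <= K * (y - b) ^+ 2.
    have e : y - b = Num.min 1 (a - b) by rewrite /y addrC addKr.
    have hb : b <= y by rewrite /y lerDl ltW.
    by apply: HF; [rewrite lexx|rewrite /y -lerBrDl ge_min lexx orbT|rewrite e ge_min lexx].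
  have : K * (y - b) ^+ 2 < 0.
    by rewrite nmulr_rlt0// exprn_gt0// /y addrC addKr.
  by move=> /(le_lt_trans h); rewrite ltNge rn_ge0.
apply: rn_small => e e0.
pose L := a - b; have L0 : 0 <= L by rewrite subr_ge0.
pose n := (maxn (Num.trunc L).+1 (Num.trunc (K * L ^+ 2 / e)).+1).
have n0 : (0 < n)%N by rewrite leq_max.
have nR : (0 : R) < n%:R by rewrite ltr0n.
have n1 : L <= n%:R.
  by apply: le_trans (ltW (truncnS_gt _)) _; rewrite ler_nat leq_max leqnn.
have n2 : K * L ^+ 2 / n%:R <= e.
  rewrite ler_pdivrMr// [e * _]mulrC -ler_pdivrMr//; apply: le_trans (ltW (truncnS_gt _)) _.
  by rewrite ler_nat leq_max leqnn orbT.
pose x (i : nat) := b + L / n%:R * i%:R.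
have xS i : x i.+1 - x i = L / n%:R by rewrite /x -natr1 mulrDr mulr1 addrA [_ + L / _]addrC addrK.
have Ln : 0 <= L / n%:R by rewrite divr_ge0// ltW.
have step i : (i <= n)%N -> rnorm (F (x i) - F b) <= i%:R * (K * (L / n%:R) ^+ 2).
  elim: i => [|i IH] lin; first by rewrite /x mulr0 addr0 subrr rn0 mul0r.
  apply: le_trans (rn_tri (F (x i)) _ _) _.
  rewrite -natr1 mulrDl mul1r addrC; apply: lerD; first by apply: IH; exact: ltnW.
  rewrite -(xS i); apply: HF.
  - by apply/andP; split; [rewrite /x lerDl; exact: mulr_ge0|rewrite -subr_ge0 xS].
  - rewrite /x; have -> : a = b + L / n%:R * n%:R by rewrite divfK ?gt_eqF// addrC subrK.
    by rewrite lerD2l ler_wpM2l// ler_nat.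
  - by rewrite xS ler_pdivrMr// mul1r.
have := step n (leqnn n).
have -> : x n = a by rewrite /x divfK ?gt_eqF// addrC subrK.
rewrite rnBC => /le_trans; apply; apply: le_trans n2.
have -> : n%:R * (K * (L / n%:R) ^+ 2) = K * L ^+ 2 / n%:R by field; rewrite gt_eqF.
exact: lexx.
Qed.

Section Contour.
Context (r eta : R).
Hypotheses (r0 : 0 < r) (eta0 : 0 < eta < pi / 2).

Let ce0 : 0 < cos eta.
Proof.
by apply: cos_gt0_pihalf; move: eta0 => /andP[? ->]; rewrite andbT; have := pi_gt0 R; lra.
Qed.

Lemma cexp_on_contour (b t : R) z : 0 <= t -> on_contour b r eta z ->
  cn (cexp (- z * t%:C)) <= expR (- b * t + 2 * r * t) * expR (- (t * cos eta * cn (z - b%:C))).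
Proof.
move=> t0 /(on_contour_geom r0 eta0) [_ _ h3]; rewrite cn_cexp -expRD ler_expR.
have -> : complex.Re (- z * t%:C) = - complex.Re z * t by case: z {h3} => p q /=; rewrite mulr0 subr0.
nra.
Qed.

Lemma cexp_Re (t : R) (z : C) : complex.Re (- z * t%:C) = - (t * complex.Re z).
Proof. by case: z => p q /=; rewrite mulr0 subr0 mulNr mulrC. Qed.

Lemma cexp_lip (t : R) z w : 0 <= t -> cn (w - z) <= 1 ->
  cn (cexp (- w * t%:C) - cexp (- z * t%:C)) <= expR (- (t * complex.Re z)) * (3 * t * expR t * cn (w - z)).
Proof.
move=> t0 h1.
have -> : cexp (- w * t%:C) - cexp (- z * t%:C) = cexp (- z * t%:C) * (cexp (- (w - z) * t%:C) - 1).
  have e : - w * t%:C = - z * t%:C + - (w - z) * t%:C by ring.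
  by rewrite e cexpD mulrBr mulr1.
rewrite cnM cn_cexp cexp_Re ler_wpM2l ?expR_ge0//.
apply: le_trans (cexpB1 _) _; rewrite cnM cnN cnR ger0_norm//.
have -> : 3 * t * expR t * cn (w - z) = 3 * (cn (w - z) * t) * expR t by ring.
have n0 := cn_ge0 (w - z); apply: ler_wpM2l; first by rewrite !mulr_ge0.
by rewrite ler_expR ler_piMl.
Qed.

(** On the contour Re z grows like |z - b| cos eta, so the exponential provides the
    decay. *)
Lemma contour_adm_exp (b t : R) p (P : R) : 0 < t -> contour_cont b r eta p -> (forall z, on_contour b r eta z -> rnorm (p z) <= P) ->
  contour_cont b r eta (fun z => cexp (- z * t%:C) *: p z) /\
  contour_exp b r eta (fun z => cexp (- z * t%:C) *: p z) (`|P| * expR (- b * t + 2 * r * t)) (t * cos eta).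
Proof.
move=> t0 cp bp; split; last first.
  move=> z hz; rewrite rnZ [X in X <= _]mulrC -[X in _ <= X]mulrA; apply: ler_pM; rewrite ?rn_ge0 ?cn_ge0//.
    exact: le_trans (bp z hz) (ler_norm _).
  by apply: cexp_on_contour => //; exact: ltW.
move=> z hz e e0.
pose E := expR (- (t * complex.Re z)); have E0 : 0 < E by exact: expR_gt0.
pose K := 3 * t * expR t; have K0 : 0 < K by rewrite !mulr_gt0// expR_gt0.
pose Q := `|P| + 1; have Q0 : 0 < Q by rewrite ltr_wpDl.
have [d d0 hd] := cp z hz (e / 2 / E) (divr_gt0 (divr_gt0 e0 (ltr0Sn _ _)) E0).
pose d2 := e / 2 / (E * K * Q).
have EKQ : 0 < E * K * Q by apply: mulr_gt0 => //; exact: mulr_gt0.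
have d20 : 0 < d2 by apply: divr_gt0 => //; exact: divr_gt0.
exists (Num.min (Num.min d 1) d2); first by rewrite !lt_min d0 ltr01.
move=> w hw; rewrite !lt_min => /andP[/andP[w1 w2] w3].
have -> : cexp (- w * t%:C) *: p w - cexp (- z * t%:C) *: p z =
  (cexp (- w * t%:C) - cexp (- z * t%:C)) *: p w + cexp (- z * t%:C) *: (p w - p z).
  by rewrite scalerBl scalerBr addrA subrK.
apply: le_lt_trans (rnD _ _) _; rewrite !rnZ (splitr e); apply: ler_ltD.
  apply: (@le_trans _ _ ((E * (K * cn (w - z))) * Q)).
    apply: ler_pM; rewrite ?rn_ge0 ?cn_ge0//; first by apply: cexp_lip; exact: ltW.
    by apply: le_trans (bp w hw) _; apply: le_trans (ler_norm _) _; rewrite lerDl.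
  have -> : E * (K * cn (w - z)) * Q = cn (w - z) * (E * K * Q) by ring.
  by rewrite -ler_pdivlMr// ltW.
rewrite cn_cexp cexp_Re -/E; have := hd w hw w1.
by rewrite ltr_pdivlMr// mulrC.
Qed.

Lemma expi_arc_end : expi (- (2 * pi - eta)) = expi eta :> C.
Proof.
rewrite /expi cosN sinN; have -> : 2 * pi - eta = - eta + pi *+ 2 by rewrite mulr_natl addrC.
by rewrite cosD2pi sinD2pi cosN sinN opprK.
Qed.

(** Holomorphy of F enters only as a quadratic Taylor estimate along the contour.
    The three pieces are computed by the fundamental theorem; the boundary values at
    the junctions of the arc with the rays cancel, and F vanishes at infinity. *)
Lemma contour_int_deriv0 b (F f : C -> X) (K L k : R) : contour_adm b r eta f -> 0 <= K ->
  (forall z w, on_contour b r eta z -> on_contour b r eta w -> cn (w - z) <= 1 ->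
     rnorm (F w - F z - (w - z) *: f z) <= K * cn (w - z) ^+ 2) ->
  0 <= L -> 0 < k -> contour_exp b r eta F L k -> contour_int b r eta f = 0.
Proof.
move=> af K0 dF L0 k0 decF.
have pi0 := pi_gt0 R; have /andP[e0 ep] := eta0.
have [c1 c2 c3] := contour_adm_pieces r0 eta0 af.
have lipF z w : on_contour b r eta z -> on_contour b r eta w -> cn (w - z) <= 1 ->
    rnorm (F w - F z) <= (rnorm (f z) + K) * cn (w - z).
  move=> hz hw h1; apply: le_trans (rnDB _ ((w - z) *: f z)) _.
  apply: le_trans (lerD (dF z w hz hw h1) (lexx _)) _.
  rewrite rnZ mulrDl addrC [rnorm _ * _]mulrC lerD2l ler_wpM2l// expr2 ler_piMl//; exact: cn_ge0.
have endF z (g : R -> C) s0 Q (D : set R) : 0 < Q -> on_contour b r eta z ->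
    (forall s, D s -> on_contour b r eta (g s)) ->
    (forall s, D s -> cn (g s - z) <= Q * `|s - s0|) ->
    forall e : R, 0 < e -> exists2 d : R, 0 < d &
    forall s, D s -> `|s - s0| <= d -> rnorm (F (g s) - F z) <= e.
  move=> Q0 hz hg hgs e e1.
  pose N := rnorm (f z) + K + 1; have N0 : 0 < N by rewrite ltr_wpDl// addr_ge0// rn_ge0.
  exists (Num.min (1 / Q) (e / N / Q)); first by rewrite lt_min !divr_gt0.
  move=> s hs; rewrite le_min => /andP[s1 s2]; have gs := hgs s hs.
  have h1 : cn (g s - z) <= 1 by apply: le_trans gs _; rewrite mulrC -ler_pdivlMr.
  apply: le_trans (lipF _ _ hz (hg s hs) h1) _.
  apply: (@le_trans _ _ (N * (Q * `|s - s0|))).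
    by apply: ler_pM => //; rewrite ?addr_ge0 ?rn_ge0 ?cn_ge0// /N lerDl.
  by rewrite mulrC -ler_pdivlMr// mulrC -ler_pdivlMr.
have rayI (w : C) : cn w = 1 -> (forall s, r <= s -> on_contour b r eta (b%:C + s%:C * w)) ->
    (forall s, 0 <= s -> cn (b%:C + s%:C * w - b%:C) = s) ->
    cont_integrable (oitv r None) (fun s => w *: f (b%:C + s%:C * w)) ->
    bochner (oitv r None) (fun s => w *: f (b%:C + s%:C * w)) = 0 - F (b%:C + r%:C * w).
  move=> w1 wG ws ci.
  have dist s s' : cn (b%:C + s%:C * w - (b%:C + s'%:C * w)) = `|s - s'|.
    by rewrite opprD addrACA subrr add0r -mulrBl cnM w1 mulr1 -rmorphB cnR.
  have m1 : oitv r None (r + 1) by apply/oitvP; rewrite ltrDl.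
  apply: (bochner_ftc (F := fun s => F (b%:C + s%:C * w)) m1 ci).
  - move=> s /oitvP [rs _] e e1.
    exists (Num.min (Num.min 1 (s - r)) (e / (K + 1))).
      by rewrite !lt_min ltr01 subr_gt0 rs divr_gt0// ltr_wpDl.
    move=> h; rewrite !lt_min => /andP[/andP[h1 h2] h3].
    have sh : r <= s + h by move: h2; rewrite ltr_norml => /andP[? _]; lra.
    have dd := dist (s + h) s; rewrite [s + h]addrC addrK in dd.
    have := dF _ _ (wG s (ltW rs)) (wG _ sh); rewrite [s + h]addrC dd => /(_ (ltW h1)).
    have -> : b%:C + (h + s)%:C * w - (b%:C + s%:C * w) = h%:C * w by rewrite rmorphD /=; ring.
    rewrite scalerA => /le_trans; apply; rewrite expr2 mulrA ler_wpM2r//.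
    move: h3; rewrite ltr_pdivlMr ?ltr_wpDl// => h3.
    by apply: le_trans (ltW h3); rewrite mulrC ler_wpM2l// lerDl.
  - apply: (near_limit_left m1); apply: (endF _ _ _ 1) => //; first exact: wG.
      by move=> s /oitvP [rs _]; apply: wG; exact: ltW.
    by move=> s _; rewrite dist mul1r.
  (* at infinity F is dominated by L / (k s) *)
  - move=> e e1; have [m hm] : exists m : R, r < m /\ L / (k * m) <= e.
      exists (Num.max (r + 1) (L / k / e)); split; first by rewrite lt_max ltrDl ltr01.
      have M0 : 0 < Num.max (r + 1) (L / k / e) by rewrite lt_max ltr_wpDl// ltW.
      rewrite invfM mulrA ler_pdivrMr// [e * _]mulrC -ler_pdivrMr//.
      by rewrite le_max lexx orbT.
    exists m; first by apply/oitvP; case: hm.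
    move=> s /oitvP [rs _] ms; rewrite subr0; have s0 : 0 < s := lt_trans r0 rs.
    apply: le_trans (decF _ (wG s (ltW rs))) _; rewrite ws ?(ltW s0)//.
    apply: le_trans hm.2; apply: (@le_trans _ _ (L / (k * s))).
      apply: ler_wpM2l => //; rewrite expRN lef_pV2 ?posrE ?expR_gt0 ?mulr_gt0//.
      by apply: le_trans (expR_ge1Dx _); rewrite lerDr.
    have m0 : 0 < m by apply: lt_trans hm.1.
    by apply: ler_wpM2l => //; rewrite lef_pV2 ?posrE ?mulr_gt0// ler_pM2l.
have lowE := rayI (expi (- eta)) (cn_expi _) (fun s rs => or_introl (ex_intro2 _ _ s rs (or_introl erefl))) (fun s s0 => cn_ray b (- eta) s0) c1.
have upE := rayI (expi eta) (cn_expi _) (fun s rs => or_introl (ex_intro2 _ _ s rs (or_intror erefl))) (fun s s0 => cn_ray b eta s0) c3.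
have arcG phi : eta <= phi <= 2 * pi - eta -> on_contour b r eta (b%:C + r%:C * expi (- phi)).
  by move=> ?; right; exists phi.
have arcdist (p q : R) : cn (b%:C + r%:C * expi (- p) - (b%:C + r%:C * expi (- q))) <= 2 * r * `|p - q|.
  rewrite opprD addrACA subrr add0r -mulrBr cnM cnR gtr0_norm//.
  rewrite [2 * r]mulrC -mulrA ler_pM2l//.
  have -> : expi (- p) = expi (- q) * expi (q - p) by rewrite -expiD addKr.
  rewrite -{2}(mulr1 (expi (- q))) -mulrBr cnM cn_expi mul1r (distrC p).
  exact: expiB1.
have pm : oitv eta (Some (2 * pi - eta)) pi by apply/oitvP; split => /=; lra.
have arcE : bochner (oitv eta (Some (2 * pi - eta)))
      (fun phi => (- 'i%C * r%:C * expi (- phi)) *: f (b%:C + r%:C * expi (- phi))) =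
    F (b%:C + r%:C * expi eta) - F (b%:C + r%:C * expi (- eta)).
  have r20 : 0 < 2 * r by rewrite mulr_gt0.
  apply: (bochner_ftc (F := fun phi => F (b%:C + r%:C * expi (- phi))) pm c2).
  - move=> phi /oitvP [p1 /= p2] e e1.
    have pG : on_contour b r eta (b%:C + r%:C * expi (- phi)) by apply: arcG; rewrite !ltW.
    set z := b%:C + r%:C * expi (- phi) in pG *.
    pose N := K * (2 * r) ^+ 2 + r * 2 * rnorm (f z) + 1.
    have N0 : 0 < N by rewrite ltr_wpDl// addr_ge0// !mulr_ge0 ?exprn_ge0 ?rn_ge0// ltW.
    exists (Num.min (Num.min (1 / (2 * r)) (e / N)) (Num.min (phi - eta) (2 * pi - eta - phi))).
      by rewrite !lt_min !divr_gt0// !subr_gt0 p1.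
    move=> h; rewrite !lt_min => /andP[/andP[h1 h2] /andP[h3 h4]].
    have hG : on_contour b r eta (b%:C + r%:C * expi (- (phi + h))).
      by apply: arcG; move: h3 h4; rewrite !ltr_norml => /andP[? ?] /andP[? ?]; apply/andP; split; lra.
    set w := b%:C + r%:C * expi (- (phi + h)) in hG *.
    have wz : cn (w - z) <= 2 * r * `|h|.
      by have := arcdist (phi + h) phi; rewrite [phi + h]addrC addrK [h + phi]addrC.
    have wz1 : cn (w - z) <= 1.
      by apply: le_trans wz _; rewrite mulrC -ler_pdivlMr// ltW.
    have -> : F w - F z - h%:C *: ((- 'i%C * r%:C * expi (- phi)) *: f z) =
      (F w - F z - (w - z) *: f z) + ((w - z) - h%:C * (- 'i%C * r%:C * expi (- phi))) *: f z.
      by rewrite scalerA (scalerBl (w - z) (h%:C * _)) addrA subrK.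
    apply: le_trans (rnD _ _) _; apply: le_trans (lerD (dF z w pG hG wz1) (lexx _)) _.
    rewrite rnZ.
    have -> : w - z - h%:C * (- 'i%C * r%:C * expi (- phi)) = r%:C * expi (- phi) * (expi (- h) - 1 - 'i%C * (- h)%:C).
      by rewrite /w /z opprD expiD rmorphN; ring.
    rewrite !cnM cn_expi mulr1 cnR gtr0_norm//.
    have hb := expiB1B (- h); rewrite normrN in hb.
    apply: (@le_trans _ _ (K * (2 * r * `|h|) ^+ 2 + r * (2 * `|h| ^+ 2) * rnorm (f z))).
      apply: lerD; first by apply: ler_wpM2l => //; rewrite ler_sqr ?nnegrE ?cn_ge0// mulr_ge0// ltW.
      by apply: ler_wpM2r; rewrite ?rn_ge0// ler_pM2l.
    apply: (@le_trans _ _ (N * `|h| * `|h|)).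
      have -> : K * (2 * r * `|h|) ^+ 2 + r * (2 * `|h| ^+ 2) * rnorm (f z) = (N - 1) * `|h| * `|h|.
        by rewrite /N; ring.
      by rewrite !ler_wpM2r// gerBl.
    by rewrite ler_wpM2r// mulrC -ler_pdivlMr// ltW.
  - apply: (near_limit_left pm); apply: (endF _ _ _ (2 * r)) => //.
    + by apply: arcG; apply/andP; split; lra.
    + by move=> s /oitvP [s1 /= s2]; apply: arcG; rewrite !ltW.
  - rewrite -expi_arc_end; apply: (near_limit_right pm); apply: (endF _ _ _ (2 * r)) => //.
    + by apply: arcG; apply/andP; split; lra.
    + by move=> s /oitvP [s1 /= s2]; apply: arcG; rewrite !ltW.
rewrite /contour_int lowE upE arcE !sub0r opprK addrC [F (b%:C + r%:C * expi (- eta)) + _]addrC subrK.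
by rewrite addNr.
Qed.

End Contour.
End Cauchy.

(** * Families of contour integrals *)

Section Families.
Context {R : realType}.
Notation C := R[i].
Notation cn := Normc.normc.
Context {X : completeNormedModType R[i]}.
Implicit Types (p : C -> X).

(** A uniform version of: p is holomorphic with derivative q. *)
Definition lip_deriv (Om : C -> Prop) p (q : C -> X) (K : R) : Prop :=
  [/\ 0 <= K, forall z, Om z -> rnorm (p z) <= K /\ rnorm (q z) <= K,
    forall z w, Om z -> Om w -> rnorm (p w - p z - (w - z) *: q z) <= K * cn (w - z) ^+ 2 &
    forall z w, Om z -> Om w -> rnorm (q w - q z) <= K * cn (w - z)].

Lemma lip_deriv_lip Om p q K z w : lip_deriv Om p q K -> Om z -> Om w -> cn (w - z) <= 1 ->
  rnorm (p w - p z) <= 2 * K * cn (w - z).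
Proof.
move=> [K0 bd dp _] hz hw h1; apply: le_trans (rnDB _ ((w - z) *: q z)) _.
apply: le_trans (lerD (dp z w hz hw) (lexx _)) _; rewrite rnZ.
have [_ hq] := bd z hz; have n0 := cn_ge0 (w - z).
have : K * cn (w - z) ^+ 2 <= K * cn (w - z) by rewrite ler_wpM2l// expr2 ler_piMl.
have : cn (w - z) * rnorm (q z) <= cn (w - z) * K by rewrite ler_wpM2l.
lra.
Qed.

Lemma lip_contour_cont b r eta p K : 0 <= K -> (forall z w, on_contour b r eta z -> on_contour b r eta w -> cn (w - z) <= 1 ->
  rnorm (p w - p z) <= K * cn (w - z)) -> contour_cont b r eta p.
Proof.
move=> K0 hp z hz e e0; exists (Num.min 1 (e / (K + 1))).
  by rewrite lt_min ltr01 divr_gt0// ltr_wpDl.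
move=> w hw; rewrite lt_min => /andP[w1 w2]; apply: le_lt_trans (hp z w hz hw (ltW w1)) _.
move: w2; rewrite ltr_pdivlMr ?ltr_wpDl// => w2; apply: le_lt_trans w2.
by rewrite mulrC ler_wpM2l ?cn_ge0// lerDl.
Qed.

Section Contour.
Context (r eta : R).
Hypotheses (r0 : 0 < r) (eta0 : 0 < eta < pi / 2).

Let ce0 : 0 < cos eta.
Proof.
by apply: cos_gt0_pihalf; move: eta0 => /andP[? ->]; rewrite andbT; have := pi_gt0 R; lra.
Qed.

(** This provides the hypothesis of contour_int_deriv0 for the product of p with an
    exponential. *)
Lemma exp_family Om p q K (t : R) z w : lip_deriv Om p q K -> 0 <= t -> Om z -> Om w -> cn (w - z) <= 1 ->
  rnorm (cexp (- w * t%:C) *: p w - cexp (- z * t%:C) *: p z -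
     (w - z) *: (cexp (- z * t%:C) *: (q z - t%:C *: p z))) <=
  expR (- (t * complex.Re z)) * (K * (4 * t ^+ 2 * expR t + 1 + 2 * t)) * cn (w - z) ^+ 2.
Proof.
move=> ab t0 hz hw h1; have [K0 bd dp _] := ab; have n0 := cn_ge0 (w - z).
pose E := cexp (- (w - z) * t%:C).
have eE : cexp (- w * t%:C) = cexp (- z * t%:C) * E.
  by rewrite /E -cexpD; congr cexp; ring.
set c := cexp (- z * t%:C).
have -> : cexp (- w * t%:C) *: p w - c *: p z - (w - z) *: (c *: (q z - t%:C *: p z)) =
   c *: ((E - 1 + (w - z) * t%:C) *: p w + (p w - p z - (w - z) *: q z) - ((w - z) * t%:C) *: (p w - p z)).
  have gid (d e k tt : C) (pw pz qz : X) : (d * e) *: pw - d *: pz - k *: (d *: (qz - tt *: pz)) =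
      d *: ((e - 1 + k * tt) *: pw + (pw - pz - k *: qz) - (k * tt) *: (pw - pz)).
    rewrite scalerA [k * d]mulrC -!scalerA -!scalerBr; congr (_ *: _).
    have e1 : (e - 1 + k * tt) *: pw = e *: pw - pw + (k * tt) *: pw.
      by rewrite scalerDl scalerBl scale1r.
    rewrite e1 !scalerBr !scalerA.
    have zid (A B D F P W : X) : A - P - (D - F) = (A - W + B) + (W - P - D) - (B - F).
      rewrite !opprB !addrA (addrAC A (- W) B) (subrK W) (addrAC (A + B - P - D) F).
      by rewrite (addrAC (A + B - P) (- D)) (addrAC (A + B) (- P)) addrK (addrAC (A - P) F).
    exact: zid.
  by rewrite eE gid.
have hE : cn (E - 1 + (w - z) * t%:C) <= 4 * t ^+ 2 * expR t * cn (w - z) ^+ 2.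
  have := cexpB1B (- (w - z) * t%:C); rewrite -/E mulNr opprK => /le_trans; apply.
  rewrite cnN cnM cnR ger0_norm//.
  have -> : 4 * t ^+ 2 * expR t * cn (w - z) ^+ 2 = 4 * (cn (w - z) * t) ^+ 2 * expR t by ring.
  apply: ler_wpM2l; first by rewrite mulr_ge0 ?sqr_ge0.
  by rewrite ler_expR ler_piMl.
have hl := lip_deriv_lip ab hz hw h1.
rewrite rnZ cn_cexp cexp_Re -[leRHS]mulrA; apply: ler_wpM2l; first exact: expR_ge0.
have [hpw _] := bd w hw.
apply: le_trans (rnD _ _) _; rewrite rnN.
apply: le_trans (lerD (rnD _ _) (lexx _)) _; rewrite !rnZ.
have a1 : cn (E - 1 + (w - z) * t%:C) * rnorm (p w) <= (4 * t ^+ 2 * expR t * cn (w - z) ^+ 2) * K.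
  by apply: ler_pM => //; [exact: cn_ge0|exact: rn_ge0].
have a3 : cn ((w - z) * t%:C) * rnorm (p w - p z) <= cn (w - z) * t * (2 * K * cn (w - z)).
  by rewrite cnM cnR ger0_norm//; apply: ler_wpM2l => //; exact: mulr_ge0.
apply: le_trans (lerD (lerD a1 (dp z w hz hw)) a3) _.
by rewrite le_eqVlt; apply/orP; left; apply/eqP; ring.
Qed.

Lemma contour_cont_lin b (c : C) p p2 : contour_cont b r eta p -> contour_cont b r eta p2 ->
  contour_cont b r eta (fun z => c *: p z + p2 z).
Proof.
move=> cp cg z hz e e0.
pose m := cn c + 1; have m0 : 0 < m by rewrite ltr_wpDl// cn_ge0.
have [d1 d10 h1] := cp z hz (e / 2 / m) (divr_gt0 (divr_gt0 e0 (ltr0Sn _ _)) m0).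
have [d2 d20 h2] := cg z hz (e / 2) (divr_gt0 e0 (ltr0Sn _ _)).
exists (Num.min d1 d2); first by rewrite lt_min d10.
move=> w hw; rewrite lt_min => /andP[/(h1 w hw) {}h1 /(h2 w hw) {}h2].
rewrite opprD addrACA -scalerBr (splitr e); apply: le_lt_trans (rnD _ _) _.
apply: ler_ltD h2; rewrite rnZ.
apply: (@le_trans _ _ (m * (e / 2 / m))); last by rewrite mulrCA divff ?mulr1// gt_eqF.
by apply: ler_pM; rewrite ?cn_ge0 ?rn_ge0// ?(ltW h1)// lerDl.
Qed.

Lemma lip_deriv_contour_cont Om p q K b : lip_deriv Om p q K -> (forall z, on_contour b r eta z -> Om z) ->
  contour_cont b r eta p /\ contour_cont b r eta q.
Proof.
move=> ab sub; have [K0 bd dp dq] := ab; split.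
  apply: (@lip_contour_cont _ _ _ _ (2 * K)); first exact: mulr_ge0.
  by move=> z w hz hw h1; apply: lip_deriv_lip h1; [exact: ab|exact: sub|exact: sub].
by apply: (@lip_contour_cont _ _ _ _ K) => // z w hz hw _; apply: dq; exact: sub.
Qed.

Lemma contour_int_shift x h f : contour_int (x + h) r eta f = contour_int x r eta (fun z => f (z + h%:C)) :> X.
Proof.
rewrite /contour_int.
have E D (u v : R -> C) : bochner D (fun s => u s *: f ((x + h)%:C + v s)) =
    bochner D (fun s => u s *: f (x%:C + v s + h%:C)).
  by congr bochner; apply/funext => s; rewrite rmorphD addrAC.
rewrite (E _ (fun _ => expi (- eta)) (fun s => s%:C * expi (- eta))).
rewrite (E _ (fun _ => expi eta) (fun s => s%:C * expi eta)).
by rewrite (E _ (fun phi => - 'i%C * r%:C * expi (- phi)) (fun s => r%:C * expi (- s))).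
Qed.

Section Translate.
Context (Om : C -> Prop) (p q : C -> X) (K t : R).
Hypotheses (ab : lip_deriv Om p q K) (t0 : 0 < t).

Let f z := cexp (- z * t%:C) *: p z.
Let f1 z := cexp (- z * t%:C) *: (q z - t%:C *: p z).

Let f_adm b : (forall z, on_contour b r eta z -> Om z) ->
  contour_cont b r eta f /\ contour_exp b r eta f (K * expR (- b * t + 2 * r * t)) (t * cos eta).
Proof.
move=> sub; have [K0 bd _ _] := ab.
have [cp cq] := lip_deriv_contour_cont ab sub.
have := contour_adm_exp r0 eta0 t0 cp (fun z hz => (bd z (sub z hz)).1).
by rewrite (ger0_norm K0).
Qed.

Let f1_adm b : (forall z, on_contour b r eta z -> Om z) -> contour_adm b r eta f1.
Proof.
move=> sub; have [K0 bd _ _] := ab.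
have [cp cq] := lip_deriv_contour_cont ab sub.
have cc : contour_cont b r eta (fun z => q z - t%:C *: p z).
  have := contour_cont_lin (- t%:C) cp cq; congr (contour_cont _ _ _ _).
  by apply/funext => z; rewrite scaleNr addrC.
have [] := contour_adm_exp (P := K + t * K) r0 eta0 t0 cc.
  move=> z /sub /bd [h1 h2]; apply: le_trans (rnB _ _) _; apply: lerD => //.
  by rewrite rnZR gtr0_norm// ler_pM2l.
move=> h1 h2; split=> //; do 2!eexists; split; last exact: h2.
- by rewrite mulr_ge0 ?expR_ge0.
- exact: mulr_gt0.
Qed.

Let Kt := K * (4 * t ^+ 2 * expR t + 1 + 2 * t).

Let Kt0 : 0 <= Kt.
Proof.
have [K0 _ _ _] := ab; apply: mulr_ge0 => //.
by rewrite !addr_ge0// ?mulr_ge0 ?expR_ge0 ?sqr_ge0// ltW.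
Qed.

Lemma contour_int_exp_deriv0 b : (forall z, on_contour b r eta z -> Om z) -> contour_int b r eta f1 = 0.
Proof.
move=> sub; have [K0 _ _ _] := ab; have [_ hf] := f_adm sub.
apply: (@contour_int_deriv0 _ _ _ _ r0 eta0 b f f1 (expR (- b * t + 2 * r * t) * Kt) _ _ (f1_adm sub) _ _ _ _ hf).
- by rewrite mulr_ge0 ?expR_ge0.
- move=> z w hz hw h1; apply: le_trans (exp_family ab (ltW t0) (sub z hz) (sub w hw) h1) _.
  apply: ler_wpM2r; first exact: exprn_ge0 (cn_ge0 _).
  apply: ler_wpM2r => //; rewrite -cexp_Re -cn_cexp.
  apply: le_trans (cexp_on_contour r0 eta0 (ltW t0) hz) _.
  rewrite ler_piMr ?expR_ge0// -expR0 ler_expR oppr_le0.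
  by rewrite !mulr_ge0 ?cn_ge0// ltW.
- by rewrite mulr_ge0 ?expR_ge0.
- exact: mulr_gt0.
Qed.

(** Translating the contour by h changes the integral by h times the integral of
    the derivative, which vanishes, up to a term of order h^2; hence the integral does
    not depend on the vertex. *)
Lemma contour_int_translate b a : b <= a ->
  (forall c, b <= c <= a -> forall z, on_contour c r eta z -> Om z) ->
  contour_int b r eta f = contour_int a r eta f.
Proof.
move=> ba sub; have [K0 _ _ _] := ab.
pose k := t * cos eta; have k0 : 0 < k by exact: mulr_gt0.
pose M := expR (- b * t + 2 * r * t) * Kt.
apply: (@quad_const _ _ (fun c => contour_int c r eta f) b a (M * (2 / k + 2 * pi * r)) ba).
move=> x y /andP[bx xy] ya h1; set h := y - x in h1 *.
have h0 : 0 <= h by rewrite subr_ge0.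
have yE : y = x + h by rewrite /h addrC subrK.
clearbody h; subst y.
have subx : forall z, on_contour x r eta z -> Om z by apply: sub; rewrite bx (le_trans xy ya).
have suby : forall z, on_contour (x + h) r eta z -> Om z by apply: sub; rewrite ya (le_trans bx xy).
have shG z : on_contour x r eta z -> on_contour (x + h) r eta (z + h%:C) by apply: on_contour_shift.
have CIy : contour_int (x + h) r eta f = contour_int x r eta (fun z => f (z + h%:C)).
  exact: contour_int_shift.
have [cy ey] := f_adm suby; have [cx ex] := f_adm subx.
have ax : contour_adm x r eta f.
  by split=> //; do 2!eexists; split; last exact: ex; [rewrite mulr_ge0 ?expR_ge0|].
have ah : contour_adm x r eta (fun z => f (z + h%:C)).
  split.
    move=> z hz e e0; have [d d0 hd] := cy _ (shG z hz) e e0; exists d => // w hw wz.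
    by apply: hd; [exact: shG|rewrite opprD addrACA subrr addr0].
  do 2!eexists; split; last first.
    move=> z hz; apply: le_trans (ey _ (shG z hz)) _.
    have -> : z + h%:C - (x + h)%:C = z - x%:C by rewrite rmorphD opprD addrACA subrr addr0.
    exact: lexx.
  - exact: k0.
  - by rewrite mulr_ge0 ?expR_ge0.
have a1 := f1_adm subx.
pose g z := (- h%:C) *: f1 z + ((-1) *: f z + f (z + h%:C)).
have ag : contour_adm x r eta (fun z => (-1) *: f z + f (z + h%:C)) by apply: contour_adm_lin.
have agg : contour_adm x r eta g by apply: contour_adm_lin.
have CIg : contour_int x r eta g = contour_int (x + h) r eta f - contour_int x r eta f.
  rewrite CIy /g (contour_int_lin r0 eta0 (- h%:C) a1 ag) (contour_int_lin r0 eta0 (-1) ax ah).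
  by rewrite (contour_int_exp_deriv0 subx) scaler0 add0r scaleN1r addrC.
rewrite -CIg.
have eg : contour_exp x r eta g (M * h ^+ 2) k.
  move=> z hz.
  have dz : (z + h%:C) - z = h%:C by rewrite addrC addKr.
  have := exp_family ab (ltW t0) (subx z hz) (suby _ (shG z hz)).
  rewrite dz cnR (ger0_norm h0) => /(_ h1).
  have -> : cexp (- (z + h%:C) * t%:C) *: p (z + h%:C) - cexp (- z * t%:C) *: p z -
     h%:C *: (cexp (- z * t%:C) *: (q z - t%:C *: p z)) = g z.
    by rewrite /g /f /f1 scaleN1r scaleNr addrC [_ - cexp (- z * t%:C) *: p z]addrC.
  move=> /le_trans; apply.
  rewrite -cexp_Re -cn_cexp -/Kt.
  have := cexp_on_contour r0 eta0 (ltW t0) hz; rewrite -/k => hc.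
  rewrite /M.
  have -> : expR (- b * t + 2 * r * t) * Kt * h ^+ 2 * expR (- (k * cn (z - x%:C))) =
     expR (- b * t + 2 * r * t) * expR (- (k * cn (z - x%:C))) * Kt * h ^+ 2 by ring.
  apply: ler_wpM2r; first exact: sqr_ge0.
  apply: ler_wpM2r => //; apply: le_trans hc _; apply: ler_wpM2r; first exact: expR_ge0.
  by rewrite ler_expR lerD2r ler_wpM2r ?lerN2// ltW.
apply: le_trans (contour_int_norm r0 eta0 agg.1 _ k0 eg) _.
  by apply: mulr_ge0 (sqr_ge0 _); exact: mulr_ge0 (expR_ge0 _) Kt0.
by rewrite mulrAC.
Qed.

End Translate.

(** Up to the factor - t the integrand is its own derivative. *)
Lemma contour_int_exp_cst b (t : R) (v : X) : 0 < t ->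
  contour_int b r eta (fun z => cexp (- z * t%:C) *: v) = 0.
Proof.
move=> t0.
have ab : lip_deriv (fun _ => True) (fun _ => v) (fun _ => 0) (rnorm v).
  split; first exact: rn_ge0.
  - by move=> z _; rewrite rn0 rn_ge0.
  - by move=> z w _ _; rewrite subrr scaler0 subrr rn0 mulr_ge0 ?rn_ge0 ?exprn_ge0 ?cn_ge0.
  - by move=> z w _ _; rewrite subrr rn0 mulr_ge0 ?rn_ge0 ?cn_ge0.
have h := @contour_int_exp_deriv0 _ _ _ _ t ab t0 b (fun _ _ => I).
have cst : contour_cont b r eta (fun _ => v) by move=> z _ e e0; exists 1 => // w _ _; rewrite subrr rn0.
have [c1 e1] := contour_adm_exp r0 eta0 t0 cst (fun z _ => lexx (rnorm v)).
have ca : contour_adm b r eta (fun z => cexp (- z * t%:C) *: v).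
  split=> //; do 2!eexists; split; last exact: e1; first by rewrite mulr_ge0 ?expR_ge0.
  exact: mulr_gt0.
have zero_adm : contour_adm b r eta (fun _ => 0 : X).
  split; first by move=> z _ e e0; exists 1 => // w _ _; rewrite subrr rn0.
  by exists 0, 1; split => // z _; rewrite rn0 mul0r.
have zeroE : contour_int b r eta (fun _ => 0 : X) = 0.
  by have := contour_int_lin r0 eta0 (-1) zero_adm zero_adm; rewrite scaler0 addr0 scaleN1r addNr.
have := contour_int_lin r0 eta0 (- t%:C) ca zero_adm; rewrite zeroE addr0.
have -> : (fun z => - t%:C *: (cexp (- z * t%:C) *: v) + 0) =
   (fun z => cexp (- z * t%:C) *: (0 - t%:C *: v)).
  by apply/funext => z; rewrite addr0 sub0r scaleNr scalerN !(scalerA _ _ v) mulrC.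
rewrite h => /esym/eqP; rewrite scaler_eq0 oppr_eq0 => /orP[/eqP|/eqP//].
by move=> /complexI t00; rewrite t00 ltxx in t0.
Qed.

(** The quadratic remainder of the exponential carries a factor |z|^2, which a part
    of the exponential decay absorbs. *)
Lemma contour_int_deriv_at b p (P P2 t : R) : 0 < t -> contour_cont b r eta p ->
  (forall z, on_contour b r eta z -> rnorm (p z) <= P) ->
  contour_cont b r eta (fun z => - z *: p z) ->
  (forall z, on_contour b r eta z -> rnorm (- z *: p z) <= P2) ->
  deriv_at (fun s => contour_int b r eta (fun z => cexp (- z * s%:C) *: p z)) t
    (contour_int b r eta (fun z => cexp (- z * t%:C) *: (- z *: p z))).
Proof.
move=> t0 cp bp cp2 bp2 e e0.
(* of the decay rate 16 del, the remainder uses 3 del and del is left over *)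
pose del := t * cos eta / 16.
have tc0 : 0 < t * cos eta by exact: mulr_gt0.
have del0 : 0 < del by rewrite divr_gt0.
pose B := `|b| + 1 / del; have B0 : 0 < B by rewrite ltr_wpDl// divr_gt0.
pose Q := `|P| * expR (- b * t + 2 * r * t) * (4 * B ^+ 2 * expR `|b|).
have Q0 : 0 <= Q by rewrite !mulr_ge0 ?expR_ge0 ?(ltW B0).
pose W := Q * (2 / del + 2 * pi * r) + 1.
have W0 : 0 < W.
  by rewrite ltr_wpDl// mulr_ge0// addr_ge0 ?divr_ge0 ?mulr_ge0 ?pi_ge0// ltW.
exists (Num.min (Num.min 1 del) (Num.min (t / 2) (e / W))).
  by rewrite !lt_min ltr01 del0 !divr_gt0.
move=> h; rewrite !lt_min => /andP[/andP[h1 h2] /andP[h3 h4]].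
have th0 : 0 < t + h by move: h3; rewrite ltr_norml => /andP[? _]; lra.
have adm s p' P' : 0 < s -> contour_cont b r eta p' -> (forall z, on_contour b r eta z -> rnorm (p' z) <= P') ->
    contour_adm b r eta (fun z => cexp (- z * s%:C) *: p' z).
  move=> s0 cp' bp'; have [c1 c2] := contour_adm_exp r0 eta0 s0 cp' bp'.
  by split=> //; do 2!eexists; split; last exact: c2; [rewrite mulr_ge0 ?expR_ge0|exact: mulr_gt0].
have a1 := adm _ _ _ th0 cp bp; have a2 := adm _ _ _ t0 cp bp; have a3 := adm _ _ _ t0 cp2 bp2.
pose g z := (- h%:C) *: (cexp (- z * t%:C) *: (- z *: p z)) + ((-1) *: (cexp (- z * t%:C) *: p z) + cexp (- z * (t + h)%:C) *: p z).
have a12 : contour_adm b r eta (fun z => (-1) *: (cexp (- z * t%:C) *: p z) + cexp (- z * (t + h)%:C) *: p z) by apply: contour_adm_lin.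
have ag : contour_adm b r eta g by apply: contour_adm_lin.
have -> : contour_int b r eta (fun z => cexp (- z * (t + h)%:C) *: p z) - contour_int b r eta (fun z => cexp (- z * t%:C) *: p z)
    - h%:C *: contour_int b r eta (fun z => cexp (- z * t%:C) *: (- z *: p z)) = contour_int b r eta g.
  rewrite /g (contour_int_lin r0 eta0 (- h%:C) a3 a12) (contour_int_lin r0 eta0 (-1) a2 a1).
  by rewrite scaleN1r scaleNr [RHS]addrC; congr (_ + _); rewrite addrC.
have eg : contour_exp b r eta g (`|h| ^+ 2 * Q) del.
  move=> z hz.
  pose s := cn (z - b%:C); have s0 : 0 <= s := cn_ge0 _.
  have zb : cn z <= `|b| + s.
    by rewrite -(subrK b%:C z) addrC; apply: le_trans (cnD _ _) _; rewrite cnR.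
  have -> : g z = cexp (- z * t%:C) *: ((cexp (- z * h%:C) - 1 - (- z * h%:C)) *: p z).
    rewrite /g rmorphD mulrDr cexpD scaleN1r !scalerA addrA -scaleNr -!scalerDl; congr (_ *: _).
    by ring.
  rewrite !rnZ.
  have c1 := cexp_on_contour r0 eta0 (ltW t0) hz; rewrite -/s in c1.
  have c2 := cexpB1B (- z * h%:C); rewrite cnM cnN cnR in c2.
  have zB : cn z <= B * expR (del * s).
    apply: le_trans zb _; rewrite mulrDl; apply: lerD.
      by rewrite ler_peMr// -expR0 ler_expR mulr_ge0// ltW.
    rewrite mul1r mulrC ler_pdivlMr// mulrC; apply: le_trans (expR_ge1Dx _).
    by rewrite lerDr.
  have zh : cn z * `|h| <= `|b| + del * s.
    apply: le_trans (ler_wpM2r (normr_ge0 h) zb) _; rewrite mulrDl; apply: lerD.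
      by rewrite ler_piMr// ltW.
    by rewrite mulrC ler_wpM2r// ltW.
  have c3 : cn (cexp (- z * h%:C) - 1 - - z * h%:C) <=
      `|h| ^+ 2 * (4 * B ^+ 2 * expR `|b|) * expR (3 * (del * s)).
    apply: le_trans c2 _.
    have -> : `|h| ^+ 2 * (4 * B ^+ 2 * expR `|b|) * expR (3 * (del * s)) =
      4 * ((B * expR (del * s)) * `|h|) ^+ 2 * (expR `|b| * expR (del * s)).
      have -> : 3 * (del * s) = del * s + del * s + del * s by ring.
      rewrite !expRD; ring.
    have n0 := cn_ge0 z.
    apply: ler_pM; rewrite ?expR_ge0 ?mulr_ge0 ?sqr_ge0//.
      apply: ler_wpM2l => //; rewrite ler_sqr ?nnegrE ?mulr_ge0 ?expR_ge0//; last exact: ltW.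
      by rewrite ler_wpM2r.
    by rewrite -expRD ler_expR.
  apply: (@le_trans _ _ ((expR (- b * t + 2 * r * t) * expR (- (t * cos eta * s))) *
     ((`|h| ^+ 2 * (4 * B ^+ 2 * expR `|b|) * expR (3 * (del * s))) * `|P|))).
    apply: ler_pM; rewrite ?cn_ge0 ?mulr_ge0 ?cn_ge0 ?rn_ge0//.
    by apply: ler_pM; rewrite ?cn_ge0 ?rn_ge0//; apply: le_trans (bp z hz) (ler_norm _).
  have -> : expR (- b * t + 2 * r * t) * expR (- (t * cos eta * s)) *
     (`|h| ^+ 2 * (4 * B ^+ 2 * expR `|b|) * expR (3 * (del * s)) * `|P|) =
     `|h| ^+ 2 * Q * (expR (- (t * cos eta * s)) * expR (3 * (del * s))) by rewrite /Q; ring.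
  apply: ler_wpM2l; first by rewrite mulr_ge0 ?sqr_ge0.
  rewrite -expRD ler_expR -/s.
  have -> : t * cos eta = 16 * del by rewrite /del [RHS]mulrC divfK.
  have : 0 <= del * s by rewrite mulr_ge0// ltW.
  lra.
apply: le_trans (contour_int_norm r0 eta0 ag.1 _ del0 eg) _.
  by rewrite mulr_ge0 ?sqr_ge0.
have -> : `|h| ^+ 2 * Q * (2 / del + 2 * pi * r) = (W - 1) * `|h| * `|h| by rewrite /W; ring.
apply: (@le_trans _ _ (W * `|h| * `|h|)); first by rewrite !ler_wpM2r// gerBl.
by rewrite ler_wpM2r// mulrC -ler_pdivlMr// ltW.
Qed.

End Contour.
End Families.

(** * The semigroup of a sectorial resolvent *)

Section PseudoResolvent.
Context {R : realType}.
Notation C := R[i].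
Notation cn := Normc.normc.
Context {X : completeNormedModType R[i]}.

(** Linear maps with the resolvent identity and the decay of the resolvent of a
    sectorial operator. No operator is mentioned: the perturbed resolvent is known
    to be such a family before its operator is constructed. *)
Definition sectorial_res (a th M : R) (Rv : C -> X -> X) : Prop :=
  [/\ 0 <= M,
    forall z, outside a th z -> forall c x y, Rv z (c *: x + y) = c *: Rv z x + Rv z y,
    forall z, outside a th z -> forall x, cn (z - a%:C) * rnorm (Rv z x) <= M * rnorm x &
    forall z w, outside a th z -> outside a th w -> forall x, Rv z x - Rv w x = (z - w) *: Rv z (Rv w x)].

Lemma cos_th (th : R) : 0 < th < pi / 2 -> 0 < cos th < 1.
Proof.
move=> /andP[t0 tp]; have := pi_gt0 R => p0; apply/andP; split.
  by apply: cos_gt0_pihalf; rewrite tp andbT; lra.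
by rewrite -cos0; apply: cos_lt => //; lra.
Qed.

Lemma sectorial_res_le a b th M Rv : 0 < th < pi / 2 -> b <= a -> sectorial_res a th M Rv ->
  sectorial_res b th (M / (1 - cos th)) Rv.
Proof.
move=> th0 ba [M0 lin bd id]; have /andP[c0 c1] := cos_th th0.
have k0 : 0 < 1 - cos th by rewrite subr_gt0.
have oo z : outside b th z -> outside a th z by move=> hz; case: (outside_dist ba th0 hz).
split.
- by rewrite divr_ge0// ltW.
- by move=> z /oo; apply: lin.
- move=> z hz x; have [ha h1 _] := outside_dist ba th0 hz.
  rewrite mulrAC ler_pdivlMr// mulrC mulrA; apply: le_trans (bd z ha x).
  by rewrite ler_wpM2r// rn_ge0.
- by move=> z w /oo hz /oo hw; apply: id.
Qed.

Section Facts.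
Context (a th M : R) (Rv : C -> X -> X) (b r eta : R).
Hypotheses (th0 : 0 < th < pi / 2) (sr : sectorial_res a th M Rv) (ba : b <= a)
  (r0 : 0 < r) (eta0 : th < eta < pi / 2).

Let eta1 : 0 < eta < pi / 2.
Proof. by move: th0 eta0 => /andP[? _] /andP[? ->]; rewrite andbT; lra. Qed.

Lemma on_contour_out c z : c <= a -> on_contour c r eta z ->
  [/\ outside a th z, outside c th z & (1 - cos th) * r <= cn (z - a%:C)].
Proof.
move=> ca hz; have [h1 h2 _] := on_contour_geom r0 eta1 hz.
have oc : outside c th z.
  apply: le_lt_trans h2 _; rewrite ltr_pM2l; last exact: lt_le_trans h1.
  move: th0 eta0 => /andP[? _] /andP[? ?]; have := pi_gt0 R => p0.
  by apply: cos_lt; lra.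
have [oa h3 _] := outside_dist ca th0 oc; split => //; apply: le_trans h3.
by have /andP[c0 c1] := cos_th th0; rewrite ler_wpM2l// subr_ge0 ltW.
Qed.

Let k0 : 0 < (1 - cos th) * r.
Proof. by have /andP[? ?] := cos_th th0; rewrite mulr_gt0// subr_gt0. Qed.

Let m := M / ((1 - cos th) * r).

Let m0 : 0 <= m.
Proof. by case: sr => M0 _ _ _; rewrite divr_ge0// ltW. Qed.

Definition far (z : C) := outside a th z /\ (1 - cos th) * r <= cn (z - a%:C).

Lemma far_bound z x : far z -> rnorm (Rv z x) <= m * rnorm x.
Proof.
move=> [hz h1]; case: sr => M0 _ bd _.
rewrite /m mulrAC ler_pdivlMr// mulrC; apply: le_trans (bd z hz x).
by rewrite ler_wpM2r// rn_ge0.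
Qed.

Lemma on_contour_far c : c <= a -> forall z, on_contour c r eta z -> far z.
Proof. by move=> ca z /(on_contour_out ca) [h1 _ h2]. Qed.

Lemma sectorial_res_lip_deriv u : lip_deriv far (fun z => Rv z u) (fun z => Rv z (Rv z u))
  (2 * (1 + m) ^+ 3 * rnorm u).
Proof.
have u0 := rn_ge0 u; case: (sr) => M0 lin bd id.
have b1 z : far z -> rnorm (Rv z u) <= m * rnorm u by move=> hz; apply: far_bound.
have b2 z w : far z -> far w -> rnorm (Rv z (Rv w u)) <= m ^+ 2 * rnorm u.
  move=> hz hw; apply: le_trans (far_bound _ hz) _; rewrite expr2 -mulrA.
  by rewrite ler_wpM2l// b1.
have b3 z w v : far z -> far w -> far v -> rnorm (Rv z (Rv w (Rv v u))) <= m ^+ 3 * rnorm u.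
  move=> hz hw hv; apply: le_trans (far_bound _ hz) _; rewrite exprS -mulrA.
  by rewrite ler_wpM2l// b2.
have sub z x y : far z -> Rv z (x - y) = Rv z x - Rv z y.
  by move=> [hz _]; have := lin z hz (-1) y x; rewrite !scaleN1r addrC => ->; rewrite addrC.
have m3 : m ^+ 3 * rnorm u <= (1 + m) ^+ 3 * rnorm u.
  by rewrite ler_wpM2r// lerXn2r ?nnegrE ?addr_ge0// lerDr.
have m31 : 0 <= m ^+ 3 * rnorm u by rewrite mulr_ge0 ?exprn_ge0.
have e : 2 * (1 + m) ^+ 3 * rnorm u = (1 + m) ^+ 3 * rnorm u + (1 + m) ^+ 3 * rnorm u by ring.
split.
- by rewrite e addr_ge0// (le_trans m31).
- move=> z hz; split.
    apply: le_trans (b1 z hz) _; rewrite ler_wpM2r//.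
    have : 0 <= m ^+ 2 by exact: sqr_ge0.
    have : 0 <= m ^+ 3 by exact: exprn_ge0.
    have -> : 2 * (1 + m) ^+ 3 = 2 + 6 * m + 6 * m ^+ 2 + 2 * m ^+ 3 by ring.
    by move: m0; lra.
  apply: le_trans (b2 z z hz hz) _; rewrite ler_wpM2r//.
  have : 0 <= m ^+ 2 by exact: sqr_ge0.
  have : 0 <= m ^+ 3 by exact: exprn_ge0.
  have -> : 2 * (1 + m) ^+ 3 = 2 + 6 * m + 6 * m ^+ 2 + 2 * m ^+ 3 by ring.
  by move: m0; lra.
- move=> z w hz hw.
  rewrite (id w z hw.1 hz.1) -scalerBr (id w z hw.1 hz.1) scalerA rnZ cnM -expr2 mulrC.
  rewrite ler_wpM2r ?exprn_ge0 ?cn_ge0//; apply: le_trans (b3 w z z hw hz hz) _.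
  by rewrite e; lra.
- move=> z w hz hw.
  have -> : Rv w (Rv w u) - Rv z (Rv z u) = (Rv w (Rv w u - Rv z u)) + (Rv w (Rv z u) - Rv z (Rv z u)).
    by rewrite sub// addrA subrK.
  apply: le_trans (rnD _ _) _; rewrite (id w z hw.1 hz.1 u) (id w z hw.1 hz.1 (Rv z u)).
  have -> : Rv w ((w - z) *: Rv w (Rv z u)) = (w - z) *: Rv w (Rv w (Rv z u)).
    by have := lin w hw.1 (w - z) (Rv w (Rv z u)) 0; rewrite !addr0 => ->; rewrite -(subrr u) !sub// !subrr addr0.
  rewrite !rnZ -mulrDr mulrC ler_wpM2r ?cn_ge0// e.
  by apply: lerD; apply: le_trans (b3 _ _ _ _ _ _) m3.
Qed.

Lemma contour_cont_idmul c (p : C -> X) : contour_cont c r eta p -> contour_cont c r eta (fun z => - z *: p z).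
Proof.
move=> cp z hz e e0.
have [d d0 hd] := cp z hz 1 ltr01.
pose N := rnorm (p z) + 1; have N0 : 0 < N by rewrite ltr_wpDl// rn_ge0.
pose Z := cn z + 1; have Z0 : 0 < Z by rewrite ltr_wpDl// cn_ge0.
have [d2 d20 hd2] := cp z hz (e / 2 / Z) (divr_gt0 (divr_gt0 e0 (ltr0Sn _ _)) Z0).
exists (Num.min (Num.min d d2) (e / 2 / N)); first by rewrite !lt_min d0 d20 !divr_gt0.
move=> w hw; rewrite !lt_min => /andP[/andP[/(hd w hw) h1 /(hd2 w hw) h2] h3].
have -> : - w *: p w - - z *: p z = - (w - z) *: p w - z *: (p w - p z).
  by rewrite !scaleNr scalerBr scalerBl !opprB opprK [RHS]addrC addrA subrK addrC.
rewrite (splitr e); apply: le_lt_trans (rnB _ _) _; rewrite !rnZ cnN; apply: ltr_leD.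
  apply: (@le_lt_trans _ _ (cn (w - z) * N)); last by rewrite -ltr_pdivlMr.
  apply: ler_wpM2l; first exact: cn_ge0.
  by apply: le_trans (rnDB _ (p z)) _; rewrite /N addrC lerD2l ltW.
apply: (@le_trans _ _ (Z * (e / 2 / Z))); last by rewrite mulrCA divff ?mulr1// gt_eqF.
by apply: ler_pM; rewrite ?cn_ge0 ?rn_ge0// ?lerDl// ltW.
Qed.

Definition contour_factor : C := ((2 * pi)%:C * 'i%C)^-1.

(** The Dunford integral that defines e^(-L t) when Rv is the resolvent of L. *)
Definition contour_sg (t : R) u : X := contour_factor *: contour_int b r eta (fun z => cexp (- z * t%:C) *: Rv z u).

(** This is (L - mu) e^(-L t) u, without reference to L. *)
Definition contour_sgL (mu : C) (t : R) u : X :=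
  contour_factor *: contour_int b r eta (fun z => cexp (- z * t%:C) *: ((z - mu) *: Rv z u)).

Let cR u : contour_cont b r eta (fun z => Rv z u).
Proof. by case: (lip_deriv_contour_cont (sectorial_res_lip_deriv u) (on_contour_far ba)). Qed.

Let bR u z : on_contour b r eta z -> rnorm (Rv z u) <= m * rnorm u.
Proof. by move=> hz; apply: far_bound; apply: on_contour_far hz. Qed.

Let czR u : contour_cont b r eta (fun z => - z *: Rv z u).
Proof. exact: contour_cont_idmul. Qed.

Let bzR u z : on_contour b r eta z -> rnorm (- z *: Rv z u) <= (M + `|a| * m) * rnorm u.
Proof.
move=> hz; rewrite rnZ cnN; have [hz1 hz2] := on_contour_far ba hz; case: (sr) => M0 _ bd _.
have zb : cn z <= cn (z - a%:C) + `|a|.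
  by rewrite -{1}(subrK a%:C z); apply: le_trans (cnD _ _) _; rewrite cnR.
apply: le_trans (ler_wpM2r (rn_ge0 _) zb) _; rewrite !mulrDl; apply: lerD; first exact: bd.
by rewrite -mulrA; apply: ler_wpM2l => //; apply: bR.
Qed.

Let adm (t : R) p P : 0 < t -> contour_cont b r eta p -> (forall z, on_contour b r eta z -> rnorm (p z) <= P) ->
  contour_adm b r eta (fun z => cexp (- z * t%:C) *: (p z : X)).
Proof.
move=> t0 cp bp; have [h1 h2] := contour_adm_exp r0 eta1 t0 cp bp; split=> //.
do 2!eexists; split; last exact: h2; first by rewrite mulr_ge0 ?expR_ge0.
by apply: mulr_gt0 => //; have /andP[] := cos_th eta1.
Qed.

Let adm_cst (t : R) u : 0 < t -> contour_adm b r eta (fun z => cexp (- z * t%:C) *: (u : X)).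
Proof.
move=> t0; apply: (@adm _ _ (rnorm u)) => //.
by move=> z _ e e0; exists 1 => // w _ _; rewrite subrr rn0.
Qed.

Lemma contour_sg_adm (t : R) u : 0 < t -> contour_adm b r eta (fun z => cexp (- z * t%:C) *: Rv z u).
Proof. by move=> t0; apply: adm t0 (cR u) (@bR u). Qed.

Let Qz_adm (t : R) u : 0 < t -> contour_adm b r eta (fun z => cexp (- z * t%:C) *: (- z *: Rv z u)).
Proof. by move=> t0; apply: adm t0 (@czR u) (@bzR u). Qed.

Let zero_adm : contour_adm b r eta (fun _ => 0 : X).
Proof.
split; first by move=> z _ e e0; exists 1 => // w _ _; rewrite subrr rn0.
by exists 0, 1; split => // z _; rewrite rn0 mul0r.
Qed.

Let CI0 : contour_int b r eta (fun _ => 0 : X) = 0.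
Proof.
by have := contour_int_lin r0 eta1 (-1) zero_adm zero_adm; rewrite scaler0 addr0 scaleN1r addNr.
Qed.

Let contour_sgL_fun mu t u : (fun z => cexp (- z * t%:C) *: ((z - mu) *: Rv z u)) =
   (fun z => -1 *: (cexp (- z * t%:C) *: (- z *: Rv z u)) + (- mu *: (cexp (- z * t%:C) *: Rv z u) + 0)).
Proof.
have gid (d z w : C) (x : X) : d *: ((z - w) *: x) = -1 *: (d *: (- z *: x)) + (- w *: (d *: x)).
  rewrite scaleN1r !scaleNr scalerN opprK scalerBl scalerBr; congr (_ - _).
  by rewrite !scalerA mulrC.
by apply/funext => z; rewrite addr0 gid.
Qed.

Lemma contour_sgL_adm mu (t : R) u : 0 < t -> contour_adm b r eta (fun z => cexp (- z * t%:C) *: ((z - mu) *: Rv z u)).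
Proof.
move=> t0; rewrite contour_sgL_fun; apply: (contour_adm_lin); first exact: Qz_adm.
by apply: contour_adm_lin zero_adm; exact: contour_sg_adm.
Qed.

Let contour_sgL_E mu t u : 0 < t ->
  contour_sgL mu t u = - (contour_factor *: contour_int b r eta (fun z => cexp (- z * t%:C) *: (- z *: Rv z u))) - mu *: contour_sg t u.
Proof.
move=> t0; rewrite /contour_sgL /contour_sg contour_sgL_fun.
have h2 : contour_adm b r eta (fun z => - mu *: (cexp (- z * t%:C) *: Rv z u) + 0).
  by apply: contour_adm_lin zero_adm; exact: contour_sg_adm.
rewrite (contour_int_lin r0 eta1 (-1) (Qz_adm u t0) h2) (contour_int_lin r0 eta1 (- mu) (contour_sg_adm u t0) zero_adm) CI0 addr0.
rewrite scaleN1r scalerDr scalerN; congr (_ + _).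
by rewrite scaleNr scalerN !scalerA mulrC.
Qed.

Lemma contour_sg_deriv_at mu (t : R) u : 0 < t -> deriv_at (fun s => contour_sg s u) t (- contour_sgL mu t u - mu *: contour_sg t u).
Proof.
move=> t0; rewrite (contour_sgL_E mu u t0) opprD !opprK addrK.
have := deriv_at_lin contour_factor (contour_int_deriv_at r0 eta1 t0 (cR u) (@bR u) (@czR u) (@bzR u)) (deriv_at_cst 0 t).
rewrite addr0; congr (deriv_at _ _ _); first by apply/funext => s; rewrite addr0.
Qed.

Lemma sectorial_res_comm z w x : outside a th z -> outside a th w -> Rv z (Rv w x) = Rv w (Rv z x).
Proof.
move=> hz hw; case: sr => _ _ _ id.
have [->//|zw] := eqVneq z w.
have zw0 : z - w != 0 by rewrite subr_eq0.
have h1 := id z w hz hw x; have h2 := id w z hw hz x.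
apply: (scalerI zw0); rewrite -h1 -opprB h2 -scaleNr opprB //.
Qed.

Lemma sectorial_res_bounded_lin z : outside a th z -> bounded_lin (Rv z) (M / cn (z - a%:C)).
Proof.
move=> hz; case: sr => M0 lin bd _; split; first exact: lin.
by move=> x; rewrite mulrAC ler_pdivlMr ?(outside_neq hz)// mulrC; apply: bd.
Qed.

Lemma res_contour_sg mu (t : R) u : 0 < t -> outside a th mu -> Rv mu (contour_sg t u) = contour_sg t (Rv mu u).
Proof.
move=> t0 hmu; have bl := sectorial_res_bounded_lin hmu.
rewrite /contour_sg (bounded_linZ bl) -(contour_int_bounded_lin r0 eta1 bl (contour_sg_adm u t0)); congr (_ *: _).
by apply: contour_int_ext => z hz; rewrite (bounded_linZ bl) sectorial_res_comm//; case: (on_contour_far ba hz).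
Qed.

(** By the resolvent identity the integrand becomes that of e^(-L t) u up to a
    term in which only the exponential depends on z, and which integrates to zero. *)
Lemma res_contour_sgL mu (t : R) u : 0 < t -> outside a th mu -> Rv mu (contour_sgL mu t u) = contour_sg t u.
Proof.
move=> t0 hmu; have bl := sectorial_res_bounded_lin hmu; case: (sr) => _ _ _ id.
rewrite /contour_sgL (bounded_linZ bl) -(contour_int_bounded_lin r0 eta1 bl (contour_sgL_adm mu u t0)) /contour_sg; congr (_ *: _).
have -> : contour_int b r eta (fun z => Rv mu (cexp (- z * t%:C) *: ((z - mu) *: Rv z u))) =
    contour_int b r eta (fun z => (-1) *: (cexp (- z * t%:C) *: Rv mu u) + cexp (- z * t%:C) *: Rv z u).
  apply: contour_int_ext => z hz; have [hz1 _] := on_contour_far ba hz.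
  rewrite (bounded_linZ bl) (bounded_linZ bl) (sectorial_res_comm u hmu hz1) -(id z mu hz1 hmu u).
  by rewrite scaleN1r scalerBr addrC.
rewrite (contour_int_lin r0 eta1 (-1) (adm_cst (Rv mu u) t0) (contour_sg_adm u t0)).
by rewrite (contour_int_exp_cst r0 eta1 b (Rv mu u) t0) scaler0 add0r.
Qed.

Lemma contour_sgL_res mu (t : R) h : 0 < t -> outside a th mu -> contour_sgL mu t (Rv mu h) = contour_sg t h.
Proof.
move=> t0 hmu; rewrite -(res_contour_sgL h t0 hmu) /contour_sgL.
have bl := sectorial_res_bounded_lin hmu; rewrite (bounded_linZ bl) -(contour_int_bounded_lin r0 eta1 bl (contour_sgL_adm mu h t0)); congr (_ *: _).
apply: contour_int_ext => z hz; have [hz1 _] := on_contour_far ba hz.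
by rewrite !(bounded_linZ bl) (sectorial_res_comm h hz1 hmu).
Qed.

End Facts.

(** The vertex of the contour may be moved to the left. *)
Lemma contour_sg_vertex a th M Rv b b' r eta (t : R) u : 0 < th < pi / 2 -> sectorial_res a th M Rv ->
  b <= b' -> b' <= a -> 0 < r -> th < eta < pi / 2 -> 0 < t ->
  contour_sg Rv b r eta t u = contour_sg Rv b' r eta t u.
Proof.
move=> th0 sr bb ba r0 eta0 t0; rewrite /contour_sg; congr (_ *: _).
have eta1 : 0 < eta < pi / 2 by move: th0 eta0 => /andP[? _] /andP[? ->]; rewrite andbT; lra.
apply: (contour_int_translate r0 eta1 (sectorial_res_lip_deriv th0 sr r0 u) t0 bb).
move=> c /andP[_ cb] z hz; apply: (on_contour_far th0 r0 eta0) hz.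
exact: le_trans cb ba.
Qed.

End PseudoResolvent.

(** * Laplace transform of the perturbation kernel *)

Lemma half_pow_small {R : realType} (K e : R) : 0 < e -> exists N : nat, (1 / 2) ^+ N * K < e.
Proof.
move=> e0; have : (fun n => (1 / 2) ^+ n * K) @ \oo --> 0 * K.
  by apply: cvgMl; apply: cvg_expr; rewrite ger0_norm ?ltr_pdivrMr; lra.
rewrite mul0r => /cvgrPdist_lt /(_ e e0) [N _ hN]; exists N.
have := hN N (leqnn N); rewrite /= sub0r normrN; apply: le_lt_trans; exact: ler_norm.
Qed.

Section Neumann.
Context {R : realType} {X : completeNormedModType R[i]}.
Notation C := R[i].

(** The inverse of 1 - A, for A of norm at most 1/2. *)
Definition neumann_inv (A : X -> X) (y : X) : X := xget 0 [set x | x - A x = y].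

Section Half.
Context (A : X -> X).
Hypothesis bA : bounded_lin A (1 / 2).

Lemma half_bound x y : x - A x = y -> rnorm x <= 2 * rnorm y.
Proof.
move=> <-; have := rnDB x (A x); have := bA.2 x; have := rn_ge0 x; lra.
Qed.

Lemma half_inj x y : x - A x = y - A y -> x = y.
Proof.
move=> h; apply/eqP; rewrite -subr_eq0; apply/eqP/rn_le0.
have := @half_bound (x - y) 0; rewrite rn0 mulr0; apply.
rewrite (bounded_linB bA); have -> : x - y - (A x - A y) = (x - A x) - (y - A y).
  by rewrite !opprB addrACA [RHS]addrACA [- A x + _]addrC.
by rewrite h subrr.
Qed.

Lemma neumann_invP y : neumann_inv A y - A (neumann_inv A y) = y.
Proof.
suff ex : exists x, x - A x = y by exact: (xgetPex 0 (P := [set x | x - A x = y]) ex).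
pose u n := iter n (fun x => y + A x) 0.
have ub n : rnorm (u n) <= 2 * rnorm y.
  elim: n => [|n IH] /=; first by rewrite rn0 mulr_ge0// rn_ge0.
  apply: le_trans (rnD _ _) _; have := bA.2 (u n); lra.
have ud n k : rnorm (u (n + k)%N - u n) <= (1 / 2) ^+ n * (2 * rnorm y).
  elim: n => [|n IH]; first by rewrite add0n expr0 mul1r /= subr0.
  rewrite addSn /= opprD addrACA subrr add0r -(bounded_linB bA); apply: le_trans (bA.2 _) _.
  by rewrite exprS -mulrA ler_wpM2l.
have [l ul] : exists l : X, u @ \oo --> l.
  apply: cauchy_cvg_rnorm => e e0.
  pose K := 2 * (2 * rnorm y) + 1.
  have [N hN] := half_pow_small K e0.
  exists N => n m Nn Nm; apply: le_lt_trans hN.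
  have h1 := ud N (n - N)%N; have h2 := ud N (m - N)%N; rewrite subnKC// in h1; rewrite subnKC// in h2.
  apply: le_trans (rn_tri (u N) _ _) _; rewrite (rnBC (u N)).
  apply: le_trans (lerD h1 h2) _; rewrite -mulrDr; apply: ler_wpM2l.
    by apply: exprn_ge0; lra.
  by rewrite /K; lra.
exists l; apply: rn_small => e e0.
have e40 : 0 < e / 4 by rewrite divr_gt0.
have [N hN] := (cvgnP _ _).1 ul _ e40.
have h1 := hN N (leqnn N); have h2 := hN N.+1 (leqnSn N).
have -> : l - A l - y = - (u N.+1 - l) + (A (u N) - A l).
  by rewrite /= opprB opprD !addrA subrK addrAC.
apply: le_trans (rnD _ _) _; rewrite rnN; have := bounded_lin_lip bA (u N) l; lra.
Qed.

Lemma neumann_inv_uniq x y : x - A x = y -> x = neumann_inv A y.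
Proof. by move=> h; apply: half_inj; rewrite neumann_invP. Qed.

Lemma neumann_inv_bounded_lin : bounded_lin (neumann_inv A) 2.
Proof.
split; last by move=> y; apply: half_bound; apply: neumann_invP.
move=> c x y; apply/esym/neumann_inv_uniq; rewrite bA.1.
rewrite opprD addrACA -scalerBr !neumann_invP //.
Qed.

End Half.
End Neumann.

Section Kernel.
Context {R : realType}.
Notation C := R[i].
Notation cn := Normc.normc.
Notation mu := (@lebesgue_measure R).
Context {X : completeNormedModType R[i]}.
Context (S BB : R -> X -> X) (d : R).
Hypothesis d01 : 0 <= d < 1.
Hypothesis Sb : forall T : R, 0 < T -> exists M : R, forall t : R, 0 < t <= T -> bounded_lin (S t) M.
Hypothesis Sadd : forall (s t : R) u, 0 < s -> 0 < t -> S (s + t) u = S s (S t u).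
Hypothesis Bb : forall T : R, 0 < T -> exists2 K : R, 0 <= K & forall t : R, 0 < t <= T -> bounded_lin (BB t) (K * t `^ (- d)).
Hypothesis SB : forall (s t : R) x, 0 < s -> 0 < t -> S s (BB t x) = BB (s + t) x.
Hypothesis Bc : forall x (t : R), 0 < t -> cont_at (fun s => BB s x) t.

Let d10 : 0 < 1 - d. Proof. by rewrite subr_gt0; case/andP: d01. Qed.

Definition laplace_trunc (la s : R) (x : X) : X :=
  bochner (oitv 0 (Some s)) (fun sg => (expR (la * sg))%:C *: BB sg x).

Lemma expR_cc (la t e : R) : 0 < e ->
  exists2 dl : R, 0 < dl & forall s, `|s - t| < dl -> cn ((expR (la * s))%:C - (expR (la * t))%:C) < e.
Proof.
move=> e0.
have c : {for t, continuous (fun s : R => expR (la * s))}.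
  apply: (@continuous_comp _ _ _ (fun s => la * s) expR); last exact: continuous_expR.
  by apply: cvgMr; exact: cvg_id.
move: c => /cvgrPdist_lt /(_ e e0) [dl dl0 h]; exists dl => [//|s hs].
rewrite -rmorphB.
by rewrite cnR distrC; apply: h; rewrite /= distrC.
Qed.

Lemma kern_cont_at (la : R) x t : 0 < t -> cont_at (fun sg => (expR (la * sg))%:C *: BB sg x) t.
Proof. by move=> t0; apply: cont_atZ (Bc x t0) => e; apply: expR_cc. Qed.

Lemma kern_dom (la s K : R) x : 0 <= K -> (forall t, 0 < t <= s -> bounded_lin (BB t) (K * t `^ (- d))) ->
  forall t, oitv 0 (Some s) t -> rnorm ((expR (la * t))%:C *: BB t x) <=
    (expR (`|la| * s) * K * rnorm x) * t `^ (- d).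
Proof.
move=> K0 hK t /oitvP [t0 /= ts].
rewrite rnZR (ger0_norm (expR_ge0 _)).
have -> : expR (`|la| * s) * K * rnorm x * t `^ (- d) = expR (`|la| * s) * (K * t `^ (- d) * rnorm x) by ring.
apply: ler_pM; rewrite ?expR_ge0 ?rn_ge0//.
  rewrite ler_expR; apply: le_trans (ler_norm _) _; rewrite normrM ler_wpM2l//.
  by rewrite gtr0_norm// ltW.
by have [_ h] : bounded_lin (BB t) (K * t `^ (- d)) by apply: hK; rewrite t0 ltW.
Qed.

Lemma laplace_trunc_ci (la s : R) x : 0 < s -> cont_integrable (oitv 0 (Some s)) (fun sg => (expR (la * sg))%:C *: BB sg x).
Proof.
move=> s0; have [K K0 hK] := Bb s0.
apply: (cont_integrable_dom (measurable_oitv _ _) _ (kern_dom la x K0 hK)).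
  by move=> t /oitvP [t0 _]; apply: kern_cont_at.
apply: le_lt_trans (pow_bound _ d01 s0) (ltry _).
by rewrite !mulr_ge0 ?expR_ge0 ?rn_ge0.
Qed.

Lemma mpow (c p : R) (D : set R) : measurable (D : set (measurableTypeR R)) ->
  measurable_fun (D : set (measurableTypeR R)) (fun t : R => c * t `^ p).
Proof. by move=> mD; apply: measurable_funTS; apply: measurable_funM => //; exact: measurable_powR. Qed.

Lemma laplace_trunc_bound (la s K : R) x : 0 < s -> 0 <= K -> (forall t, 0 < t <= s -> bounded_lin (BB t) (K * t `^ (- d))) ->
  rnorm (laplace_trunc la s x) <= (expR (`|la| * s) * K * rnorm x) / (1 - d) * s `^ (1 - d).
Proof.
move=> s0 K0 hK.
apply: (bochner_norm (measurable_oitv _ _) (laplace_trunc_ci la x s0) _ (kern_dom la x K0 hK)).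
  by apply: mpow; exact: measurable_oitv.
by apply: pow_bound => //; rewrite !mulr_ge0 ?expR_ge0 ?rn_ge0.
Qed.

Lemma pow_le_exp (y p : R) : 0 < y -> 0 <= p <= 1 -> y `^ p <= expR y.
Proof.
move=> y0 /andP[p0 p1]; have [y1|y1] := leP y 1.
  apply: (@le_trans _ _ 1); last by rewrite -expR0 ler_expR ltW.
  have e1 : 1 `^ p = 1 :> R by rewrite powR1.
  by rewrite -[leRHS]e1; apply: ge0_ler_powR; rewrite ?nnegrE// ltW.
apply: (@le_trans _ _ y); last by apply: le_trans (expR_ge1Dx _); rewrite lerDr.
by rewrite -[leRHS](powRr1 (ltW y0)); apply: ler_powR => //; exact: ltW.
Qed.

(** The inequality expR (- y) <= y^(-p) trades the exponential for a power of nu, at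
    the price of a stronger but still integrable singularity. *)
Lemma laplace_trunc_decay (nu K : R) x : 0 < nu -> 0 <= K -> (forall t, 0 < t <= 1 -> bounded_lin (BB t) (K * t `^ (- d))) ->
  rnorm (laplace_trunc (- nu) 1 x) <= K / ((1 - d) / 2) * nu `^ (- ((1 - d) / 2)) * rnorm x.
Proof.
move=> nu0 K0 hK; set p := (1 - d) / 2.
have p0 : 0 < p by rewrite divr_gt0.
have /andP[d0 d1] := d01.
have dp : 0 <= d + p < 1 by apply/andP; split; rewrite /p; lra.
have dom t : oitv 0 (Some 1) t -> rnorm ((expR (- nu * t))%:C *: BB t x) <=
    (K * nu `^ (- p) * rnorm x) * t `^ (- (d + p)).
  move=> /oitvP [t0 /= t1]; rewrite rnZR (ger0_norm (expR_ge0 _)).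
  have h1 : expR (- nu * t) <= nu `^ (- p) * t `^ (- p).
    rewrite -(powRM _ (ltW nu0) (ltW t0)) mulNr expRN powRN lef_pV2 ?posrE ?expR_gt0 ?powR_gt0 ?mulr_gt0//.
    by apply: pow_le_exp; [exact: mulr_gt0|apply/andP; split; rewrite /p; lra].
  have [_ /(_ x) h2] : bounded_lin (BB t) (K * t `^ (- d)) by apply: hK; rewrite t0 ltW.
  apply: (@le_trans _ _ ((nu `^ (- p) * t `^ (- p)) * (K * t `^ (- d) * rnorm x))).
    by apply: ler_pM; rewrite ?expR_ge0 ?rn_ge0.
  have e1 : t `^ (- (d + p)) = t `^ (- d) * t `^ (- p).
    by rewrite opprD powRD// (gt_eqF t0) implybT.
  by rewrite e1 le_eqVlt; apply/orP; left; apply/eqP; ring.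
have Kn : 0 <= K * nu `^ (- p) * rnorm x by rewrite !mulr_ge0 ?powR_ge0 ?rn_ge0.
apply: le_trans (bochner_norm (c := K * nu `^ (- p) * rnorm x / (1 - (d + p)) * 1 `^ (1 - (d + p))) (measurable_oitv _ _) (laplace_trunc_ci (- nu) x ltr01) _ dom _) _.
- by apply: mpow; exact: measurable_oitv.
- exact: pow_bound.
- rewrite powR1 mulr1; have -> : 1 - (d + p) = p by rewrite /p; lra.
  by rewrite le_eqVlt; apply/orP; left; apply/eqP; ring.
Qed.

Lemma laplace_trunc_lin (la s : R) c x y : 0 < s -> laplace_trunc la s (c *: x + y) = c *: laplace_trunc la s x + laplace_trunc la s y.
Proof.
move=> s0; rewrite /laplace_trunc -(bochner_lin c (measurable_oitv _ _) (laplace_trunc_ci la y s0) (laplace_trunc_ci la x s0)).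
apply: bochner_ext => t /oitvP [t0 /= ts]; have [K K0 hK] := Bb s0.
have [lin _] : bounded_lin (BB t) (K * t `^ (- d)) by apply: hK; rewrite t0 ltW.
by rewrite lin scalerDr !scalerA mulrC.
Qed.

Lemma laplace_trunc_deriv_at (la s : R) x : 0 < s -> deriv_at (fun y => laplace_trunc la y x) s ((expR (la * s))%:C *: BB s x).
Proof.
move=> s0; have s10 : 0 < s + 1 by rewrite addr_gt0.
by apply: (bochner_deriv_at (laplace_trunc_ci la x s10)); apply/oitvP; split => //=; rewrite ltrDl.
Qed.

(** Since S(s) BB(t) = BB(s + t), the semigroup acts on truncated transforms as a
    shift of the interval of integration. *)
Lemma laplace_trunc_add (la s t : R) x : 0 < s -> 0 < t ->
  laplace_trunc la (s + t) x = laplace_trunc la s x + (expR (la * s))%:C *: S s (laplace_trunc la t x).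
Proof.
move=> s0 t0; have st0 : 0 < s + t by rewrite addr_gt0.
have hs : oitv 0 (Some (s + t)) s by apply/oitvP; split => //=; rewrite ltrDl.
have [_ c2 eI] := bochner_split hs (laplace_trunc_ci la x st0); rewrite {1}/laplace_trunc eI; congr (_ + _).
have [M hM] := Sb s0; have bS : bounded_lin (S s) M by apply: hM; rewrite s0 lexx.
have e1 sg : oitv 0 (Some t) sg ->
    (expR (la * s))%:C *: S s ((expR (la * sg))%:C *: BB sg x) =
    (expR (la * (sg + s)))%:C *: BB (sg + s) x.
  move=> /oitvP [sg0 _]; rewrite (bounded_linZ bS) SB// scalerA -rmorphM -expRD -mulrDr.
  by rewrite [s + sg]addrC.
have c1 : cont_integrable (oitv 0 (Some t)) (fun sg => (expR (la * (sg + s)))%:C *: BB (sg + s) x).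
  split.
    move=> sg /oitvP [sg0 _] e e0.
    have [|dl dl0 h] := kern_cont_at la x (_ : 0 < sg + s) e0; first by rewrite addr_gt0.
    by exists dl => // y hy; apply: h; rewrite opprD addrACA subrr addr0.
  have := (cont_integrableZ (expR (la * s))%:C (measurable_oitv _ _) (cont_integrable_bounded_lin bS (measurable_oitv _ _) (laplace_trunc_ci la x t0))).2.
  apply: le_lt_trans; apply: le_integral_lower => sg hsg; first by rewrite lee_fin rn_ge0.
  by rewrite e1.
rewrite -(bochner_shift t0 c1 c2).
rewrite /laplace_trunc -(bochner_bounded_lin bS (measurable_oitv _ _) (laplace_trunc_ci la x t0)) -bochnerZ; last 2 first.
- exact: measurable_oitv.
- by apply: (cont_integrable_bounded_lin bS (measurable_oitv _ _)); exact: laplace_trunc_ci.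
by apply: bochner_ext => sg hsg; rewrite e1.
Qed.

(** The Laplace transform of the kernel. As S(1) shifts the kernel by one, it is the
    sum of a geometric series of operators expR la S(1) applied to the transform
    truncated at 1; this avoids integrals over a half-line. *)
Definition laplace (la : R) (x : X) : X :=
  neumann_inv (fun v => (expR la)%:C *: S 1 v) (laplace_trunc la 1 x).

Definition laplace_dom (la : R) := bounded_lin (fun v => (expR la)%:C *: S 1 v) (1 / 2).

Lemma laplace_dom_ex : exists l0 : R, forall la, la <= l0 -> laplace_dom la.
Proof.
have [M hM] := Sb ltr01; have bS : bounded_lin (S 1) M by apply: hM; rewrite ltr01 lexx.
pose m := `|M| + 1; have m0 : 0 < m by rewrite ltr_wpDl.
exists (ln (1 / 2 / m)) => la hla.
have el : expR la * m <= 1 / 2.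
  by rewrite -ler_pdivlMr// -[leRHS]lnK ?posrE ?divr_gt0// ler_expR.
split=> [c x y|x].
  by rewrite bS.1 scalerDr !scalerA mulrC.
rewrite rnZR (ger0_norm (expR_ge0 _)); apply: (@le_trans _ _ (expR la * (m * rnorm x))).
  apply: ler_wpM2l; first exact: expR_ge0.
  apply: le_trans (bS.2 x) _; apply: ler_wpM2r; first exact: rn_ge0.
  by apply: le_trans (ler_norm _) _; rewrite lerDl.
by rewrite mulrA ler_wpM2r ?rn_ge0.
Qed.

Lemma laplace_lin la c x y : laplace_dom la -> laplace la (c *: x + y) = c *: laplace la x + laplace la y.
Proof. by move=> kd; rewrite /laplace laplace_trunc_lin// (neumann_inv_bounded_lin kd).1. Qed.

Lemma laplace_norm la x : laplace_dom la -> rnorm (laplace la x) <= 2 * rnorm (laplace_trunc la 1 x).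
Proof. by move=> kd; apply: (neumann_inv_bounded_lin kd).2. Qed.

(** Both sides are compared after applying the injective operator 1 - expR la S(1);
    there laplace_trunc_add, for s + 1 = 1 + s, gives the identity. *)
Lemma laplace_S la s x : laplace_dom la -> 0 < s ->
  (expR (la * s))%:C *: S s (laplace la x) = laplace la x - laplace_trunc la s x.
Proof.
move=> kd s0.
have [Ms hMs] := Sb s0; have bS : bounded_lin (S s) Ms by apply: hMs; rewrite s0 lexx.
have [M1 hM1] := Sb ltr01; have b1 : bounded_lin (S 1) M1 by apply: hM1; rewrite ltr01 lexx.
have kE := neumann_invP kd (laplace_trunc la 1 x); rewrite -/(laplace la x) in kE.
set k := laplace la x in kE *.
have comm v : (expR la)%:C *: S 1 ((expR (la * s))%:C *: S s v) =
    (expR (la * s))%:C *: S s ((expR la)%:C *: S 1 v).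
  by rewrite (bounded_linZ b1) (bounded_linZ bS) -!Sadd// [1 + s]addrC !scalerA mulrC.
apply: (half_inj kd).
have -> : (expR (la * s))%:C *: S s k - (expR la)%:C *: S 1 ((expR (la * s))%:C *: S s k) =
   (expR (la * s))%:C *: S s (laplace_trunc la 1 x).
  by rewrite comm -scalerBr -(bounded_linB bS) kE.
rewrite (bounded_linB b1) scalerBr.
have h1 := laplace_trunc_add la x s0 ltr01; have h2 := laplace_trunc_add la x ltr01 s0.
rewrite mulr1 in h2; rewrite addrC h1 in h2.
have -> : k - laplace_trunc la s x - ((expR la)%:C *: S 1 k - (expR la)%:C *: S 1 (laplace_trunc la s x)) =
   (k - (expR la)%:C *: S 1 k) + (expR la)%:C *: S 1 (laplace_trunc la s x) - laplace_trunc la s x.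
  by rewrite opprB addrA addrAC [k - _ - _]addrAC -addrA [- laplace_trunc la s x + _]addrC addrA.
by rewrite kE -h2 addrC addKr.
Qed.

Lemma semigroup_laplace la s x : laplace_dom la -> 0 < s -> S s (laplace la x) = (expR (- la * s))%:C *: (laplace la x - laplace_trunc la s x).
Proof.
move=> kd s0; rewrite -(laplace_S x kd s0) scalerA -rmorphM -expRD mulNr addNr expR0.
by rewrite scale1r.
Qed.

End Kernel.

(** * Continuation of the Laplace transform to the complement of a sector *)

Section Calculus.
Context {R : realType} {X : completeNormedModType R[i]}.

Lemma deriv_at_near (F G : R -> X) t l (dl : R) : 0 < dl ->
  (forall s, `|s - t| < dl -> F s = G s) -> deriv_at F t l -> deriv_at G t l.
Proof.
move=> dl0 FG dF e e0; have [d d0 hd] := dF e e0.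
exists (Num.min d dl); first by rewrite lt_min d0.
move=> h; rewrite lt_min => /andP[/hd {}hd hl].
by rewrite -!FG ?subrr ?normr0// addrC addKr.
Qed.

Lemma deriv_at_pos (F G : R -> X) t l : 0 < t ->
  (forall s, 0 < s -> F s = G s) -> deriv_at F t l -> deriv_at G t l.
Proof.
move=> t0 FG; apply: (deriv_at_near t0) => s; rewrite ltr_norml => /andP[h _].
by apply: FG; lra.
Qed.

Lemma deriv_at_expZ (F : R -> X) (la t : R) l : deriv_at F t l ->
  deriv_at (fun s => (expR (la * s))%:C *: F s) t ((expR (la * t))%:C *: (l + la%:C *: F t)).
Proof.
move=> dF e e0.
pose E := expR (la * t); have E0 : 0 < E := expR_gt0 _.
pose L := expR `|la|; have L0 : 0 < L := expR_gt0 _.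
have cF := deriv_at_cont_at dF.
pose k := E * L + 1; have k0 : 0 < k by rewrite addr_gt0 ?mulr_gt0.
have [d1 d10 h1] := dF _ (divr_gt0 (divr_gt0 e0 (ltr0Sn _ 2)) k0).
pose m := E * `|la| + 1; have m0 : 0 < m by rewrite ltr_wpDl// mulr_ge0// ltW.
pose N := E * (`|la| ^+ 2 * L) * rnorm (F t) + E * `|la| * L * rnorm l + 1.
have N0 : 0 < N by rewrite ltr_wpDl// addr_ge0// !mulr_ge0 ?rn_ge0// ?ltW.
exists (Num.min (Num.min d1 1) (e / 3 / N)).
  by rewrite !lt_min d10 ltr01 !divr_gt0.
move=> h; rewrite !lt_min => /andP[/andP[hd1 h11] hN].
have hx := h1 h hd1.
have eE : expR (la * (t + h)) = E * expR (la * h) by rewrite mulrDr expRD.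
set D := F (t + h) - F t - h%:C *: l in hx.
have FE : F (t + h) = D + F t + h%:C *: l by rewrite /D addrAC subrK subrK.
have idn : (expR (la * (t + h)))%:C *: F (t + h) - E%:C *: F t - h%:C *: (E%:C *: (l + la%:C *: F t)) =
   (E * expR (la * h))%:C *: D + (E * (expR (la * h) - 1 - la * h))%:C *: F t + (E * (expR (la * h) - 1) * h)%:C *: l.
  rewrite eE FE !scalerDr !scalerA -!rmorphM.
  have -> : (E * (expR (la * h) - 1 - la * h))%:C *: F t = (E * expR (la * h))%:C *: F t - E%:C *: F t - (h * (E * la))%:C *: F t.
    by rewrite -!scalerBl -!rmorphB; congr (_%:C *: _); ring.
  have -> : (E * (expR (la * h) - 1) * h)%:C *: l = (E * expR (la * h) * h)%:C *: l - (h * E)%:C *: l.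
    by rewrite -scalerBl -rmorphB; congr (_%:C *: _); ring.
  have zid (A B G P U W : X) : A + B + G - P - (U + W) = A + (B - P - W) + (G - U).
    by rewrite opprD !addrA [A + B + G - P]addrAC -!addrA; do 3!congr (_ + _); rewrite addrA addrC.
  by rewrite -zid mulrA.
rewrite -/E idn.
have lh : `|la * h| <= `|la| by rewrite normrM ler_piMr// ltW.
have b1 : expR (la * h) <= L by rewrite ler_expR (le_trans (ler_norm _)).
have eL : expR `|la * h| <= L by rewrite ler_expR.
have b2 : `|expR (la * h) - 1| <= `|la| * L * `|h|.
  apply: le_trans (expRB1 _) _; rewrite {1}normrM mulrAC; apply: ler_wpM2r => //; exact: ler_wpM2l.
have b3 : `|expR (la * h) - 1 - la * h| <= (`|la| ^+ 2 * L) * `|h| ^+ 2.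
  apply: le_trans (expRB1B _) _; rewrite {1}normrM exprMn mulrAC.
  by rewrite ler_wpM2r ?exprn_ge0// ler_wpM2l ?exprn_ge0.
apply: le_trans (rnD _ _) _; apply: le_trans (lerD (rnD _ _) (lexx _)) _.
rewrite !rnZR !normrM (gtr0_norm E0) (gtr0_norm (expR_gt0 _)).
have t1 : E * expR (la * h) * rnorm D <= e / 3 * `|h|.
  apply: (@le_trans _ _ (k * (e / 3 / k * `|h|))).
    apply: ler_pM => //; rewrite ?rn_ge0 ?mulr_ge0 ?expR_ge0// ?(ltW E0)//.
    by apply: (@le_trans _ _ (E * L)); [rewrite ler_pM2l|rewrite lerDl].
  by rewrite mulrA [k * _]mulrC divfK// gt_eqF.
have hN' : `|h| * N <= e / 3 by rewrite -ler_pdivlMr// ltW.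
have t2 : E * `|expR (la * h) - 1 - la * h| * rnorm (F t) + E * `|expR (la * h) - 1| * `|h| * rnorm l <= e / 3 * `|h|.
  apply: (@le_trans _ _ ((`|h| * N) * `|h|)); last by rewrite ler_wpM2r.
  apply: (@le_trans _ _ (E * ((`|la| ^+ 2 * L) * `|h| ^+ 2) * rnorm (F t) + E * (`|la| * L * `|h|) * `|h| * rnorm l)).
    apply: lerD; rewrite ler_wpM2r ?rn_ge0//; first by rewrite ler_pM2l.
    by rewrite ler_wpM2r// ler_pM2l.
  have -> : E * ((`|la| ^+ 2 * L) * `|h| ^+ 2) * rnorm (F t) + E * (`|la| * L * `|h|) * `|h| * rnorm l = (`|h| * (N - 1)) * `|h|.
    by rewrite /N; ring.
  by rewrite ler_wpM2r// ler_wpM2l// gerBl.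
rewrite -addrA; apply: le_trans (lerD t1 t2) _.
have : 0 <= e / 3 * `|h| by rewrite mulr_ge0// divr_ge0// ltW.
have -> : e * `|h| = e / 3 * `|h| + e / 3 * `|h| + e / 3 * `|h| by lra.
lra.
Qed.

End Calculus.

Section Perturb.
Context {R : realType}.
Notation C := R[i].
Notation cn := Normc.normc.
Context {X : completeNormedModType R[i]}.
Context (S BB : R -> X -> X) (d : R).
Hypothesis d01 : 0 <= d < 1.
Hypothesis Sb : forall T : R, 0 < T -> exists M : R, forall t : R, 0 < t <= T -> bounded_lin (S t) M.
Hypothesis Sadd : forall (s t : R) u, 0 < s -> 0 < t -> S (s + t) u = S s (S t u).
Hypothesis Bb : forall T : R, 0 < T -> exists2 K : R, 0 <= K & forall t : R, 0 < t <= T -> bounded_lin (BB t) (K * t `^ (- d)).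
Hypothesis SB : forall (s t : R) x, 0 < s -> 0 < t -> S s (BB t x) = BB (s + t) x.
Hypothesis Bc : forall x (t : R), 0 < t -> cont_at (fun s => BB s x) t.
Context (a th M : R) (Rv : C -> X -> X).
Hypothesis th0 : 0 < th < pi / 2.
Hypothesis sr : sectorial_res a th M Rv.
Hypothesis Sgen : forall (r eta t : R) u, 0 < r -> th < eta < pi / 2 -> 0 < t ->
  S t u = contour_sg Rv a r eta t u.

Let d10 : 0 < 1 - d. Proof. by rewrite subr_gt0; case/andP: d01. Qed.

Let mid : th < (th + pi / 2) / 2 < pi / 2.
Proof. by move: th0 => /andP[? ?]; apply/andP; split; lra. Qed.

Notation K := (laplace S BB).
Notation F := (laplace_trunc BB).
Notation Kdom := (laplace_dom S).

Lemma S_bl (t : R) : 0 < t -> exists m, bounded_lin (S t) m.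
Proof. by move=> t0; have [m hm] := Sb t0; exists m; apply: hm; rewrite t0 lexx. Qed.

Lemma S_Rv z t u : outside a th z -> 0 < t -> Rv z (S t u) = S t (Rv z u).
Proof.
by move=> hz t0; rewrite !(Sgen _ ltr01 mid t0) (res_contour_sg th0 sr (lexx a) ltr01 mid).
Qed.

Lemma S_Rv_deriv_at z t h : outside a th z -> 0 < t ->
  deriv_at (fun s => S s (Rv z h)) t (- S t h - z *: S t (Rv z h)).
Proof.
move=> hz t0; have := contour_sg_deriv_at th0 sr (lexx a) ltr01 mid z (Rv z h) t0.
rewrite (contour_sgL_res th0 sr (lexx a) ltr01 mid h t0 hz) -!(Sgen _ ltr01 mid t0).
by apply: deriv_at_pos => // s s0; rewrite (Sgen _ ltr01 mid s0).
Qed.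

Lemma outside_real (la : R) : la < a -> outside a th la%:C.
Proof.
move=> h; have /andP[c0 _] := cos_th th0.
by apply: (@lt_le_trans _ _ 0); [rewrite subr_lt0|apply: mulr_ge0 (cn_ge0 _) (ltW c0)].
Qed.

Lemma laplace_bl la : Kdom la -> exists2 k, 0 <= k & bounded_lin (K la) k.
Proof.
move=> kd; have [k k0 hk] := Bb ltr01.
exists (2 * ((expR (`|la| * 1) * k) / (1 - d) * 1 `^ (1 - d))).
  by rewrite !mulr_ge0 ?invr_ge0 ?expR_ge0 ?powR_ge0 ?(ltW d10).
split; first by move=> c x y; apply: (laplace_lin d01 Bb Bc).
move=> x; apply: le_trans (laplace_norm BB x kd) _; rewrite -mulrA ler_pM2l//.
apply: le_trans (laplace_trunc_bound d01 Bb Bc la x ltr01 k0 hk) _.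
by rewrite le_eqVlt; apply/orP; left; apply/eqP; ring.
Qed.

Lemma semigroup_laplace_deriv_at la t x : Kdom la -> 0 < t ->
  deriv_at (fun s => S s (K la x)) t (- (la%:C *: S t (K la x)) - BB t x).
Proof.
move=> kd t0.
have h1 := deriv_at_lin (-1) (laplace_trunc_deriv_at d01 Bb Bc la x t0) (deriv_at_cst (K la x) t).
have h2 := deriv_at_expZ (- la) h1.
have e1 s : 0 < s -> (expR (- la * s))%:C *: (-1 *: F la s x + K la x) = S s (K la x).
  by move=> s0; rewrite (semigroup_laplace d01 Sb Sadd Bb SB Bc x kd s0) scaleN1r [- _ + _]addrC.
have := deriv_at_pos t0 e1 h2.
have -> : (expR (- la * t))%:C *: (-1 *: ((expR (la * t))%:C *: BB t x) + 0 +
    (- la)%:C *: (-1 *: F la t x + K la x)) = - (la%:C *: S t (K la x)) - BB t x.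
  rewrite -e1// addr0 scalerDr addrC; congr (_ + _).
    by rewrite !scalerA -scaleNr; congr (_ *: _); rewrite rmorphN mulrN mulrC.
  by rewrite scaleN1r scalerN scalerA -rmorphM -expRD mulNr addNr expR0 scale1r.
done.
Qed.

Lemma pow_small (p e : R) : 0 < p -> 0 < e ->
  exists2 dl : R, 0 < dl & forall s : R, 0 < s < dl -> s `^ p < e.
Proof.
move=> p0 e0; exists (e `^ p^-1); first by rewrite powR_gt0.
move=> s /andP[s0 sd]; have -> : e = (e `^ p^-1) `^ p by rewrite -powRrM mulVf ?gt_eqF// powRr1// ltW.
by apply: gt0_ltr_powR; rewrite ?nnegrE// ?powR_ge0// ltW.
Qed.

(** On the range of the Laplace transform S(s) differs from the identity by a scalar
    of order s and by a truncated transform of order s^(1 - d), uniformly. *)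
Lemma semigroup_laplace_lim la : Kdom la -> forall e : R, 0 < e -> exists2 dl : R, 0 < dl &
  forall s : R, 0 < s < dl -> forall x, rnorm (S s (K la x) - K la x) <= e * rnorm x.
Proof.
move=> kd e e0; have [k k0 bk] := laplace_bl kd; have [B B0 hB] := Bb ltr01.
pose L := expR `|la|; have L0 : 0 < L := expR_gt0 _.
pose N := `|la| * L * k + L * (L * B / (1 - d)) + 1.
have N0 : 0 < N by rewrite ltr_wpDl// addr_ge0// !mulr_ge0 ?invr_ge0 ?(ltW d10)// ltW.
have [dl dl0 hdl] := pow_small d10 (divr_gt0 e0 N0).
exists (Num.min dl 1); first by rewrite lt_min dl0 ltr01.
move=> s /andP[s0]; rewrite lt_min => /andP[sd s1] x.
have sd1 : s `^ d <= 1.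
  have e1 : 1 `^ d = 1 :> R by rewrite powR1.
  by rewrite -[leRHS]e1; apply: ge0_ler_powR; rewrite ?nnegrE// ?(ltW s0)// ?(ltW s1)//; case/andP: d01.
have sp : s <= s `^ (1 - d).
  have {1}-> : s = s `^ (1 - d) * s `^ d.
    by rewrite -powRD ?subrK ?powRr1 ?(ltW s0)// (gt_eqF s0) implybT.
  by rewrite ler_piMr// powR_ge0.
have hF : rnorm (F la s x) <= (L * B / (1 - d)) * s `^ (1 - d) * rnorm x.
  apply: le_trans (laplace_trunc_bound d01 Bb Bc la x s0 B0 _) _.
    by move=> t /andP[t0 ts]; apply: hB; rewrite t0 (le_trans ts)// ltW.
  have -> : expR (`|la| * s) * B * rnorm x / (1 - d) * s `^ (1 - d) =
     expR (`|la| * s) * (B * rnorm x / (1 - d) * s `^ (1 - d)) by ring.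
  have -> : L * B / (1 - d) * s `^ (1 - d) * rnorm x = L * (B * rnorm x / (1 - d) * s `^ (1 - d)) by ring.
  apply: ler_wpM2r; first by rewrite !mulr_ge0 ?rn_ge0 ?powR_ge0 ?invr_ge0 ?(ltW d10).
  by rewrite ler_expR ler_piMr// ltW.
have sla : `|- la * s| <= `|la| by rewrite normrM normrN (gtr0_norm s0) ler_piMr// ltW.
rewrite (semigroup_laplace d01 Sb Sadd Bb SB Bc x kd s0).
have -> : (expR (- la * s))%:C *: (K la x - F la s x) - K la x =
   (expR (- la * s) - 1)%:C *: K la x - (expR (- la * s))%:C *: F la s x.
  vec (R[i]) X; ring.
apply: le_trans (rnB _ _) _; rewrite !rnZR (gtr0_norm (expR_gt0 _)).
have b1 : `|expR (- la * s) - 1| <= `|la| * L * s `^ (1 - d).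
  apply: le_trans (expRB1 _) _; rewrite {1}normrM normrN (gtr0_norm s0) [leRHS]mulrAC.
  by apply: ler_pM; rewrite ?mulr_ge0 ?expR_ge0 ?(ltW s0)// ?ler_expR// ler_wpM2l.
have b2 : expR (- la * s) <= L by rewrite ler_expR (le_trans (ler_norm _)).
apply: (@le_trans _ _ ((`|la| * L * s `^ (1 - d)) * (k * rnorm x) + L * ((L * B / (1 - d)) * s `^ (1 - d) * rnorm x))).
  by apply: lerD; apply: ler_pM; rewrite ?rn_ge0 ?expR_ge0//; exact: bk.2.
have -> : (`|la| * L * s `^ (1 - d)) * (k * rnorm x) + L * ((L * B / (1 - d)) * s `^ (1 - d) * rnorm x) =
   (s `^ (1 - d) * (N - 1)) * rnorm x by rewrite /N; ring.
apply: ler_wpM2r; first exact: rn_ge0.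
have := hdl s; rewrite s0 sd => /(_ isT); rewrite ltr_pdivlMr// => /ltW; apply: le_trans.
by apply: ler_wpM2l; rewrite ?powR_ge0// gerBl.
Qed.

(** The resolvent identity for Laplace transforms. The defect v of the identity
    satisfies d/ds S(s) v = - la S(s) v, hence S(s) v = expR la S(1) S(s) v, which is
    only possible if S(s) v = 0; and S(s) v tends to v as s tends to zero. *)
Lemma laplace_res la mu x : Kdom la -> Kdom mu -> la < a ->
  K la x - K mu x = (la - mu)%:C *: Rv la%:C (K mu x).
Proof.
move=> kl km laa; have ol := outside_real laa; have [kk kk0 bl] := laplace_bl kl.
pose h := K mu x; pose w := Rv la%:C h.
pose v := K la x - h - (la - mu)%:C *: w.
have Sv s : 0 < s -> S s v = S s (K la x) - S s h - (la - mu)%:C *: S s w.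
  by move=> /S_bl [m bm]; rewrite /v !(bounded_linB bm) (bounded_linZ bm).
have dv t : 0 < t -> deriv_at (fun s => S s v) t (- la%:C *: S t v).
  move=> t0; have d1 := deriv_at_lin (-1) (semigroup_laplace_deriv_at x km t0) (semigroup_laplace_deriv_at x kl t0).
  have d2 := deriv_at_lin (- (la - mu)%:C) (S_Rv_deriv_at h ol t0) d1.
  have -> : - la%:C *: S t v = - (la - mu)%:C *: (- S t h - la%:C *: S t (Rv la%:C h)) +
    (-1 *: (- (mu%:C *: S t (K mu x)) - BB t x) + (- (la%:C *: S t (K la x)) - BB t x)).
    by rewrite (Sv _ t0) -/h -/w; vec (R[i]) X; ring.
  apply: deriv_at_pos t0 _ d2 => s s0; rewrite (Sv _ s0) -/w -/h; vec (R[i]) X; ring.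
(* hence expR (la * s) S(s) v is constant; compare its values at s and s + 1 *)
have de t : oitv 0 None t -> deriv_at (fun s => (expR (la * s))%:C *: S s v) t 0.
  move=> /oitvP [t0 _]; have := deriv_at_expZ la (dv t t0).
  by rewrite scaleNr addNr scaler0.
have Sv0 s : 0 < s -> S s v = 0.
  move=> s0; have s10 : 0 < s + 1 by rewrite addr_gt0.
  have os : oitv 0 None s by apply/oitvP.
  have os1 : oitv 0 None (s + 1) by apply/oitvP.
  have := deriv_at0_const de os os1; rewrite [s + 1]addrC Sadd// mulrDr mulr1 expRD [expR _ * _]mulrC rmorphM -scalerA.
  have e0 : (expR (la * s))%:C != 0 :> C by rewrite fmorph_eq0 gt_eqF// expR_gt0.
  move=> /(scalerI e0) e1; apply: (half_inj kl).
  rewrite -e1 subrr; have [m bm] := S_bl ltr01.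
  by rewrite (bounded_lin0 bm) scaler0 subrr.
suff v0 : v = 0.
  by move: v0 => /eqP; rewrite /v subr_eq0 => /eqP.
have bw := sectorial_res_bounded_lin sr ol; set m := _ / _ in bw.
pose N := (2 + `|la - mu| * `|m|) * rnorm x + 1.
have N0 : 0 < N by rewrite ltr_wpDl// mulr_ge0 ?rn_ge0// addr_ge0// mulr_ge0.
apply: rn_small => e e0.
have [dl1 dl10 h1] := semigroup_laplace_lim kl (divr_gt0 e0 N0).
have [dl2 dl20 h2] := semigroup_laplace_lim km (divr_gt0 e0 N0).
pose s := Num.min dl1 dl2 / 2.
have s0 : 0 < s by rewrite divr_gt0// lt_min dl10.
have sd : s < Num.min dl1 dl2 by rewrite /s ltr_pdivrMr// ltr_pMr// ?ltr1n// lt_min dl10.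
move: (sd); rewrite lt_min => /andP[sd1 sd2].
have {}h1 := h1 s _ x; rewrite s0 sd1 in h1; have {}h1 := h1 isT.
have {}h2 := h2 s _ x; rewrite s0 sd2 in h2; have {}h2 := h2 isT.
have -> : v - 0 = - (S s (K la x) - K la x) + (S s h - h) + (la - mu)%:C *: Rv la%:C (S s h - h).
  have /eqP := Sv0 s s0; rewrite (Sv _ s0) subr_eq0 => /eqP e1.
  rewrite (bounded_linB bw) (S_Rv h ol s0) -/w /v.
  by rewrite scalerBr -e1; vec (R[i]) X; ring.
apply: le_trans (rnD _ _) _; apply: le_trans (lerD (rnD _ _) (lexx _)) _.
rewrite rnN rnZR.
have h3 : rnorm (Rv la%:C (S s h - h)) <= `|m| * (e / N * rnorm x).
  by apply: le_trans (bw.2 _) (le_trans (ler_wpM2r (rn_ge0 _) (ler_norm m)) (ler_wpM2l (normr_ge0 _) h2)).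
apply: (@le_trans _ _ (e / N * rnorm x + e / N * rnorm x + `|la - mu| * (`|m| * (e / N * rnorm x)))).
  exact: (lerD (lerD h1 h2) (ler_wpM2l (normr_ge0 _) h3)).
have -> : e / N * rnorm x + e / N * rnorm x + `|la - mu| * (`|m| * (e / N * rnorm x)) =
   e * ((N - 1) / N) by rewrite /N; ring.
by rewrite ler_piMr ?(ltW e0)// ler_pdivrMr// mul1r gerBl.
Qed.

Lemma laplace_small (e : R) : 0 < e -> exists l1 : R, forall la, la <= l1 ->
  Kdom la /\ forall x, rnorm (K la x) <= e * rnorm x.
Proof.
move=> e0; have [l0 hl0] := laplace_dom_ex Sb; have [B B0 hB] := Bb ltr01.
pose p := (1 - d) / 2; have p0 : 0 < p by rewrite divr_gt0.
pose N := 2 * (B / p) + 1; have N0 : 0 < N by rewrite ltr_wpDl// !mulr_ge0 ?invr_ge0// ltW.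
have [dl dl0 hdl] := pow_small p0 (divr_gt0 e0 N0).
exists (Num.min l0 (- (dl / 2)^-1)) => la; rewrite le_min => /andP[/hl0 kd ll]; split=> // x.
have nu0 : 0 < - la by rewrite oppr_gt0 (le_lt_trans ll)// oppr_lt0 invr_gt0 divr_gt0.
have h1 : (- la) `^ (- p) <= e / N.
  have i0 : 0 < (- la)^-1 by rewrite invr_gt0.
  have -> : (- la) `^ (- p) = (- la)^-1 `^ p by rewrite -[(- la)^-1]powR_inv1 ?(ltW nu0)// -powRrM mulN1r.
  apply: ltW; apply: hdl; rewrite i0 /=; apply: (@le_lt_trans _ _ (dl / 2)); last first.
    by rewrite ltr_pdivrMr// ltr_pMr// ltr1n.
  by rewrite -[leRHS]invrK lef_pV2 ?posrE// ?invr_gt0 ?divr_gt0// lerNr.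
apply: le_trans (laplace_norm BB x kd) _.
have := laplace_trunc_decay d01 Bb Bc x nu0 B0 hB; rewrite opprK -/p => h2.
apply: (@le_trans _ _ (2 * (B / p * (e / N) * rnorm x))).
  rewrite ler_pM2l//; apply: le_trans h2 _; apply: ler_wpM2r; first exact: rn_ge0.
  by apply: ler_wpM2l => //; rewrite divr_ge0// ltW.
have -> : 2 * (B / p * (e / N) * rnorm x) = (e * ((N - 1) / N)) * rnorm x by rewrite /N; ring.
apply: ler_wpM2r; first exact: rn_ge0.
by rewrite ler_piMr ?(ltW e0)// ler_pdivrMr// mul1r gerBl.
Qed.

(** The continuation to complex z that the resolvent identity forces, from the
    value at a real number m0. Formally it is R(z) P. *)
Definition laplace_ext (m0 : R) (z : C) (x : X) : X := K m0 x + (z - m0%:C) *: Rv z (K m0 x).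

Section Continuation.
Context (m0 : R).
Hypotheses (km : forall la, la <= m0 -> Kdom la) (ma : m0 < a).

Lemma laplace_ext_real la x : la <= m0 -> laplace_ext m0 la%:C x = K la x.
Proof.
move=> lm; have := laplace_res x (km lm) (km (lexx _)) (le_lt_trans lm ma).
by move/eqP; rewrite subr_eq addrC rmorphB => /eqP ->.
Qed.

Lemma laplace_ext_id z w x : outside a th z -> outside a th w ->
  laplace_ext m0 z x - laplace_ext m0 w x = (z - w) *: Rv z (laplace_ext m0 w x).
Proof.
move=> hz hw; have bz := sectorial_res_bounded_lin sr hz; case: (sr) => _ _ _ id.
have := id z w hz hw (K m0 x); rewrite /laplace_ext (bounded_linD bz) (bounded_linZ bz).
set p := Rv z (K m0 x); set q := Rv w (K m0 x); set r := Rv z q => e1.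
rewrite scalerDr scalerA [(z - w) * _]mulrC -scalerA -e1; vec (R[i]) X; ring.
Qed.

Lemma laplace_ext_S z x (s : R) : outside a th z -> 0 < s ->
  S s (laplace_ext m0 z x) - laplace_ext m0 z x = (S s (K m0 x) - K m0 x) + (z - m0%:C) *: Rv z (S s (K m0 x) - K m0 x).
Proof.
move=> hz s0; have bz := sectorial_res_bounded_lin sr hz; have [m bm] := S_bl s0.
rewrite /laplace_ext (bounded_linD bm) (bounded_linZ bm) -S_Rv// (bounded_linB bz); vec (R[i]) X; ring.
Qed.

Lemma laplace_ext_lin z c x y : outside a th z -> laplace_ext m0 z (c *: x + y) = c *: laplace_ext m0 z x + laplace_ext m0 z y.
Proof.
move=> hz; have bz := sectorial_res_bounded_lin sr hz; rewrite /laplace_ext (laplace_lin d01 Bb Bc c x y (km (lexx _))).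
by rewrite bz.1; vec (R[i]) X; ring.
Qed.

(** K decays along the negative axis, and the resolvent identity compares z with
    the point of the axis at the same distance from the vertex. *)
Lemma laplace_ext_small (e : R) : 0 < e -> exists2 rad : R, 0 < rad &
  forall z, outside a th z -> rad <= cn (z - a%:C) -> bounded_lin (laplace_ext m0 z) e.
Proof.
case: (sr) => M0 _ bd _ e0.
(* |z - la| <= 2 |z - a| for the real number la used below *)
have N0 : 0 < 1 + 2 * M by rewrite ltr_wpDr// mulr_ge0.
have [l1 h1] := laplace_small (divr_gt0 e0 N0).
pose l2 := Num.min l1 m0; have l2a : l2 < a by rewrite gt_min ma orbT.
exists (a - l2); first by rewrite subr_gt0.
move=> z hz hr; pose la := a - cn (z - a%:C).
have la2 : la <= l2 by rewrite /la lerBlDr addrC -lerBlDr.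
have [lal1 lam] : la <= l1 /\ la <= m0 by move: la2; rewrite le_min => /andP.
have ol : outside a th la%:C by apply: outside_real; exact: le_lt_trans lam ma.
split; first by move=> c x y; apply: laplace_ext_lin.
move=> x; have := laplace_ext_id x hz ol; rewrite (laplace_ext_real x lam) => /eqP; rewrite subr_eq => /eqP ->.
have [_ hK] := h1 la lal1; have z0 := outside_neq hz.
apply: le_trans (rnD _ _) _; rewrite rnZ.
have zl : cn (z - la%:C) <= 2 * cn (z - a%:C).
  have gen (p q : R) : z - q%:C = (z - p%:C) + (p - q)%:C by ring.
  rewrite (gen a la).
  apply: le_trans (cnD _ _) _; rewrite cnR /la subKr (ger0_norm (cn_ge0 _)); lra.
apply: (@le_trans _ _ ((1 + 2 * M) * rnorm (K la x))); last first.
  apply: le_trans (ler_wpM2l (ltW N0) (hK x)) _.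
  by rewrite mulrA [_ * (e / _)]mulrC divfK// gt_eqF.
rewrite mulrDl mul1r addrC; apply: lerD => //.
apply: le_trans (ler_wpM2r (rn_ge0 _) zl) _; rewrite -!mulrA ler_pM2l//; exact: bd.
Qed.

End Continuation.
End Perturb.

(** * The perturbed resolvent *)

Section PerturbedResolvent.
Context {R : realType}.
Notation C := R[i].
Notation cn := Normc.normc.
Context {X : completeNormedModType R[i]}.
Context (a th M : R) (Rv KK : C -> X -> X).
Hypothesis th0 : 0 < th < pi / 2.
Hypothesis sr : sectorial_res a th M Rv.
Hypothesis KK_id : forall z w x, outside a th z -> outside a th w ->
  KK z x - KK w x = (z - w) *: Rv z (KK w x).
Hypothesis KK_small : forall e : R, 0 < e -> exists2 rad : R, 0 < rad &
  forall z, outside a th z -> rad <= cn (z - a%:C) -> bounded_lin (KK z) e.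

Lemma vertex_ex : exists2 b : R, b <= a & forall z, outside b th z -> bounded_lin (KK z) (1 / 2).
Proof.
have [|rad rad0 hr] := KK_small (_ : 0 < 1 / 2); first by rewrite divr_gt0.
have /andP[c0 c1] := cos_th th0; have k0 : 0 < 1 - cos th by rewrite subr_gt0.
have ba : a - rad / (1 - cos th) <= a by rewrite gerBl divr_ge0// ltW.
exists (a - rad / (1 - cos th)) => // z hz.
have [ha _ h2] := outside_dist ba th0 hz; apply: hr => //; apply: le_trans h2.
by rewrite subKr mulrC divfK// gt_eqF.
Qed.

Context (b : R).
Hypotheses (ba : b <= a) (half : forall z, outside b th z -> bounded_lin (KK z) (1 / 2)).

(** The solution w of w = Rv z x + KK z w. As KK z is formally R(z) P, this is formally
    the resolvent of L - P. *)
Definition perturbed_res (z : C) (x : X) : X := neumann_inv (KK z) (Rv z x).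

Let oo z : outside b th z -> outside a th z.
Proof. by move=> hz; case: (outside_dist ba th0 hz). Qed.

Lemma perturbed_resE z x : outside b th z -> perturbed_res z x - Rv z x = KK z (perturbed_res z x).
Proof. by move=> hz; rewrite -(neumann_invP (half hz) (Rv z x)) subKr. Qed.

Lemma perturbed_res_norm z x : outside b th z -> rnorm (perturbed_res z x) <= 2 * rnorm (Rv z x).
Proof. by move=> hz; apply: (neumann_inv_bounded_lin (half hz)).2. Qed.

Lemma perturbed_res_inj z x : (forall y, Rv z y = 0 -> y = 0) -> outside b th z -> perturbed_res z x = 0 -> x = 0.
Proof.
move=> Rinj hz h; apply: Rinj; have := perturbed_resE x hz.
by rewrite h (bounded_lin0 (half hz)) sub0r => /eqP; rewrite oppr_eq0 => /eqP.
Qed.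

Lemma perturbed_res_sectorial : sectorial_res b th (2 * (M / (1 - cos th))) perturbed_res.
Proof.
have [M0 lin bd id] := sectorial_res_le th0 ba sr.
split; first exact: mulr_ge0.
- by move=> z hz c x y; rewrite /perturbed_res lin// (neumann_inv_bounded_lin (half hz)).1.
- move=> z hz x; apply: le_trans (ler_wpM2l (cn_ge0 _) (perturbed_res_norm x hz)) _.
  by rewrite mulrCA -mulrA ler_pM2l//; apply: bd.
move=> z w hz hw x; have bz := half hz; have rz := sectorial_res_bounded_lin sr (oo hz).
apply: (half_inj bz); rewrite !(bounded_linB bz) (bounded_linZ bz) -scalerBr.
have e1 y : perturbed_res z y - KK z (perturbed_res z y) = Rv z y by rewrite -perturbed_resE// subKr.
have e2 : KK w (perturbed_res w x) = perturbed_res w x - Rv w x by rewrite perturbed_resE.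
have e3 := KK_id (perturbed_res w x) (oo hz) (oo hw).
rewrite e2 (bounded_linB rz) scalerBr -id// in e3.
rewrite e1; move/eqP: e3; rewrite eq_sym subr_eq => /eqP ->.
by rewrite -(e1 x); vec (R[i]) X; ring.
Qed.

End PerturbedResolvent.

(** * The mild equation *)

Section StrongOperators.
Context {R : realType} {X : completeNormedModType R[i]}.

Context (A : R -> X -> X) (F : R -> X) (s0 t0 t1 dl m : R).
Hypotheses (dl0 : 0 < dl) (bA : forall s, `|s - s0| < dl -> bounded_lin (A s) m) (st : s0 = t1 - t0).

Let km : 0 < `|m| + 1. Proof. by rewrite ltr_wpDl. Qed.
Let bm s x : `|s - s0| < dl -> rnorm (A s x) <= (`|m| + 1) * rnorm x.
Proof.
move=> /bA [_ h]; apply: le_trans (h x) _; apply: ler_wpM2r; first exact: rn_ge0.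
by apply: le_trans (ler_norm _) _; rewrite lerDl.
Qed.

Lemma strong_cont_at : cont_at (fun s => A s (F t0)) s0 -> cont_at F t0 ->
  cont_at (fun t => A (t1 - t) (F t)) t0.
Proof.
move=> cA cF e e0.
have [d1 d10 h1] := cA _ (divr_gt0 e0 (ltr0Sn _ 1)).
have [d2 d20 h2] := cF _ (divr_gt0 (divr_gt0 e0 (ltr0Sn _ 1)) km).
exists (Num.min (Num.min dl d1) d2); first by rewrite !lt_min dl0 d10.
move=> t; rewrite !lt_min => /andP[/andP[td t1d] t2d].
have ts : t1 - t - s0 = - (t - t0) by rewrite st; ring.
have tdl : `|t1 - t - s0| < dl by rewrite ts normrN.
have ud := h1 (t1 - t); rewrite ts normrN in ud; have {}ud := ud t1d.
rewrite -st (splitr e); apply: le_lt_trans (rn_tri (A (t1 - t) (F t0)) _ _) _.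
apply: ler_ltD ud; rewrite -(bounded_linB (bA tdl)); apply: le_trans (bm _ tdl) _.
have := h2 t t2d => /ltW h; apply: le_trans (ler_wpM2l (ltW km) h) _.
by rewrite mulrC divfK// gt_eqF.
Qed.

Lemma strong_deriv_at l n : deriv_at F t0 l -> deriv_at (fun s => A s (F t0)) s0 n ->
  cont_at (fun s => A s l) s0 -> deriv_at (fun t => A (t1 - t) (F t)) t0 (A s0 l - n).
Proof.
move=> dF dA cA e e0; have e30 : 0 < e / 3 by rewrite divr_gt0.
have [d1 d10 h1] := dF _ (divr_gt0 e30 km).
have [d2 d20 h2] := dA _ e30; have [d3 d30 h3] := cA _ e30.
exists (Num.min (Num.min dl d1) (Num.min d2 d3)); first by rewrite !lt_min dl0 d10 d20.
move=> h; rewrite !lt_min => /andP[/andP[hl hd1] /andP[hd2 hd3]].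
have es : t1 - (t0 + h) = s0 - h by rewrite st; ring.
have tdl : `|s0 - h - s0| < dl by rewrite addrAC subrr add0r normrN.
have t3 : `|s0 - h - s0| < d3 by rewrite addrAC subrr add0r normrN.
have {}h1 := h1 h hd1; have {}h2 := h2 (- h); rewrite normrN in h2; have {}h2 := h2 hd2.
have {}h3 := ltW (h3 _ t3).
rewrite es -st.
have -> : A (s0 - h) (F (t0 + h)) - A s0 (F t0) - h%:C *: (A s0 l - n) =
  A (s0 - h) (F (t0 + h) - F t0 - h%:C *: l) + (A (s0 - h) (F t0) - A s0 (F t0) - (- h)%:C *: n)
  + h%:C *: (A (s0 - h) l - A s0 l).
  by rewrite !(bounded_linB (bA tdl)) (bounded_linZ (bA tdl)); vec (R[i]) X; ring.
apply: le_trans (rnD _ _) _; apply: le_trans (lerD (rnD _ _) (lexx _)) _.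
have b1 : rnorm (A (s0 - h) (F (t0 + h) - F t0 - h%:C *: l)) <= e / 3 * `|h|.
  apply: le_trans (bm _ tdl) _; apply: le_trans (ler_wpM2l (ltW km) h1) _.
  by rewrite mulrA [_ * (e / 3 / _)]mulrC divfK// gt_eqF.
have b3 : rnorm (h%:C *: (A (s0 - h) l - A s0 l)) <= e / 3 * `|h|.
  by rewrite rnZR mulrC ler_wpM2r.
apply: le_trans (lerD (lerD b1 h2) b3) _.
by rewrite le_eqVlt; apply/orP; left; apply/eqP; field.
Qed.

End StrongOperators.

Section Convolution.
Context {R : realType} {X : completeNormedModType R[i]}.
Context (A : R -> X -> X) (d : R).
Hypothesis d01 : 0 <= d < 1.
Hypothesis Ab : forall T : R, 0 < T -> exists2 K : R, 0 <= K & forall t : R, 0 < t <= T -> bounded_lin (A t) (K * t `^ (- d)).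
Hypothesis Ac : forall x (t : R), 0 < t -> cont_at (fun s => A s x) t.

Lemma kern_loc (t : R) : 0 < t -> exists m, forall s, `|s - t| < t / 2 -> bounded_lin (A s) m.
Proof.
move=> t0; have t20 : 0 < t / 2 by rewrite divr_gt0.
have tt0 : 0 < t + t by rewrite addr_gt0.
have [K K0 hK] := Ab tt0; exists (K * (t / 2) `^ (- d)).
move=> s; rewrite ltr_norml => /andP[s1 s2].
have s3 : t / 2 <= s by lra.
have s0 : 0 < s by apply: lt_le_trans s3.
have [lin bd] : bounded_lin (A s) (K * s `^ (- d)) by apply: hK; rewrite s0 /=; lra.
split=> // x; apply: le_trans (bd x) _; apply: ler_wpM2r; first exact: rn_ge0.
apply: ler_wpM2l => //; rewrite !powRN lef_pV2 ?posrE ?powR_gt0//.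
by have /andP[d0 _] := d01; apply: ge0_ler_powR; rewrite ?nnegrE ?(ltW s0) ?(ltW t20).
Qed.

Lemma conv_cont_at (t x : R) (F : R -> X) : oitv 0 (Some t) x -> cont_at F x ->
  cont_at (fun y => A (t - y) (F y)) x.
Proof.
move=> /oitvP [x0 /= xt] cF; have tx0 : 0 < t - x by rewrite subr_gt0.
have [m hm] := kern_loc tx0.
by apply: (strong_cont_at (_ : 0 < (t - x) / 2) hm erefl _ cF); [rewrite divr_gt0|apply: Ac].
Qed.

Lemma conv_cont_integrable (t m : R) (F : R -> X) : 0 < t -> (forall x, oitv 0 (Some t) x -> cont_at F x) ->
  (forall x, oitv 0 (Some t) x -> rnorm (F x) <= m) ->
  cont_integrable (oitv 0 (Some t)) (fun y => A (t - y) (F y)).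
Proof.
move=> t0 cF bF; have [K K0 hK] := Ab t0.
have m0 : 0 <= m.
  have h2 : oitv 0 (Some t) (t / 2) by apply/oitvP; split=> /=; lra.
  exact: le_trans (rn_ge0 _) (bF _ h2).
apply: (cont_integrable_dom (g := fun y => (K * m) * (t - y) `^ (- d)) (measurable_oitv _ _)).
- by move=> x hx; apply: conv_cont_at hx (cF x hx).
- move=> x hx; move: (hx) => /oitvP [x0 /= xt].
  have [_ h] : bounded_lin (A (t - x)) (K * (t - x) `^ (- d)) by apply: hK; apply/andP; split; lra.
  apply: le_trans (h _) _; rewrite mulrAC; apply: ler_wpM2r; first exact: powR_ge0.
  by apply: ler_wpM2l => //; apply: bF.
apply: le_lt_trans (pow_bound_right (mulr_ge0 K0 m0) d01 t0) (ltry _).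
Qed.

End Convolution.

Section Mild.
Context {R : realType}.
Notation C := R[i].
Notation cn := Normc.normc.
Context {X : completeNormedModType R[i]}.
Context (S BB : R -> X -> X) (d : R).
Hypothesis d01 : 0 <= d < 1.
Hypothesis Sb : forall T : R, 0 < T -> exists M : R, forall t : R, 0 < t <= T -> bounded_lin (S t) M.
Hypothesis Sadd : forall (s t : R) u, 0 < s -> 0 < t -> S (s + t) u = S s (S t u).
Hypothesis Sc : forall u (t : R), 0 < t -> cont_at (fun s => S s u) t.
Hypothesis Bb : forall T : R, 0 < T -> exists2 K : R, 0 <= K & forall t : R, 0 < t <= T -> bounded_lin (BB t) (K * t `^ (- d)).
Hypothesis Bc : forall x (t : R), 0 < t -> cont_at (fun s => BB s x) t.
Context (a th M : R) (Rv KK : C -> X -> X).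
Hypothesis th0 : 0 < th < pi / 2.
Hypothesis sr : sectorial_res a th M Rv.
Hypothesis Sgen : forall (r eta t : R) u, 0 < r -> th < eta < pi / 2 -> 0 < t ->
  S t u = contour_sg Rv a r eta t u.
Hypothesis KK_small : forall e : R, 0 < e -> exists2 rad : R, 0 < rad &
  forall z, outside a th z -> rad <= cn (z - a%:C) -> bounded_lin (KK z) e.
Context (m0 : R).
Hypothesis SKK : forall e : R, 0 < e -> exists2 dl : R, 0 < dl & forall s : R, 0 < s < dl ->
  exists2 D : X -> X, (forall x, rnorm (D x) <= e * rnorm x) &
    forall z x, outside a th z -> S s (KK z x) - KK z x = D x + (z - m0%:C) *: Rv z (D x).
Context (b M' : R) (RP : C -> X -> X).
Hypothesis ba : b <= a.
Hypothesis sP : sectorial_res b th M' RP.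
Hypothesis RPE : forall z x, outside b th z -> RP z x - Rv z x = KK z (RP z x).
Context (mu : C).
Hypothesis omu : outside b th mu.
Hypothesis SKK_deriv_at : forall x (t : R), 0 < t ->
  deriv_at (fun s => S s (KK mu x)) t (- (mu *: S t (KK mu x)) - BB t x).
Context (r eta : R).
Hypotheses (r0 : 0 < r) (eta0 : th < eta < pi / 2).

Let eta1 : 0 < eta < pi / 2.
Proof. by move: th0 eta0 => /andP[? _] /andP[? ->]; rewrite andbT; lra. Qed.

Let ce0 : 0 < cos eta. Proof. by have /andP[] := cos_th eta1. Qed.
Let k0 : 0 < 1 - cos th. Proof. by have /andP[? ?] := cos_th th0; rewrite subr_gt0. Qed.
Let M0 : 0 <= M. Proof. by case: sr. Qed.
Let M'0 : 0 <= M'. Proof. by case: sP. Qed.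

Notation q := (contour_sg RP b r eta).

Let S_bl (t : R) : 0 < t -> exists m, bounded_lin (S t) m.
Proof. by move=> t0; have [m hm] := Sb t0; exists m; apply: hm; rewrite t0 lexx. Qed.

Lemma contour_cont_ext c (f h : C -> X) : (forall z, on_contour c r eta z -> f z = h z) ->
  contour_cont c r eta f -> contour_cont c r eta h.
Proof.
move=> fh cf z hz e e0; have [dl dl0 hd] := cf z hz e e0; exists dl => // w hw hwz.
by rewrite -!fh//; apply: hd.
Qed.

Let og c z : c <= b -> on_contour c r eta z -> outside b th z.
Proof. by move=> cb /(on_contour_out th0 r0 eta0 cb) []. Qed.

Let g_contour_cont c u : c <= b -> contour_cont c r eta (fun z => KK z (RP z u)).
Proof.
move=> cb; have ca := le_trans cb ba.
have c1 := (lip_deriv_contour_cont (sectorial_res_lip_deriv th0 sr r0 u) (on_contour_far th0 r0 eta0 ca)).1.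
have c2 := (lip_deriv_contour_cont (sectorial_res_lip_deriv th0 sP r0 u) (on_contour_far th0 r0 eta0 cb)).1.
apply: contour_cont_ext (contour_cont_lin (-1) c1 c2) => z hz.
by rewrite scaleN1r addrC -RPE//; apply: og hz.
Qed.

Lemma contour_diff c (t : R) u : c <= b -> 0 < t ->
  q t u - S t u = contour_factor *: contour_int c r eta (fun z => cexp (- z * t%:C) *: KK z (RP z u)).
Proof.
move=> cb t0; have ca := le_trans cb ba.
rewrite -(contour_sg_vertex u th0 sP cb (lexx _) r0 eta0 t0) (Sgen u r0 eta0 t0).
rewrite -(contour_sg_vertex u th0 sr ca (lexx _) r0 eta0 t0) /contour_sg -scalerBr; congr (_ *: _).
have a1 := contour_sg_adm th0 sr ca r0 eta0 u t0; have a2 := contour_sg_adm th0 sP cb r0 eta0 u t0.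
have := contour_int_lin r0 eta1 (-1) a1 a2; rewrite scaleN1r addrC => <-.
apply: contour_int_ext => z hz; rewrite scaleN1r addrC -scalerBr RPE//; exact: og hz.
Qed.

Let contour_int_bound c (t P : R) p : 0 < t -> contour_cont c r eta p ->
  (forall z, on_contour c r eta z -> rnorm (p z) <= P) ->
  rnorm (contour_factor *: contour_int c r eta (fun z => cexp (- z * t%:C) *: (p z : X))) <=
  cn (@contour_factor R) * (`|P| * expR (- c * t + 2 * r * t) * (2 / (t * cos eta) + 2 * pi * r)).
Proof.
move=> t0 cp bp; have [h1 h2] := contour_adm_exp r0 eta1 t0 cp bp.
rewrite rnZ; apply: ler_wpM2l; first exact: cn_ge0.
by apply: (contour_int_norm r0 eta1 h1 _ _ h2); rewrite ?mulr_ge0 ?mulr_gt0 ?expR_ge0.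
Qed.

(** Near time zero the vertex of the contour is moved to b - 1/t, where KK is
    small: the perturbed family and the semigroup differ by o(1) in norm. *)
Lemma contour_near (e : R) : 0 < e -> exists2 dl : R, 0 < dl &
  forall t : R, 0 < t < dl -> forall u, rnorm (q t u - S t u) <= e * rnorm u.
Proof.
move=> e0; have p0 := pi_gt0 R.
pose W := cn (@contour_factor R) * (M' / (1 - cos th)) * expR (1 + `|b| + 2 * r) * (2 / cos eta + 2 * pi * r) + 1.
have k1 : 0 <= 2 / cos eta + 2 * pi * r by rewrite addr_ge0 ?divr_ge0 ?mulr_ge0 ?(ltW ce0) ?(ltW r0) ?(ltW p0).
have k2 : 0 <= M' / (1 - cos th) by rewrite divr_ge0// ltW.
have W0 : 0 < W by rewrite ltr_wpDl// !mulr_ge0 ?cn_ge0 ?expR_ge0.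
have [rad rad0 hrad] := KK_small (divr_gt0 e0 W0).
exists (Num.min 1 ((1 - cos th) / rad)); first by rewrite lt_min ltr01 divr_gt0.
move=> t /andP[t0]; rewrite lt_min => /andP[t1 tr] u.
(* at this vertex the exponential contributes at most expR 1, up to constants *)
pose c := b - t^-1; have ti0 : 0 < t^-1 by rewrite invr_gt0.
have cb : c <= b by rewrite gerBl ltW.
have ca := le_trans cb ba.
pose P := e / W * (M' / (1 - cos th) * t * rnorm u).
have P0 : 0 <= P by rewrite /P !mulr_ge0 ?invr_ge0 ?rn_ge0 ?(ltW W0) ?(ltW k0) ?(ltW e0) ?(ltW t0).
have bP z : on_contour c r eta z -> rnorm (KK z (RP z u)) <= P.
  move=> hz; have [oa oc _] := on_contour_out th0 r0 eta0 ca hz.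
  have [_ _ da] := outside_dist ca th0 oc; have [ob _ db] := outside_dist cb th0 oc.
  have bk : bounded_lin (KK z) (e / W).
    apply: hrad oa (le_trans _ da); rewrite mulrC -ler_pdivrMr//.
    apply: (@le_trans _ _ t^-1); last by rewrite /c opprB addrCA lerDl subr_ge0.
    by rewrite -[leLHS]invrK lef_pV2 ?posrE ?invr_gt0 ?divr_gt0// invf_div ltW.
  apply: le_trans (bk.2 _) _; apply: ler_wpM2l; first by rewrite divr_ge0// ltW.
  case: (sP) => _ _ bd _; have := bd z ob u.
  have db' : (1 - cos th) / t <= cn (z - b%:C) by apply: le_trans db; rewrite /c subKr.
  move=> h; have := le_trans (ler_wpM2r (rn_ge0 (RP z u)) db') h.
  have -> : M' / (1 - cos th) * t * rnorm u = M' * rnorm u * ((1 - cos th) / t)^-1 by rewrite invf_div; ring.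
  by rewrite ler_pdivlMr ?divr_gt0// mulrC.
rewrite (contour_diff u cb t0); apply: le_trans (contour_int_bound t0 (g_contour_cont u cb) bP) _.
rewrite (ger0_norm P0).
have ex : expR (- c * t + 2 * r * t) <= expR (1 + `|b| + 2 * r).
  rewrite ler_expR /c opprB mulrBl mulVf ?gt_eqF//.
  apply: lerD; last by rewrite ler_piMr ?mulr_ge0// ltW.
  apply: lerD => //; apply: le_trans (ler_norm _) _.
  by rewrite normrN normrM ler_piMr// gtr0_norm// ltW.
have tx : t * (2 / (t * cos eta) + 2 * pi * r) <= 2 / cos eta + 2 * pi * r.
  rewrite mulrDr; apply: lerD; last by rewrite ler_piMl ?(ltW t1)// !mulr_ge0// ltW.
  by have -> : t * (2 / (t * cos eta)) = 2 / cos eta by field; rewrite !gt_eqF.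
apply: (@le_trans _ _ (cn (@contour_factor R) * (e / W * (M' / (1 - cos th) * rnorm u) * expR (1 + `|b| + 2 * r) * (2 / cos eta + 2 * pi * r)))); last first.
  have -> : cn (@contour_factor R) * (e / W * (M' / (1 - cos th) * rnorm u) * expR (1 + `|b| + 2 * r) * (2 / cos eta + 2 * pi * r)) = (e * ((W - 1) / W)) * rnorm u by rewrite /W; ring.
  apply: ler_wpM2r; first exact: rn_ge0.
  by rewrite ler_piMr ?(ltW e0)// ler_pdivrMr// mul1r gerBl.
apply: ler_wpM2l; first exact: cn_ge0.
have -> : P * expR (- c * t + 2 * r * t) * (2 / (t * cos eta) + 2 * pi * r) =
  (e / W * (M' / (1 - cos th) * rnorm u) * expR (- c * t + 2 * r * t)) * (t * (2 / (t * cos eta) + 2 * pi * r)).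
  by rewrite /P; ring.
have P1 : 0 <= e / W * (M' / (1 - cos th) * rnorm u).
  by rewrite !mulr_ge0 ?invr_ge0 ?rn_ge0 ?(ltW W0) ?(ltW k0) ?(ltW e0).
have B0 : 0 <= t * (2 / (t * cos eta) + 2 * pi * r).
  by rewrite mulr_ge0 ?(ltW t0)// addr_ge0 ?divr_ge0 ?mulr_ge0 ?(ltW t0) ?(ltW ce0) ?(ltW r0) ?(ltW p0).
apply: ler_pM tx => //; first exact: mulr_ge0 P1 (expR_ge0 _).
exact: ler_wpM2l.
Qed.

Lemma contour_bound (T : R) u : 0 < T -> exists2 m, 0 <= m & forall t : R, 0 < t <= T -> rnorm (q t u) <= m.
Proof.
move=> T0; have p0 := pi_gt0 R; have [dl dl0 hdl] := contour_near ltr01; have [m hm] := Sb T0.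
pose P := M' / ((1 - cos th) * r) * rnorm u.
pose B := cn (@contour_factor R) * (`|P| * expR ((`|b| + 2 * r) * T) * (2 / (dl * cos eta) + 2 * pi * r)).
have k1 t : 0 < t -> 0 <= 2 / (t * cos eta) + 2 * pi * r.
  by move=> t0; rewrite addr_ge0 ?divr_ge0 ?mulr_ge0 ?(ltW t0) ?(ltW ce0) ?(ltW r0) ?(ltW p0).
have B0 : 0 <= B by rewrite !mulr_ge0 ?cn_ge0 ?expR_ge0 ?k1.
exists (B + (1 + `|m|) * rnorm u); first by rewrite addr_ge0// mulr_ge0 ?rn_ge0// addr_ge0.
move=> t /andP[t0 tT]; have [td|td] := ltP t dl.
  apply: le_trans (rnDB _ (S t u)) _; apply: (@le_trans _ _ (rnorm u + `|m| * rnorm u)); last first.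
    by rewrite mulrDl mul1r lerDr.
  apply: lerD; first by rewrite -[leRHS]mul1r; apply: hdl; rewrite t0.
  have [_ h] : bounded_lin (S t) m by apply: hm; rewrite t0.
  by apply: le_trans (h u) _; rewrite ler_wpM2r ?rn_ge0 ?ler_norm.
apply: (@le_trans _ _ B); last by rewrite lerDl mulr_ge0 ?rn_ge0// addr_ge0.
have cR := (lip_deriv_contour_cont (sectorial_res_lip_deriv th0 sP r0 u) (on_contour_far th0 r0 eta0 (lexx b))).1.
have bR z : on_contour b r eta z -> rnorm (RP z u) <= P.
  by move=> hz; apply: (far_bound th0 sP r0); apply: (on_contour_far th0 r0 eta0 (lexx b)).
apply: le_trans (contour_int_bound t0 cR bR) _; apply: ler_wpM2l; first exact: cn_ge0.
apply: ler_pM; rewrite ?k1 ?mulr_ge0 ?expR_ge0//.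
  apply: ler_wpM2l => //; rewrite ler_expR -mulrDl.
  apply: (@le_trans _ _ ((`|b| + 2 * r) * t)).
    by apply: ler_wpM2r; [exact: ltW|rewrite lerD2r -normrN ler_norm].
  by apply: ler_wpM2l => //; rewrite addr_ge0 ?mulr_ge0 ?(ltW r0).
rewrite lerD2r; apply: ler_wpM2l => //; rewrite lef_pV2 ?posrE ?mulr_gt0//.
by rewrite ler_pM2r.
Qed.

Lemma contour_cont_at (t : R) u : 0 < t -> cont_at (fun s => q s u) t.
Proof. by move=> t0; exact: deriv_at_cont_at (contour_sg_deriv_at th0 sP (lexx b) r0 eta0 mu u t0). Qed.

(** q(t) - S(t) u is a contour integral of values of KK, on which the semigroup is
    uniformly continuous at zero, while S(s) S(t) u = S(s + t) u. *)
Lemma semigroup_contour_lim (t : R) u : 0 < t -> forall e : R, 0 < e -> exists2 dl : R, 0 < dl &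
  forall s : R, 0 < s < dl -> rnorm (S s (q t u) - q t u) <= e.
Proof.
move=> t0 e e0; have p0 := pi_gt0 R.
pose P := M' / ((1 - cos th) * r) * rnorm u.
have P0 : 0 <= P by rewrite /P !mulr_ge0 ?invr_ge0 ?mulr_ge0 ?rn_ge0 ?(ltW k0) ?(ltW r0).
have bR z : on_contour b r eta z -> rnorm (RP z u) <= P.
  by move=> hz; apply: (far_bound th0 sP r0); apply: (on_contour_far th0 r0 eta0 (lexx b)).
pose ma := M / ((1 - cos th) * r).
have ma0 : 0 <= ma by rewrite /ma !mulr_ge0 ?invr_ge0 ?mulr_ge0 ?(ltW k0) ?(ltW r0).
pose W := cn (@contour_factor R) * ((1 + M + `|a - m0| * ma) * P * expR (- b * t + 2 * r * t) * (2 / (t * cos eta) + 2 * pi * r)) + 1.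
have k1 : 0 <= 2 / (t * cos eta) + 2 * pi * r.
  by rewrite addr_ge0 ?divr_ge0 ?mulr_ge0 ?(ltW t0) ?(ltW ce0) ?(ltW r0) ?(ltW p0).
have k2 : 0 <= 1 + M + `|a - m0| * ma by apply: addr_ge0 (mulr_ge0 (normr_ge0 _) ma0); apply: addr_ge0.
have W0 : 0 < W.
  rewrite ltr_wpDl//.
  exact: mulr_ge0 (cn_ge0 _) (mulr_ge0 (mulr_ge0 (mulr_ge0 k2 P0) (expR_ge0 _)) k1).
have e20 : 0 < e / 2 by rewrite divr_gt0.
have [d1 d10 h1] := SKK (divr_gt0 e20 W0).
have [d2 d20 h2] := Sc u t0 e20.
exists (Num.min d1 d2); first by rewrite lt_min d10.
move=> s /andP[s0]; rewrite lt_min => /andP[sd1 sd2].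
have [|D bD hD] := h1 s; first by rewrite s0.
have [m bS] := S_bl s0.
have gc := g_contour_cont u (lexx b).
pose p z := S s (KK z (RP z u)) - KK z (RP z u).
have cp : contour_cont b r eta p.
  have cS : contour_cont b r eta (fun z => S s (KK z (RP z u))).
    move=> z hz x x0; pose k := `|m| + 1; have k0' : 0 < k by rewrite ltr_wpDl.
    have [y y0 hy] := gc z hz (x / k) (divr_gt0 x0 k0'); exists y => // w hw wz.
    rewrite -(bounded_linB bS); apply: le_lt_trans (bS.2 _) _.
    apply: (@le_lt_trans _ _ (k * rnorm (KK w (RP w u) - KK z (RP z u)))).
      by apply: ler_wpM2r; [exact: rn_ge0|apply: le_trans (ler_norm _) _; rewrite lerDl].
    by rewrite mulrC -ltr_pdivlMr//; apply: hy.
  apply: contour_cont_ext (contour_cont_lin (-1) gc cS) => z hz.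
  by rewrite scaleN1r addrC.
have bp z : on_contour b r eta z -> rnorm (p z) <= e / 2 / W * ((1 + M + `|a - m0| * ma) * P).
  move=> hz; have fz := on_contour_far th0 r0 eta0 ba hz; have [oa _] := fz.
  rewrite /p (hD z _ oa); set y := RP z u.
  have Dy : rnorm (D y) <= e / 2 / W * P.
    by apply: le_trans (bD y) _; apply: ler_wpM2l (bR z hz); rewrite divr_ge0 ?ltW.
  have r1 := far_bound th0 sr r0 (D y) fz; rewrite -/ma in r1.
  case: (sr) => _ _ bd _; have r2 := bd z oa (D y).
  have zm : cn (z - m0%:C) <= cn (z - a%:C) + `|a - m0|.
    have -> : z - m0%:C = (z - a%:C) + (a - m0)%:C by ring.
    by apply: le_trans (cnD _ _) _; rewrite cnR.
  apply: le_trans (rnD _ _) _; rewrite rnZ.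
  have r3 : cn (z - m0%:C) * rnorm (Rv z (D y)) <= M * rnorm (D y) + `|a - m0| * (ma * rnorm (D y)).
    apply: le_trans (ler_wpM2r (rn_ge0 _) zm) _; rewrite mulrDl; apply: lerD => //.
    exact: ler_wpM2l.
  apply: le_trans (lerD (lexx _) r3) _.
  have -> : rnorm (D y) + (M * rnorm (D y) + `|a - m0| * (ma * rnorm (D y))) = (1 + M + `|a - m0| * ma) * rnorm (D y) by ring.
  by apply: le_trans (ler_wpM2l k2 Dy) _; rewrite le_eqVlt; apply/orP; left; apply/eqP; ring.
have ga : contour_adm b r eta (fun z => cexp (- z * t%:C) *: KK z (RP z u)).
  have := contour_sg_adm th0 sP (lexx b) r0 eta0 u t0; have := contour_sg_adm th0 sr ba r0 eta0 u t0 => a1 a2.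
  have [c1 [K [k [K0 k0' h]]]] := contour_adm_lin (-1) a1 a2.
  have ee z : on_contour b r eta z -> -1 *: (cexp (- z * t%:C) *: Rv z u) + cexp (- z * t%:C) *: RP z u = cexp (- z * t%:C) *: KK z (RP z u).
    by move=> hz; rewrite scaleN1r addrC -scalerBr RPE//; exact: og hz.
  split; first exact: contour_cont_ext ee c1.
  by exists K, k; split=> // z hz; rewrite -ee//; apply: h.
have qE := contour_diff u (lexx b) t0; have {}qE : q t u = S t u + contour_factor *: contour_int b r eta (fun z => cexp (- z * t%:C) *: KK z (RP z u)) by rewrite -qE addrC subrK.
have -> : S s (q t u) - q t u = (S (s + t) u - S t u) + contour_factor *: contour_int b r eta (fun z => cexp (- z * t%:C) *: p z).
  have := contour_int_lin r0 eta1 (-1) ga (contour_adm_bounded_lin bS ga); rewrite (contour_int_bounded_lin r0 eta1 bS ga) => ce.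
  have -> : contour_int b r eta (fun z => cexp (- z * t%:C) *: p z) = - contour_int b r eta (fun z => cexp (- z * t%:C) *: KK z (RP z u)) + S s (contour_int b r eta (fun z => cexp (- z * t%:C) *: KK z (RP z u))).
    rewrite -scaleN1r -ce; apply: contour_int_ext => z _.
    by rewrite /p (bounded_linZ bS) scaleN1r [RHS]addrC -scalerBr.
  by rewrite qE (bounded_linD bS) (bounded_linZ bS) -Sadd//; vec (R[i]) X; ring.
apply: le_trans (rnD _ _) _; rewrite [leRHS]splitr; apply: lerD.
  by apply: ltW; apply: h2; rewrite addrK gtr0_norm.
apply: le_trans (contour_int_bound t0 cp bp) _.
rewrite ger0_norm; last exact: mulr_ge0 (divr_ge0 (ltW e20) (ltW W0)) (mulr_ge0 k2 P0).
have -> : cn (@contour_factor R) * (e / 2 / W * ((1 + M + `|a - m0| * ma) * P) * expR (- b * t + 2 * r * t) * (2 / (t * cos eta) + 2 * pi * r)) = e / 2 * ((W - 1) / W) by rewrite /W; ring.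
by rewrite ler_piMr ?(ltW e20)// ler_pdivrMr// mul1r gerBl.
Qed.

(** The decomposition of q into KK q and Rv y makes S(v) q differentiable in v; its
    derivative cancels that of q except for the term produced by the kernel. *)
Lemma semigroup_contour_deriv (t x : R) u : oitv 0 (Some t) x ->
  deriv_at (fun y => S (t - y) (q y u)) x (BB (t - x) (q x u)).
Proof.
move=> /oitvP [x0 /= xt]; have s0 : 0 < t - x by rewrite subr_gt0.
set y := contour_sgL RP b r eta mu x u; set s := t - x in s0 *.
have oa : outside a th mu by case: (outside_dist ba th0 omu).
have qE : q x u = KK mu (q x u) + Rv mu y.
  rewrite -[in LHS](res_contour_sgL th0 sP (lexx b) r0 eta0 u x0 omu) -/y.
  rewrite -(res_contour_sgL th0 sP (lexx b) r0 eta0 u x0 omu) -/y -RPE// subrK//.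
have dS : deriv_at (fun v => S v (q x u)) s (- S s y - mu *: S s (q x u) - BB s (q x u)).
  have := deriv_at_lin 1 (S_Rv_deriv_at th0 sr Sgen y oa s0) (SKK_deriv_at (q x u) s0).
  have [m bS] := S_bl s0.
  have -> : 1 *: (- S s y - mu *: S s (Rv mu y)) + (- (mu *: S s (KK mu (q x u))) - BB s (q x u)) =
     - S s y - mu *: S s (q x u) - BB s (q x u).
    have eS : S s (q x u) = S s (KK mu (q x u)) + S s (Rv mu y) by rewrite [in LHS]qE (bounded_linD bS).
    by rewrite eS; vec (R[i]) X; ring.
  apply: deriv_at_pos s0 _ => v v0; have [m' bS'] := S_bl v0.
  by rewrite [in RHS]qE (bounded_linD bS') scale1r addrC.
have [m hm] := Sb (addr_gt0 s0 s0).
have bS v : `|v - s| < s -> bounded_lin (S v) m.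
  by rewrite ltr_norml => /andP[v1 v2]; apply: hm; apply/andP; split; lra.
have := strong_deriv_at s0 bS erefl (contour_sg_deriv_at th0 sP (lexx b) r0 eta0 mu u x0) dS (Sc _ s0).
have [m' bS'] := S_bl s0.
have -> // : S s (- y - mu *: q x u) - (- S s y - mu *: S s (q x u) - BB s (q x u)) = BB s (q x u).
have gen (v w : X) : S s (- v - mu *: w) = - S s v - mu *: S s w.
  by rewrite (bounded_linB bS') (bounded_linN bS') (bounded_linZ bS').
by rewrite gen; vec (R[i]) X; ring.
Qed.

(** The function S(t - y) q(y) joins S(t) u to q(t). *)
Lemma mild_contour (t : R) u : 0 < t ->
  q t u = S t u + bochner (oitv 0 (Some t)) (fun y => BB (t - y) (q y u)).
Proof.
move=> t0; have [m m00 hm] := contour_bound u t0.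
have h2 : oitv 0 (Some t) (t / 2) by apply/oitvP; split=> /=; lra.
have ci : cont_integrable (oitv 0 (Some t)) (fun y => BB (t - y) (q y u)).
  apply: (conv_cont_integrable d01 Bb Bc (m := m) t0) => x /oitvP [x0 /= xt]; first exact: contour_cont_at.
  by apply: hm; rewrite x0 ltW.
have [m1 hS] := Sb t0; pose k := `|m1| + 1; have kp : 0 < k by rewrite ltr_wpDl.
have bS s x : 0 < s -> s <= t -> rnorm (S s x) <= k * rnorm x.
  move=> s0 st; have [_ h] : bounded_lin (S s) m1 by apply: hS; rewrite s0.
  apply: le_trans (h x) _; apply: ler_wpM2r; first exact: rn_ge0.
  by apply: le_trans (ler_norm _) _; rewrite lerDl.
have lS s : 0 < s -> s <= t -> bounded_lin (S s) m1 by move=> s0 st; apply: hS; rewrite s0.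
rewrite (bochner_ftc (F := fun y => S (t - y) (q y u)) (A := S t u) (B := q t u) h2 ci).
- by rewrite addrC subrK.
- by move=> x hx; apply: semigroup_contour_deriv.
- apply: near_limit_left h2 _ => e e0; pose n := k * rnorm u + 1.
  have n0 : 0 < n by rewrite ltr_wpDl// mulr_ge0 ?rn_ge0// ltW.
  have [dl dl0 hdl] := contour_near (divr_gt0 e0 n0).
  exists (dl / 2); first by rewrite divr_gt0.
  move=> s /oitvP [s0 /= st]; rewrite subr0 gtr0_norm// => sd.
  have ts0 : 0 < t - s by rewrite subr_gt0.
  have tst : t - s <= t by rewrite gerBl ltW.
  have -> : S t u = S (t - s) (S s u) by rewrite -Sadd// subrK.
  rewrite -(bounded_linB (lS _ ts0 tst)); apply: le_trans (bS _ _ ts0 tst) _.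
  have h : rnorm (q s u - S s u) <= e / n * rnorm u by apply: hdl; apply/andP; split=> //; lra.
  apply: le_trans (ler_wpM2l (ltW kp) h) _.
  have -> : k * (e / n * rnorm u) = e * ((n - 1) / n) by rewrite /n; ring.
  by rewrite ler_piMr ?(ltW e0)// ler_pdivrMr// mul1r gerBl.
apply: near_limit_right h2 _ => e e0; have e20 : 0 < e / 2 by rewrite divr_gt0.
have [d1 d10 hd1] := semigroup_contour_lim u t0 e20.
have [d2 d20 hd2] := contour_cont_at u t0 (divr_gt0 e20 kp).
exists (Num.min (d1 / 2) (d2 / 2)); first by rewrite lt_min !divr_gt0.
move=> s /oitvP [s0 /= st]; rewrite le_min distrC => /andP[].
have ts0 : 0 < t - s by rewrite subr_gt0.
have tst : t - s <= t by rewrite gerBl ltW.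
rewrite gtr0_norm// => sd1 sd2.
apply: le_trans (rn_tri (S (t - s) (q t u)) _ _) _; rewrite [leRHS]splitr; apply: lerD.
  rewrite -(bounded_linB (lS _ ts0 tst)); apply: le_trans (bS _ _ ts0 tst) _.
  have h : rnorm (q s u - q t u) <= e / 2 / k.
    by apply: ltW; apply: hd2; rewrite distrC gtr0_norm//; lra.
  by apply: le_trans (ler_wpM2l (ltW kp) h) _; rewrite mulrC divfK// gt_eqF.
by apply: hd1; apply/andP; split=> //; lra.
Qed.

End Mild.

(** * Uniqueness of mild solutions *)

Section Volterra.
Context {R : realType} {X : completeNormedModType R[i]}.
Context (w : R -> X) (T N d m : R).
Hypotheses (d01 : 0 <= d < 1) (T0 : 0 < T) (N0 : 0 <= N).
Let p := (1 - d) / 2.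
Hypothesis wb : forall t : R, 0 < t <= T -> rnorm (w t) <= m.
Hypothesis wv : forall t c : R, 0 < t <= T -> 0 <= c ->
  (forall s, oitv 0 (Some t) s -> rnorm (w s) * (t - s) `^ (- d) <= c * (t - s) `^ (- (d + p))) ->
  rnorm (w t) <= N * (c / p * t `^ p).

(** A weakly singular homogeneous Volterra inequality has no bounded solution
    but zero: for a large weight expR (la * t) the integral operator is a
    contraction. *)
Lemma volterra_zero (t : R) : 0 < t <= T -> w t = 0.
Proof.
have p0 : 0 < p by rewrite divr_gt0// subr_gt0; case/andP: d01.
have /andP[d0 d1] := d01.
have m0 : 0 <= m by apply: le_trans (rn_ge0 _) (wb (t := T) _); rewrite T0 lexx.
pose k := N * (T `^ p / p) + 1.
have k0 : 0 < k by rewrite ltr_wpDl// !mulr_ge0 ?invr_ge0 ?powR_ge0// ltW.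
have [|dl dl0 hdl] := pow_small p0 (_ : 0 < (1 / 2) / k).
  by rewrite !divr_gt0.
(* the weight for which the integral operator has norm at most 1/2 *)
pose la := (dl / 2)^-1; have la0 : 0 < la by rewrite invr_gt0 divr_gt0.
have lap : la `^ (- p) <= (1 / 2) / k.
  have i0 : 0 < la^-1 by rewrite invr_gt0.
  have -> : la `^ (- p) = la^-1 `^ p by rewrite -[la^-1]powR_inv1 ?(ltW la0)// -powRrM mulN1r.
  by apply: ltW; apply: hdl; rewrite i0 /la invrK /= ltr_pdivrMr// ltr_pMr// ltr1n.
have step j s : 0 < s <= T -> rnorm (w s) <= (1 / 2) ^+ j * (m * expR (la * s)).
  elim: j s => [|j IH] s sT; move: (sT) => /andP[s0 sT'].
    rewrite expr0 mul1r; apply: le_trans (wb sT) _; rewrite ler_peMr//.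
    by rewrite -expR0 ler_expR mulr_ge0// ltW.
  set mj := (1 / 2) ^+ j * m; have mj0 : 0 <= mj by rewrite mulr_ge0 ?exprn_ge0.
  have c0 : 0 <= mj * expR (la * s) * la `^ (- p).
    by apply: mulr_ge0 (powR_ge0 _ _); apply: mulr_ge0 (expR_ge0 _).
  apply: le_trans (wv sT c0 _) _.
    move=> x /oitvP [x0 /= xs]; have sx0 : 0 < s - x by rewrite subr_gt0.
    have e1 : (s - x) `^ (- (d + p)) = (s - x) `^ (- d) * (s - x) `^ (- p).
      by rewrite opprD powRD// (gt_eqF sx0) implybT.
    have h1 : expR (la * x) <= expR (la * s) * (la `^ (- p) * (s - x) `^ (- p)).
      have -> : expR (la * x) = expR (la * s) * expR (- (la * (s - x))).
        by rewrite -expRD; congr expR; ring.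
      apply: ler_wpM2l; first exact: expR_ge0.
      rewrite -(powRM _ (ltW la0) (ltW sx0)) expRN powRN lef_pV2 ?posrE ?expR_gt0 ?powR_gt0 ?mulr_gt0//.
      by apply: pow_le_exp; [exact: mulr_gt0|apply/andP; split; rewrite /p; lra].
    have h2 := IH x; rewrite x0 (le_trans (ltW xs) sT') in h2; have {}h2 := h2 isT.
    apply: (@le_trans _ _ ((mj * expR (la * x)) * (s - x) `^ (- d))).
      by apply: ler_wpM2r; [exact: powR_ge0|rewrite -mulrA].
    apply: (@le_trans _ _ ((mj * (expR (la * s) * (la `^ (- p) * (s - x) `^ (- p)))) * (s - x) `^ (- d))).
      by apply: ler_wpM2r; [exact: powR_ge0|apply: ler_wpM2l].
    by rewrite e1 le_eqVlt; apply/orP; left; apply/eqP; ring.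
  have -> : N * (mj * expR (la * s) * la `^ (- p) / p * s `^ p) =
     (mj * expR (la * s)) * (la `^ (- p) * (N * (s `^ p / p))) by ring.
  have -> : (1 / 2) ^+ j.+1 * (m * expR (la * s)) = (mj * expR (la * s)) * (1 / 2).
    by rewrite /mj exprS; ring.
  apply: ler_wpM2l; first exact: mulr_ge0 mj0 (expR_ge0 _).
  apply: (@le_trans _ _ ((1 / 2) / k * k)); last by rewrite divfK// gt_eqF.
  apply: ler_pM => //; rewrite ?powR_ge0 ?mulr_ge0 ?invr_ge0 ?powR_ge0 ?(ltW p0)//.
  rewrite /k; apply: (@le_trans _ _ (N * (T `^ p / p))); last by rewrite lerDl.
  apply: ler_wpM2l => //; apply: ler_wpM2r; first by rewrite invr_ge0 ltW.
  by apply: ge0_ler_powR; rewrite ?nnegrE ?(ltW p0) ?(ltW s0) ?(ltW T0).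
move=> tT; apply: rn_small => e e0; rewrite subr0.
have [j hj] := half_pow_small (m * expR (la * t)) e0.
exact: le_trans (step j t tT) (ltW hj).
Qed.

End Volterra.

(** * Sectorial generators and their resolvents *)

Section Generators.
Context {R : realType}.
Notation C := R[i].
Notation cn := Normc.normc.
Context {X : completeNormedModType R[i]}.

Lemma Re_norm (z : C) : complex.Re `|z| = cn z.
Proof. by rewrite cnE. Qed.

Section Resolvent.
Context (L : unbounded_operator X).

Lemma resolventP z y : resolvent_set L z ->
  dom L (resolvent L z y) /\ opfun L (resolvent L z y) = y + z *: resolvent L z y.
Proof.
move=> [ex _]; have [x [hx _]] := ex y.
have /= := xgetPex 0 (P := [set x | dom L x /\ opfun L x - z *: x = y]) (ex_intro _ x hx).
by rewrite -/(resolvent L z y) => -[h1 h2]; split=> //; apply/eqP; rewrite -subr_eq h2.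
Qed.

Lemma resolvent_uniq z x y : resolvent_set L z -> dom L x -> opfun L x - z *: x = y ->
  x = resolvent L z y.
Proof.
move=> rz dx hx; have [h1 h2] := resolventP y rz; have [ex _] := rz.
have [v [_ uv]] := ex y; rewrite -(uv x)//; apply: uv.
by split=> //; rewrite h2 addrK.
Qed.

Lemma res_of_sectorial (T : R -> X -> X) : sectorial_generator T L ->
  exists a th M : R, [/\ 0 < th < pi / 2, sectorial_res a th M (resolvent L),
    forall z x, outside a th z -> resolvent L z x = 0 -> x = 0 &
    forall (r eta t : R) u, 0 < r -> th < eta < pi / 2 -> 0 < t ->
      T t u = contour_sg (resolvent L) a r eta t u].
Proof.
move=> [a [th [th0 sub [M hM] gen]]].
have rz z : outside a th z -> resolvent_set L z by move=> hz; apply/sub/sector_complE.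
have sr : sectorial_res a th `|M| (resolvent L).
  split=> //.
  - move=> z /rz hz c x y; have [d1 e1] := resolventP x hz; have [d2 e2] := resolventP y hz.
    apply/esym/resolvent_uniq => //; first exact: dom_linear.
    by rewrite opfun_linear// e1 e2; vec (R[i]) X; ring.
  - move=> z hz x; have /hM [c [c0 hc]] : sector_compl a th z by apply/sector_complE.
    rewrite Re_norm => hb; apply: le_trans (ler_wpM2l (cn_ge0 _) (hc x)) _.
    rewrite mulrA; apply: ler_wpM2r; first exact: rn_ge0.
    exact: le_trans hb (ler_norm _).
  - move=> z w /rz hz /rz hw x.
    have [d1 e1] := resolventP x hw; have [d2 e2] := resolventP (resolvent L w x) hz.
    apply/eqP; rewrite subr_eq; apply/eqP/esym/resolvent_uniq => //; first exact: dom_linear.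
    by rewrite opfun_linear// e1 e2; vec (R[i]) X; ring.
exists a, th, `|M|; split=> //.
- move=> z x /rz hz h0; have [d1] := resolventP x hz; rewrite h0 scaler0 addr0 => <-.
  have := opfun_linear (-1) (dom_zero L) (dom_zero L).
  by rewrite scaler0 addr0 scaleN1r addNr.
move=> r eta t u r0 eta0 t0; have [v hv ->] := gen r eta r0 eta0 t u t0.
have eta1 : 0 < eta < pi / 2.
  by move: th0 eta0 => /andP[? _] /andP[? ->]; rewrite andbT; lra.
by rewrite (contour_int_uniq r0 eta1 (contour_sg_adm th0 sr (lexx a) r0 eta0 u t0) hv).
Qed.

End Resolvent.

Section Generator.
Context (a th M : R) (RP : C -> X -> X) (T : R -> X -> X).
Hypothesis th0 : 0 < th < pi / 2.
Hypothesis sP : sectorial_res a th M RP.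
Hypothesis RP_inj : forall z x, outside a th z -> RP z x = 0 -> x = 0.
Hypothesis Tgen : forall (r eta t : R) u, 0 < r -> th < eta < pi / 2 -> 0 < t ->
  T t u = contour_sg RP a r eta t u.

Let m : C := (a - 1)%:C.

Let om : outside a th m.
Proof.
have /andP[c0 _] := cos_th th0; rewrite /outside /m.
apply: (@lt_le_trans _ _ 0); last by apply: mulr_ge0 (cn_ge0 _) (ltW c0).
by rewrite /= subr_lt0 gtrBl.
Qed.

Let bR z : outside a th z -> bounded_lin (RP z) (M / cn (z - a%:C)).
Proof. by move=> hz; apply: (sectorial_res_bounded_lin sP). Qed.

Let inv (x : X) : X := xget 0 [set y | RP m y = x].

Let invK y : inv (RP m y) = y.
Proof.
have /= h : RP m (inv (RP m y)) = RP m y by exact: (xgetPex 0 (P := [set v | RP m v = RP m y]) (ex_intro _ y erefl)).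
apply/eqP; rewrite -subr_eq0; apply/eqP/(RP_inj om).
by rewrite (bounded_linB (bR om)) h subrr.
Qed.

Let domP := [set x | exists y, x = RP m y].
Let opP x : X := m *: x + inv x.

Let domP0 : domP 0.
Proof. by exists 0; rewrite (bounded_lin0 (bR om)). Qed.

Let domPL (c : C) x y : domP x -> domP y -> domP (c *: x + y).
Proof. by move=> [x' ->] [y' ->]; exists (c *: x' + y'); rewrite (bR om).1. Qed.

Let opPL (c : C) x y : domP x -> domP y -> opP (c *: x + y) = c *: opP x + opP y.
Proof.
move=> [x' ->] [y' ->]; rewrite /opP -(bR om).1 !invK (bR om).1; vec (R[i]) X; ring.
Qed.

(** The operator whose resolvent is the injective pseudo-resolvent RP; it is
    m + RP(m)^-1 for any m outside of the sector. *)
Definition generator := UnboundedOperator domP0 domPL opPL.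

Let opE z y : outside a th z -> domP (RP z y) /\ opP (RP z y) - z *: RP z y = y.
Proof.
move=> hz; case: (sP) => _ _ _ id; have h := id m z om hz y.
have e : RP z y = RP m (y + (z - m) *: RP z y).
  by rewrite (bounded_linD (bR om)) (bounded_linZ (bR om)) -[RP m y](subrK (RP z y)) h; vec (R[i]) X; ring.
split; first by eexists; exact: e.
by rewrite /opP {2}e invK; vec (R[i]) X; ring.
Qed.

Let opU z x y : outside a th z -> domP x -> opP x - z *: x = y -> x = RP z y.
Proof.
move=> hz [v ex] hy; case: (sP) => _ _ _ id.
have [[v' ex'] hy'] := opE y hz.
have val p w : p = RP m w -> opP p - z *: p = y -> w = y + (z - m) *: p.
  by move=> ep <-; rewrite /opP {2}ep invK; vec (R[i]) X; ring.
have {}hy := val x v ex hy; have {}hy' := val _ v' ex' hy'.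
pose dl := x - RP z y.
have e : dl = (z - m) *: RP m dl.
  rewrite /dl (bounded_linB (bR om)) {1}ex {1}ex' hy hy' !(bounded_linD (bR om)) !(bounded_linZ (bR om)).
  vec (R[i]) X; ring.
have h := id z m hz om dl; rewrite -(bounded_linZ (bR hz)) -e in h.
move/eqP: h; rewrite subr_eq addrC -subr_eq subrr eq_sym => /eqP /(RP_inj om) /eqP.
by rewrite subr_eq0 => /eqP.
Qed.

Let resE z y : outside a th z -> resolvent generator z y = RP z y.
Proof.
move=> hz; have [d1 e1] := opE y hz.
have [h1 h2] : dom generator (resolvent generator z y) /\ opfun generator (resolvent generator z y) - z *: resolvent generator z y = y.
  by exact: (xgetPex 0 (P := [set x | dom generator x /\ opfun generator x - z *: x = y]) (ex_intro _ (RP z y) (conj d1 e1))).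
exact: opU h1 h2.
Qed.

Lemma sectorial_of_res : sectorial_generator T generator.
Proof.
have bE z : outside a th z -> opnorm_le (resolvent generator z) (M / cn (z - a%:C)).
  move=> hz; case: (sP) => M0 _ _ _; split; first by rewrite divr_ge0 ?cn_ge0.
  by move=> x; rewrite resE//; apply: (bR hz).2.
have sr : sectorial_res a th M (resolvent generator).
  case: (sP) => M0 lin bd id; split=> //.
  - by move=> z hz c x y; rewrite !resE//; apply: lin.
  - by move=> z hz x; rewrite resE//; apply: bd.
  - by move=> z w hz hw x; rewrite !resE//; apply: id.
exists a, th; split=> //.
- move=> z /(sector_complE a z th0) hz; split; last by exists (M / cn (z - a%:C)); apply: bE.
  move=> y; exists (RP z y); split; first exact: opE.
  by move=> x [dx hx]; apply/esym/opU.
- exists M => z /(sector_complE a z th0) hz; exists (M / cn (z - a%:C)); first exact: bE.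
  by rewrite Re_norm mulrC divfK// gt_eqF// (outside_neq hz).
move=> r eta r0 eta0 t u t0.
have eta1 : 0 < eta < pi / 2.
  by move: th0 eta0 => /andP[? _] /andP[? ->]; rewrite andbT; lra.
exists (contour_int a r eta (fun z => cexp (- z * t%:C) *: resolvent generator z u)).
  exact: (contour_int_is_contour r0 eta1 (contour_sg_adm th0 sr (lexx a) r0 eta0 u t0)).
rewrite (Tgen u r0 eta0 t0) /contour_sg /contour_factor; congr (_ *: _); apply: contour_int_ext => z hz.
by have [oz _ _] := on_contour_out th0 r0 eta0 (lexx a) hz; rewrite resE.
Qed.

End Generator.
End Generators.

(** * Perturbation in a single space *)

Lemma cont_at_sum {R : realType} {X : normedModType R[i]} (I : Type) (s : seq I)
  (F : I -> R -> X) t : (forall i, cont_at (F i) t) -> cont_at (fun x => \sum_(i <- s) F i x) t.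
Proof.
move=> cF; elim: s => [|i s IH] e e0.
  by exists 1 => // x _; rewrite !big_nil subrr rn0.
by have [dl dl0 h] := cont_atD (cF i) IH e0; exists dl => // x /h; rewrite !big_cons.
Qed.

Section Perturbation.
Context {R : realType}.
Notation C := R[i].
Notation cn := Normc.normc.
Notation mu := (@lebesgue_measure R).
Notation mfun D f := (measurable_fun (D : set (measurableTypeR R)) f).
Context {X : completeNormedModType R[i]}.
Context (n : nat) (S : R -> X -> X) (B : 'I_n -> R -> X -> X) (d : R).
Hypothesis d01 : 0 <= d < 1.
Hypothesis Sb : forall T : R, 0 < T -> exists M : R, forall t : R, 0 < t <= T -> bounded_lin (S t) M.
Hypothesis Sadd : forall (s t : R) u, 0 < s -> 0 < t -> S (s + t) u = S s (S t u).
Hypothesis Sc : forall u (t : R), 0 < t -> cont_at (fun s => S s u) t.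
Hypothesis Bb : forall i (T : R), 0 < T -> exists2 K : R, 0 <= K & forall t : R, 0 < t <= T -> bounded_lin (B i t) (K * t `^ (- d)).
Hypothesis SB : forall i (s t : R) x, 0 < s -> 0 < t -> S s (B i t x) = B i (s + t) x.
Hypothesis Bc : forall i x (t : R), 0 < t -> cont_at (fun s => B i s x) t.

Definition mild (u0 : X) (v : R -> X) : Prop :=
  [/\ strongly_measurable `]0, +oo[ v,
      forall T : R, 0 < T -> exists K : R, forall t : R, 0 < t <= T -> rnorm (v t) <= K &
      forall t : R, 0 < t -> exists I : 'I_n -> X,
        (forall i, is_bochner_integral `]0, t[ (fun s => B i (t - s) (v s)) (I i)) /\
        v t = S t u0 + \sum_i I i].

Lemma kern_consts (T : R) : 0 < T -> exists K : 'I_n -> R, forall i,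
  0 <= K i /\ forall t : R, 0 < t <= T -> bounded_lin (B i t) (K i * t `^ (- d)).
Proof.
move=> T0.
have ex i : exists k : R, 0 <= k /\ forall t : R, 0 < t <= T -> bounded_lin (B i t) (k * t `^ (- d)).
  by have [k k0 hk] := Bb i T0; exists k.
by have [K hK] := boolp.choice ex; exists K.
Qed.

(** One of the two solutions is continuous, and its integrals are those of everywhere
    limits of simple functions; this is what makes the difference estimable, the other
    solution being only strongly measurable. *)
Lemma mild_uniq u0 v q : mild u0 v -> mild u0 q -> (forall t : R, 0 < t -> cont_at q t) ->
  forall t : R, 0 < t -> v t = q t.
Proof.
move=> [_ bv ev] [_ bq eq] cq T T0; have p0 : 0 < (1 - d) / 2 by rewrite divr_gt0// subr_gt0; case/andP: d01.
have [m1 h1] := bv T T0; have [m2 h2] := bq T T0.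
have [K hK] := kern_consts T0.
have dp : 0 <= d + (1 - d) / 2 < 1 by have /andP[? ?] := d01; apply/andP; split; lra.
have N0 : 0 <= \sum_i K i by apply: sumr_ge0 => i _; case: (hK i).
suff : v T - q T = 0 by move/eqP; rewrite subr_eq0 => /eqP.
apply: (volterra_zero (w := fun t => v t - q t) (m := m1 + m2) d01 T0 N0) => [t tT|t c tT c0 hw|]; last by rewrite T0 lexx.
  by apply: le_trans (rnB _ _) (lerD _ _); [exact: h1|exact: h2].
move: (tT) => /andP[t0 tT'].
have [I [hI ->]] := ev t t0; have [J [hJ ->]] := eq t t0.
have -> : S t u0 + \sum_i I i - (S t u0 + \sum_i J i) = \sum_i (I i - J i).
  by rewrite big_split sumrN /= opprD addrACA subrr add0r.
apply: le_trans (rn_sum _ _ _) _; rewrite mulr_suml; apply: ler_sum => i _.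
have [Ki0 bK] := hK i.
have cB : forall s, oitv 0 (Some t) s -> cont_at (fun y => B i (t - y) (q y)) s.
  by move=> s hs; apply: (conv_cont_at d01 (Bb i) (Bc i)) => //; apply: cq; case/oitvP: hs.
have := is_bochner_lin (-1) (measurable_oitv 0 (Some t)) (hI i) (hJ i) (cont_simple_limit cB).
rewrite scaleN1r addrC => bI.
have mg : mfun (oitv 0 (Some t)) (fun s : R => K i * c * (t - s) `^ (- (d + (1 - d) / 2))).
  apply: measurable_funTS; apply: measurable_funM => //.
  by apply: (measurableT_comp (measurable_powR _)); apply: measurable_funB.
have hg s : oitv 0 (Some t) s -> rnorm (-1 *: B i (t - s) (q s) + B i (t - s) (v s)) <=
    K i * c * (t - s) `^ (- (d + (1 - d) / 2)).
  move=> hs; move: (hs) => /oitvP [s0 /= st].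
  have bB : bounded_lin (B i (t - s)) (K i * (t - s) `^ (- d)) by apply: bK; apply/andP; split; lra.
  rewrite scaleN1r addrC -(bounded_linB bB); apply: le_trans (bB.2 _) _.
  rewrite -!mulrA; apply: ler_wpM2l => //; rewrite mulrC; exact: hw.
have := is_bochner_norm_le (measurable_oitv 0 (Some t)) bI mg hg.
move=> /le_trans /(_ (pow_bound_right (mulr_ge0 Ki0 c0) dp t0)).
rewrite lee_fin subr0; have -> : 1 - (d + (1 - d) / 2) = (1 - d) / 2 by lra.
by rewrite -!mulrA.
Qed.

(** The perturbed resolvent, and the fact that its Dunford integral solves the mild
    equation; together with uniqueness this determines the perturbed family. *)
Lemma perturbation : analytic_semigroup S ->
  exists (a th M : R) (RP : C -> X -> X), [/\ 0 < th < pi / 2, sectorial_res a th M RP,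
    forall z x, outside a th z -> RP z x = 0 -> x = 0 &
    forall (r eta : R) u, 0 < r -> th < eta < pi / 2 ->
      mild u (fun t => contour_sg RP a r eta t u) /\ (forall t : R, 0 < t -> cont_at (fun t => contour_sg RP a r eta t u) t)].
Proof.
move=> [L /res_of_sectorial [a [th [M [th0 sr Rinj Sgen]]]]].
set Rv := resolvent L in sr Rinj Sgen.
pose BB t x := \sum_i B i t x.
have BBb : forall T : R, 0 < T -> exists2 K : R, 0 <= K & forall t : R, 0 < t <= T -> bounded_lin (BB t) (K * t `^ (- d)).
  move=> T T0.
  have [K hK] := kern_consts T0.
  exists (\sum_i K i); first by apply: sumr_ge0 => i _; case: (hK i).
  move=> t tT; split=> [c x y|x].
    by rewrite /BB scaler_sumr -big_split; apply: eq_bigr => i _; rewrite ((hK i).2 t tT).1.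
  apply: le_trans (rn_sum _ _ _) _; rewrite !mulr_suml; apply: ler_sum => i _.
  exact: ((hK i).2 t tT).2.
have SBB s t x : 0 < s -> 0 < t -> S s (BB t x) = BB (s + t) x.
  move=> s0 t0; have [m hm] := Sb s0; have bS : bounded_lin (S s) m by apply: hm; rewrite s0 lexx.
  by rewrite /BB (bounded_lin_sum bS); apply: eq_bigr => i _; apply: SB.
have BBc x t : 0 < t -> cont_at (fun s => BB s x) t.
  by move=> t0; apply: cont_at_sum => i; apply: Bc.
have [l0 hl0] := laplace_dom_ex Sb.
(* the base point of the continuation *)
pose m0 := Num.min l0 (a - 1).
have km la : la <= m0 -> laplace_dom S la by rewrite le_min => /andP[/hl0].
have ma : m0 < a by rewrite gt_min; apply/orP; right; rewrite gtrBl.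
pose KKf := laplace_ext S BB Rv m0.
have Kid := laplace_ext_id S BB sr m0.
have Ksm := laplace_ext_small d01 Sb Sadd BBb SBB BBc th0 sr Sgen km ma.
have SKK : forall e : R, 0 < e -> exists2 dl : R, 0 < dl & forall s : R, 0 < s < dl ->
  exists2 D : X -> X, (forall x, rnorm (D x) <= e * rnorm x) &
    forall z x, outside a th z -> S s (KKf z x) - KKf z x = D x + (z - m0%:C) *: Rv z (D x).
  move=> e e0; have [dl dl0 hdl] := semigroup_laplace_lim d01 Sb Sadd BBb SBB BBc (km m0 (lexx _)) e0.
  exists dl => // s sd; exists (fun x => S s (laplace S BB m0 x) - laplace S BB m0 x); first exact: hdl.
  by move=> z x hz; apply: (laplace_ext_S BB Sb th0 sr Sgen m0 x hz); case/andP: sd.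
have [b ba half] := vertex_ex th0 Ksm.
have sP := perturbed_res_sectorial th0 sr Kid ba half.
have Pinj z x : outside b th z -> perturbed_res Rv KKf z x = 0 -> x = 0.
  move=> hz; apply: (perturbed_res_inj half _ hz) => y; apply: Rinj.
  by case: (outside_dist ba th0 hz).
pose mu := Num.min m0 (b - 1).
have omu : outside b th mu%:C by apply: (outside_real th0); rewrite gt_min gtrBl ltr01 orbT.
have mum : mu <= m0 by rewrite ge_min lexx.
have SKd x t : 0 < t -> deriv_at (fun s => S s (KKf mu%:C x)) t (- (mu%:C *: S t (KKf mu%:C x)) - BB t x).
  rewrite /KKf (laplace_ext_real d01 Sb Sadd BBb SBB BBc th0 sr Sgen km ma x mum) => t0.
  exact: (semigroup_laplace_deriv_at d01 Sb Sadd BBb SBB BBc x (km mu mum) t0).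
exists b, th, (2 * (M / (1 - cos th))), (perturbed_res Rv KKf); split=> // r eta u r0 eta0.
have qc (t : R) : 0 < t -> cont_at (fun s => contour_sg (perturbed_res Rv KKf) b r eta s u) t.
  by move=> t0; exact: (contour_cont_at th0 sP mu%:C r0 eta0 u t0).
have qb := contour_bound Sb th0 sr Sgen Ksm ba sP (perturbed_resE Rv half) r0 eta0 u.
split=> //; split.
- have [s [hs cs]] : simple_limit `]0, +oo[ (fun t => contour_sg (perturbed_res Rv KKf) b r eta t u).
    by apply: (cont_simple_limit (D := oitv 0 None)) => t /oitvP [t0 _]; apply: qc.
  by exists s; split=> //; apply: aeW => t; apply: cs.
- by move=> T /qb [k _ hk]; exists k.
move=> t t0; have [k _ hk] := qb t t0.
have ci i : cont_integrable (oitv 0 (Some t)) (fun s => B i (t - s) (contour_sg (perturbed_res Rv KKf) b r eta s u)).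
  apply: (conv_cont_integrable d01 (Bb i) (Bc i) (m := k) t0) => x /oitvP [x0 /= xt]; first exact: qc.
  by apply: hk; rewrite x0 ltW.
exists (fun i => bochner (oitv 0 (Some t)) (fun s => B i (t - s) (contour_sg (perturbed_res Rv KKf) b r eta s u))).
split; first by move=> i; apply: (bochnerP (measurable_oitv _ _) (ci i)).
rewrite (mild_contour d01 Sb Sadd Sc BBb BBc th0 sr Sgen Ksm SKK ba sP (perturbed_resE Rv half) omu SKd r0 eta0 u t0).
by rewrite /BB (cont_integrable_sum _ (measurable_oitv _ _) ci).2.
Qed.

End Perturbation.

(** * Perturbation in a scale of spaces *)

Section ScaleFacts.
Context (R : realType) (J : Type) (X : J -> completeNormedModType R[i]).
Context (V : lmodType R[i]) (iota : forall g : J, {linear X g -> V}).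
Context (reg : J -> R) (S : forall g : J, R -> {linear X g -> X g}).
Hypothesis iota_inj : forall g : J, injective (iota g).
Hypothesis S_consistent : consistent_operators iota S.
Hypothesis S_semigroup : semigroup_in_scale iota reg S.

Lemma recastP (g g' : J) (x : X g) : (exists y, iota g' y = iota g x) ->
  iota g' (recast iota g' x) = iota g x.
Proof. by move=> [y hy]; exact: (xgetPex 0 (P := [set y | iota g' y = iota g x]) (ex_intro _ y hy)). Qed.

Lemma S_betweenP (g g' : J) (t : R) (u : X g) : smoothing iota reg S g g' -> 0 < t ->
  iota g' (S_between iota S g' t u) = iota g (S g t u).
Proof.
move=> [_ [M [_ h]]] t0; apply: recastP.
by have [|ex _] := h t t; [rewrite t0 lexx|apply: ex].
Qed.

Lemma S_between_self (g : J) (t : R) (u : X g) : S_between iota S g t u = S g t u.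
Proof. by apply: (@iota_inj g); apply: recastP; exists (S g t u). Qed.

Lemma dist_self g : dist reg g g = 0. Proof. exact: subrr. Qed.

Lemma scale_bound g (T : R) : 0 < T -> exists M : R, forall t : R, 0 < t <= T -> bounded_lin (S g t) M.
Proof.
move=> T0; have [_ _ [[_ [M [_ h]]] _]] := S_semigroup g.
exists (M T) => t tT; have [_ [_ bd]] := h T t tT.
split=> [c x y|x]; first by rewrite linearP.
by have := bd x; rewrite S_between_self dist_self oppr0 powRr0 mulr1.
Qed.

Lemma scale_cont g u (t : R) : 0 < t -> cont_at (fun s => S g s u) t.
Proof.
move=> t0; have [_ _ [_ /(_ u t t0) h]] := S_semigroup g; apply/cont_atP.
suff -> : (fun s => S g s u) = (fun s => S_between iota S g s u) by [].
by apply: funext => s; rewrite S_between_self.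
Qed.

Section Kernel.
Context (g g' : J) (rho d : R) (P : {linear X g' -> X g}).
Hypothesis pc : perturbation_class iota reg S rho P.
Hypothesis dd : dist reg g' g <= d.

Let B t x := S_between iota S g' t (P x).

Let sm : smoothing iota reg S g g'. Proof. by case: pc => _ []. Qed.

(** The singularity of the kernel is measured by the regularity gap between the two
    spaces; a larger exponent is allowed, so that all perturbations share one. *)
Lemma kernel_bound (T : R) : 0 < T -> exists2 K : R, 0 <= K &
  forall t : R, 0 < t <= T -> bounded_lin (B t) (K * t `^ (- d)).
Proof.
move=> T0; have [_ _ [rho0 hP]] := pc; have [_ [M [_ h]]] := sm.
set e := dist reg g' g in h; have de : e <= d by [].
exists (`|M T| * T `^ (d - e) * rho); first by rewrite !mulr_ge0 ?powR_ge0.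
move=> t tT; have [_ [_ bd]] := h T t tT; move: (tT) => /andP[t0 tT'].
split=> [c x y|x].
  apply: (@iota_inj g'); rewrite linearP !(S_betweenP _ sm t0) -linearP.
  by congr (iota g _); rewrite -linearP; congr (S g t _); rewrite linearP.
apply: le_trans (bd (P x)) _.
have e1 : t `^ (- e) = t `^ (d - e) * t `^ (- d).
  by rewrite -powRD ?(gt_eqF t0) ?implybT//; congr (_ `^ _); ring.
have h1 : t `^ (d - e) <= T `^ (d - e).
  by apply: ge0_ler_powR; rewrite ?nnegrE ?(ltW t0) ?(ltW T0)// subr_ge0.
apply: (@le_trans _ _ ((`|M T| * t `^ (- e)) * (rho * rnorm x))).
  apply: (@le_trans _ _ ((`|M T| * t `^ (- e)) * rnorm (P x))).
    by apply: ler_wpM2r (rn_ge0 _) _ _ _; apply: ler_wpM2r (powR_ge0 _ _) _ _ (ler_norm _).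
  by apply: ler_wpM2l (hP x); rewrite mulr_ge0 ?powR_ge0.
have -> : `|M T| * T `^ (d - e) * rho * t `^ (- d) * rnorm x =
  (`|M T| * (T `^ (d - e) * t `^ (- d))) * (rho * rnorm x) by ring.
apply: ler_wpM2r; first by rewrite mulr_ge0 ?rn_ge0.
by apply: ler_wpM2l => //; rewrite e1; apply: ler_wpM2r h1; exact: powR_ge0.
Qed.

Lemma kernel_cont x (t : R) : 0 < t -> cont_at (fun s => B s x) t.
Proof. by move=> t0; apply/cont_atP; case: pc => _ [_ h] _; apply: h. Qed.

Lemma kernel_semigroup (s t : R) x : 0 < s -> 0 < t -> S g' s (B t x) = B (s + t) x.
Proof.
move=> s0 t0; apply: (@iota_inj g').
rewrite (S_betweenP _ sm (addr_gt0 s0 t0)).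
have [_ sg _] := S_semigroup g; rewrite (sg s t _ (ltW s0) (ltW t0)).
exact: (S_consistent (ltW s0) (S_betweenP _ sm t0)).
Qed.

End Kernel.

(** The weight in the growth condition is trivial for initial values in the space
    itself. *)
Lemma mild_solutionP (alpha : J) (n : nat) (beta : 'I_n -> J)
    (P : forall i : 'I_n, {linear X alpha -> X (beta i)}) (u0 : X alpha) (v : R -> X alpha) :
  mild_solution iota reg S P u0 v <->
  mild (fun t => S alpha t) (fun i t x => S_between iota S alpha t (P i x)) u0 v.
Proof.
split=> [[[sm bd] eq]|[sm bd eq]].
  split=> // [T /bd [K hK]|t t0].
    by exists K => t /hK; rewrite dist_self powRr0 mul1r.
  by have [I [hI ->]] := eq t t0; exists I; rewrite S_between_self.
split=> [|t t0]; last by have [I [hI ->]] := eq t t0; exists I; rewrite S_between_self.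
split=> // T /bd [K hK].
by exists K => t /hK; rewrite dist_self powRr0 mul1r.
Qed.

End ScaleFacts.

Theorem theorem6p21 (R : realType) (J : Type)
    (X : J -> completeNormedModType R[i])
    (V : lmodType R[i]) (iota : forall g : J, {linear X g -> V})
    (reg : J -> R) (S : forall g : J, R -> {linear X g -> X g})
    (iota_inj : forall g : J, injective (iota g))
    (X_consistent : topologically_consistent iota)
    (S_consistent : consistent_operators iota S)
    (alpha : J)
    (S_semigroup : semigroup_in_scale iota reg S)
    (n : nat) (n_gt0 : (0 < n)%N) (beta : 'I_n -> J)
    (rho : R) (rho_gt0 : 0 < rho)
    (P : forall i : 'I_n, {linear X alpha -> X (beta i)})
    (P_class : forall i : 'I_n,
       perturbation_class iota reg S rho (P i)) :
  analytic_semigroup (S alpha) ->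
  analytic_semigroup (perturbed iota reg S P).
Proof.
move=> an.
pose d := \big[Num.max/0]_(i < n) dist reg alpha (beta i).
have d01 : 0 <= d < 1.
  apply/andP; split; first exact: bigmax_ge_id.
  by apply/bigmax_ltP; split=> // i _; have [/andP[]] := P_class i.
have dd i : dist reg alpha (beta i) <= d by exact: le_bigmax.
have Sadd (s t : R) u : 0 < s -> 0 < t -> S alpha (s + t) u = S alpha s (S alpha t u).
  by move=> s0 t0; have [_ sg _] := S_semigroup alpha; apply: sg; exact: ltW.
have Bb i := kernel_bound iota_inj (P_class i) (dd i).
have SB i := kernel_semigroup iota_inj S_consistent S_semigroup (P_class i).
have Bc i := kernel_cont (P_class i).
have Sb := scale_bound iota_inj S_semigroup alpha.
have Sc (u : X alpha) := scale_cont iota_inj S_semigroup u.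
have [a [th [M [RP [th0 sP Pinj ex]]]]] := perturbation d01 Sb Sadd Sc Bb SB Bc an.
exists (generator th0 sP Pinj); apply: sectorial_of_res => r eta t u r0 eta0 t0.
have [hq qc] := ex r eta u r0 eta0.
rewrite /perturbed (gt_eqF t0).
have hx := xgetPex (fun=> 0) (P := [set v | mild_solution iota reg S P u v])
  (ex_intro _ _ ((mild_solutionP reg S iota_inj P u _).2 hq)).
exact: (mild_uniq d01 Bb Bc ((mild_solutionP reg S iota_inj P u _).1 hx) hq qc t0).
Qed.
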